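(* Let $\mathcal{X}$ and $\mathcal{Y}$ be locally finite countably generated coarse spaces, each with at most countably many coarsely connected components, and let $\Phi\colon \mathcal{A}(\mathcal{X})\to\mathcal{A}(\mathcal{Y})$ be a full and faithful $*$-functor. Then $\Phi$ induces a coarse embedding $f^{\Phi}\colon\mathcal{X}\to\mathcal{Y}$. That is, there is a coarse embedding $f^\Phi\colon\mathcal X\to\mathcal Y$ such that for every faithful $\mathcal{X}$-module $C$ in $\mathcal{A}(\mathcal{X})$, every unitary $U\colon H_C\to H_{\Phi(C)}$ with $\Phi(t)=UtU^*$ for all $t\in\operatorname{End}_{\mathcal{A}(\mathcal{X})}(C)$, every $\delta\in(0,1)$ and all sufficiently large entourages $F\in\mathcal{E}^Y$, $E\in\mathcal{E}^X$, the approximate relation $f^{U}_{\delta,F,E}\subset Y\times X$ is asymptotically equivalent to the graph $\{(f^{\Phi}(x),x)\mid x\in X\}$.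
   Context: Coarse spaces. A coarse structure on a set $X$ is a family $\mathcal{E}^X$ of subsets of $X\times X$ (entourages) containing the diagonal and closed under subsets, finite unions, transposes and compositions $F\circ E=\{(z,x)\mid\exists y:(z,y)\in F,(y,x)\in E\}$. It is countably generated if it is the smallest coarse structure containing some countable family of subsets. $A\subset X$ is $E$-bounded if $A\times A\subset E$, and bounded if it is $E$-bounded for some $E\in\mathcal{E}^X$. Coarsely connected components are the classes of the relation $\{(x,y)\}\in\mathcal{E}^X$. $E[A]=\{x\mid\exists a\in A:(x,a)\in E\}$; $A\prec B$ means $A\subset E[B]$ for some $E\in\mathcal{E}^X$; $A\asymp B$ (asymptotically equivalent) means $A\prec B$ and $B\prec A$. $Y\times X$ carries the product coarse structure generated by $\mathcal{E}^Y\times\mathcal{E}^X$. A coarse space is locally finite if all its bounded subsets are finite. Maps. $f\colon X\to Y$ is coarse if $(f\times f)(E)\in\mathcal{E}^Y$ for all $E\in\mathcal{E}^X$; coarse maps $f,g$ are close ($f\sim g$) if $(f\times g)(E)\in\mathcal{E}^Y$ for all $E\in\mathcal{E}^X$; $f$ is a coarse equivalence if there is a coarse map $g$ with $f\circ g\sim\mathrm{id}$ and $g\circ f\sim\mathrm{id}$; $f$ is a coarse embedding if it is a coarse equivalence onto its image with the induced coarse structure. Modules. For a locally finite coarse space $\mathcal{X}=(X,\mathcal{E}^X)$, a coarse $\mathcal{X}$-module $C$ is a Hilbert space $H_C$ with a (unital) representation $A\mapsto\mathbb{1}_A^C$ of the Boolean algebra $\mathcal{P}(X)$ by projections on $H_C$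 such that for some gauge (symmetric entourage containing the diagonal) $E$ the span of $\{\mathbb{1}^C_AH_C\mid A\ E\text{-bounded}\}$ is dense; equivalently $\sum_{x\in X}\mathbb{1}^C_{\{x\}}=1$ strongly. Its rank is the Hilbert dimension of $H_C$. $C$ is faithful if $\{x\in X\mid\mathbb{1}^C_{\{x\}}\ne0\}\asymp X$. The support of a bounded operator $t\colon H_C\to H_D$ between $\mathcal{X}$-modules is $\{(y,x)\mid\mathbb{1}^D_{\{y\}}t\mathbb{1}^C_{\{x\}}\neq0\}$; $t$ has controlled propagation if its support is an entourage; $t$ is approximable if it is a norm limit of controlled propagation operators. Categories. For an infinite cardinal $\kappa$, $\mathcal{A}_\kappa(\mathcal{X})$ is the $C^*$-category of coarse $\mathcal{X}$-modules of rank at most $\kappa$ with approximable operators as morphisms; $\mathcal{A}_\infty(\mathcal{X})$ is the same without rank restriction. $\mathcal{A}(\cdot)$ denotes either $\mathcal{A}_\kappa(\cdot)$ for one fixed infinite $\kappa$, or $\mathcal{A}_\infty(\cdot)$, the same choice for $\mathcal{X}$ and $\mathcal{Y}$. $*$-functors are $\mathbb{C}$-linear on morphisms and preserve adjoints. Approximate relations. For a bounded operator $T\colon H_{C_X}\to H_{C_Y}$ between an $\mathcal X$-module and a $\mathcal Y$-module, $f^T_{\delta,F,E}=\bigcup\{B\times A\mid B\subset Y\ F\text{-bounded},\ A\subset X\ E\text{-bounded},\ \|\mathbb{1}_B^{C_Y}T\mathbb{1}_A^{C_X}\|>\delta\}$. ''For all sufficiently large $F,E$'' means: there are $F_0\in\mathcal{E}^Y,E_0\in\mathcal{E}^X$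 such that the assertion holds whenever $F\supset F_0$, $E\supset E_0$. It is known that every $*$-isomorphism $\operatorname{End}_{\mathcal{A}(\mathcal{X})}(C)\to\operatorname{End}_{\mathcal{A}(\mathcal{Y})}(\Phi(C))$ is of the form $\operatorname{Ad}_U$ for a unitary $U\colon H_C\to H_{\Phi(C)}$. *)

(* Defs.v *)
From HB Require Import structures.
From mathcomp Require Import all_boot all_order all_algebra.
From mathcomp Require Import sesquilinear.
From mathcomp Require Import all_classical all_reals all_analysis.
From mathcomp Require Import complex.

Set Implicit Arguments.
Unset Strict Implicit.
Unset Printing Implicit Defensive.

Import Order.TTheory GRing.Theory Num.Theory.
Import numFieldNormedType.Exports.

Local Open Scope classical_set_scope.
Local Open Scope ring_scope.

(* Finite unions: the empty one is covered by the diagonal and subsets. *)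
Record coarse_structure (X : Type) (S : set (set (X * X))) : Prop := {
  coarse_diag : S diagonal;
  coarse_sub : forall E F, E `<=` F -> S F -> S E;
  coarse_setU : forall E F, S E -> S F -> S (E `|` F);
  coarse_inv : forall E, S E -> S (E^-1)%relation;
  coarse_comp : forall E F, S E -> S F -> S (E \; F)%relation }.

Record coarseSpace := CoarseSpace {
  coarse_pt :> Type;
  ent : set (set (coarse_pt * coarse_pt));
  entP : coarse_structure ent }.

Arguments ent : clear implicits.

Lemma coarse_structure_smallest (X : Type) (G : set (set (X * X))) :
  coarse_structure (smallest (@coarse_structure X) G).
Proof.
split.
- by move=> S [cS _]; exact: coarse_diag cS.
- by move=> E F EF SF S hS; apply: coarse_sub EF (SF _ hS); case: hS.
- by move=> E F SE SF S hS; apply: coarse_setU (SE _ hS) (SF _ hS); case: hS.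
- by move=> E SE S hS; apply: coarse_inv (SE _ hS); case: hS.
- by move=> E F SE SF S hS; apply: coarse_comp (SE _ hS) (SF _ hS); case: hS.
Qed.

Definition countably_generated (X : coarseSpace) : Prop :=
  exists2 G : set (set (X * X)), countable G &
    ent X = smallest (@coarse_structure X) G.

Definition rel_bounded (X : Type) (E : set (X * X)) (A : set X) : Prop :=
  A `*` A `<=` E.

Definition coarse_bounded (X : coarseSpace) (A : set X) : Prop :=
  exists2 E, ent X E & rel_bounded E A.

Definition locally_finite (X : coarseSpace) : Prop :=
  forall A : set X, coarse_bounded A -> finite_set A.

Definition coarse_components (X : coarseSpace) : set (set X) :=
  range (fun x : X => [set y | ent X [set (x, y)]]).

Arguments coarse_components : clear implicits.

Definition thicken (X : Type) (E : set (X * X)) (A : set X) : set X :=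
  [set x | exists2 a, A a & E (x, a)].

Definition asymp_sub (X : coarseSpace) (A B : set X) : Prop :=
  exists2 E, ent X E & A `<=` thicken E B.

Definition asymp_eq (X : coarseSpace) (A B : set X) : Prop :=
  asymp_sub A B /\ asymp_sub B A.

(* F x E, seen as a relation on Y x X. *)
Definition prod_rel (Y X : Type) (F : set (Y * Y)) (E : set (X * X)) :
    set ((Y * X) * (Y * X)) :=
  [set p | F (p.1.1, p.2.1) /\ E (p.1.2, p.2.2)].

Definition prod_coarse (Y X : coarseSpace) : coarseSpace :=
  @CoarseSpace (Y * X)%type _ (@coarse_structure_smallest (Y * X)
    [set prod_rel F E | F in ent Y & E in ent X]).

Definition pair_image (X Y : Type) (f g : X -> Y) (E : set (X * X)) :
    set (Y * Y) :=
  [set (f p.1, g p.2) | p in E].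

Definition coarse_map (X Y : coarseSpace) (f : X -> Y) : Prop :=
  forall E, ent X E -> ent Y (pair_image f f E).

Definition close_maps (X Y : coarseSpace) (f g : X -> Y) : Prop :=
  forall E, ent X E -> ent Y (pair_image f g E).

Definition coarse_equivalence (X Y : coarseSpace) (f : X -> Y) : Prop :=
  coarse_map f /\
  exists g : Y -> X,
    [/\ coarse_map g, close_maps (f \o g) id & close_maps (g \o f) id].

Definition induced_ent (Y : coarseSpace) (A : set Y) :
    set (set ({y | A y} * {y | A y})) :=
  [set E | ent Y (pair_image sval sval E)].

Lemma coarse_structure_induced (Y : coarseSpace) (A : set Y) :
  coarse_structure (@induced_ent Y A).
Proof.
have [dY sY uY iY cY] := entP Y; split; rewrite /induced_ent /=.
- by apply: sY dY => _ [[a b] /diagonalP -> <-].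
- by move=> E F EF; apply: sY => _ [p /EF Fp <-]; exists p.
- move=> E F hE hF; apply: sY (uY _ _ hE hF) => _ [p [Ep|Fp] <-].
    by left; exists p.
  by right; exists p.
- move=> E hE; apply: sY (iY _ hE) => _ [[a b] /= Eba <-].
  by exists (b, a).
- move=> E F hE hF; apply: sY (cY _ _ hE hF) => _ [[a b] /= [z Faz Ezb] <-].
  by exists (sval z); [exists (a, z)|exists (z, b)].
Qed.

Definition sub_coarse (Y : coarseSpace) (A : set Y) : coarseSpace :=
  CoarseSpace (@coarse_structure_induced Y A).

Definition to_image (X Y : Type) (f : X -> Y) (x : X) : {y | range f y} :=
  exist _ (f x) (imageT f x).

Definition coarse_embedding (X Y : coarseSpace) (f : X -> Y) : Prop :=
  @coarse_equivalence X (sub_coarse (range f)) (to_image f).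

(* Following sesquilinear, the inner product is linear in its first argument. *)
HB.mixin Record NormedModule_isHilbert (C : numClosedFieldType) H
    of CompleteNormedModule C H := {
  inner : {dot H for (@Num.conj C)};
  inner_norm : forall x : H, `|x| ^+ 2 = inner x x }.

#[short(type="hilbertType")]
HB.structure Definition Hilbert (C : numClosedFieldType) :=
  {H of CompleteNormedModule C H & NormedModule_isHilbert C H}.

Section Operators.
Context {C : numClosedFieldType}.

Definition lin_span (V : lmodType C) (S : set V) : set V :=
  [set v | exists n (c : 'I_n -> C) (s : 'I_n -> V),
     (forall i, S (s i)) /\ v = \sum_(i < n) c i *: s i].

Record bounded_op (H K : hilbertType C) := BoundedOp {
  bounded_op_fun :> {linear H -> K};
  bounded_opP : bounded_near bounded_op_fun (nbhs (0 : H)) }.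

Definition is_adjoint (H K : hilbertType C) (t : H -> K) (s : K -> H) : Prop :=
  forall (x : H) (y : K), inner (t x) y = inner x (s y).

Definition is_projection (H : hilbertType C) (p : H -> H) : Prop :=
  is_adjoint p p /\ p \o p =1 p.

Definition unitary_op (H K : hilbertType C) (u : H -> K) : Prop :=
  exists v : bounded_op K H, [/\ is_adjoint u v, cancel u v & cancel v u].

Definition orthonormal_basis (H : hilbertType C) (B : set H) : Prop :=
  (forall u v, B u -> B v -> inner u v = (u == v)%:R) /\ dense (lin_span B).

End Operators.

(* Norms on normed modules over R[i] have values in R[i], hence the real part. *)
Definition op_norm (R : realType) (H K : hilbertType R[i]) (t : H -> K) : R :=
  sup [set complex.Re `|t x| | x in [set x : H | `|x| <= 1]].

Definition gauge (X : coarseSpace) (E : set (X * X)) : Prop :=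
  [/\ ent X E, diagonal `<=` E & (E^-1)%relation = E].

(* [ind C A] is the projection 1_A^C; the Boolean operations on commuting     *)
(* projections are p /\ q = pq, p \/ q = p + q - pq and ~ p = 1 - p.          *)
Record coarse_module (R : realType) (X : coarseSpace) := CoarseModule {
  mod_space :> hilbertType R[i];
  ind : set X -> bounded_op mod_space mod_space;
  ind_projection : forall A, is_projection (ind A);
  ind0 : forall v, ind set0 v = 0;
  indT : forall v, ind setT v = v;
  indI : forall A B v, ind (A `&` B) v = ind A (ind B v);
  indU : forall A B v,
    ind (A `|` B) v = ind A v + ind B v - ind A (ind B v);
  indC : forall A v, ind (~` A) v = v - ind A v;
  ind_dense : exists2 E, gauge E &
    dense (lin_span (\bigcup_(A in [set A | rel_bounded E A]) range (ind A))) }.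

Definition faithful_module (R : realType) (X : coarseSpace)
    (C : coarse_module R X) : Prop :=
  asymp_eq [set x : X | exists v, ind C [set x] v != 0] setT.

Definition op_support (R : realType) (X : coarseSpace) (C D : coarse_module R X)
    (t : C -> D) : set (X * X) :=
  [set yx | exists v, ind D [set yx.1] (t (ind C [set yx.2] v)) != 0].

Definition controlled_propagation (R : realType) (X : coarseSpace)
    (C D : coarse_module R X) (t : C -> D) : Prop :=
  ent X (op_support t).

Definition approximable (R : realType) (X : coarseSpace)
    (C D : coarse_module R X) (t : bounded_op C D) : Prop :=
  forall e : R, 0 < e -> exists2 s : bounded_op C D,
    controlled_propagation s & op_norm (t \- s) < e.

Definition approx_relation (R : realType) (X Y : coarseSpace)
    (C : coarse_module R X) (D : coarse_module R Y) (T : C -> D)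
    (delta : R) (F : set (Y * Y)) (E : set (X * X)) : set (Y * X) :=
  \bigcup_(BA in [set BA : set Y * set X |
      [/\ rel_bounded F BA.1, rel_bounded E BA.2 &
          delta < op_norm (ind D BA.1 \o T \o ind C BA.2)]])
    (BA.1 `*` BA.2).

(* An infinite cardinal is given by an infinite type of that cardinality. *)
Inductive rank_bound :=
  | RankAtMost (K : Type) of infinite_set [set: K]
  | RankUnrestricted.

Definition satisfies_rank (R : realType) (k : rank_bound) (X : coarseSpace)
    (C : coarse_module R X) : Prop :=
  match k with
  | @RankAtMost K _ =>
      exists2 B : set C, orthonormal_basis B & (B #<= [set: K])%card
  | RankUnrestricted => True
  end.

Record Aobj (R : realType) (k : rank_bound) (X : coarseSpace) := AObj {
  Aobj_module :> coarse_module R X;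
  Aobj_rank : satisfies_rank k Aobj_module }.

Record Amor (R : realType) (X : coarseSpace) (C D : coarse_module R X) := AMor {
  Amor_op :> bounded_op C D;
  Amor_approximable : approximable Amor_op }.

(* Identities, composites, linear combinations and adjoints of approximable   *)
(* operators are again approximable; each clause refers to the corresponding  *)
(* morphism through its underlying operator.                                  *)
Record star_functor (R : realType) (k : rank_bound) (X Y : coarseSpace) := {
  fobj :> Aobj R k X -> Aobj R k Y;
  fmor : forall C D : Aobj R k X, Amor C D -> Amor (fobj C) (fobj D);
  fmor_id : forall (C : Aobj R k X) (i : Amor C C),
    i =1 id -> fmor i =1 id;
  fmor_comp : forall (C D B : Aobj R k X)
      (s : Amor D B) (t : Amor C D) (st : Amor C B),
    st =1 s \o t -> fmor st =1 fmor s \o fmor t;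
  fmor_linear : forall (C D : Aobj R k X) (a : R[i]) (s t u : Amor C D),
    (forall v, u v = a *: s v + t v) ->
    forall v, fmor u v = a *: fmor s v + fmor t v;
  fmor_adjoint : forall (C D : Aobj R k X) (t : Amor C D) (s : Amor D C),
    is_adjoint t s -> is_adjoint (fmor t) (fmor s) }.

Definition full_functor (R : realType) (k : rank_bound) (X Y : coarseSpace)
    (Phi : star_functor R k X Y) : Prop :=
  forall (C D : Aobj R k X) (s : Amor (Phi C) (Phi D)),
    exists t : Amor C D, fmor Phi t =1 s.

Definition faithful_functor (R : realType) (k : rank_bound) (X Y : coarseSpace)
    (Phi : star_functor R k X Y) : Prop :=
  forall (C D : Aobj R k X) (t s : Amor C D),
    fmor Phi t =1 fmor Phi s -> t =1 s.

(* Main.v *)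
(* A full and faithful Phi maps the rank one projection onto a unit vector e_x
   supported at x to a projection fixing a unit vector xi_x, and it transports
   each v in the coarse component of x to W_x v = Phi(<-, e_x> v) xi_x,
   an isometric image of v.

   Let t_y be the preimage of 1_{y}. If the vectors t_y e_x were not
   concentrated near x, uniformly in x, then a gliding hump with greedily chosen
   signs s_y would produce a preimage of the diagonal operator sum_y s_y 1_{y}
   which is not approximable, contradicting fullness. Hence most of the mass of
   xi_x sits at points y for which the normalised 1_{y} xi_x is almost W_x v
   with v a unit vector supported near x. If two such points y, y' for one x
   were not uniformly close, infinitely many pairs could be selected over
   disjoint subsets of X, and the sum of the rank one operators exchanging the
   corresponding vectors v would be an approximable partial isometry whose
   image under Phi is not approximable. So xi_x is concentrated on a uniformly
   bounded set, in which f(x) is chosen.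

   The same selection of disjoint pairs, applied on the X side and, using
   fullness, on the Y side, shows that f is coarse and expanding, and that
   1_B U 1_A can only have large norm near the graph of f. The multiplicity of
   C at a point may be infinite; there the offending vectors are first made
   orthogonal by Gram-Schmidt. *)

From HB Require Import structures.
Require Import Defs.
From mathcomp Require Import all_boot all_order all_algebra.
From mathcomp Require Import all_classical all_reals all_analysis.
From mathcomp Require Import complex.
From mathcomp Require Import ring lra.

Set Implicit Arguments.
Unset Strict Implicit.
Unset Printing Implicit Defensive.

Import Order.TTheory GRing.Theory Num.Theory.
Import numFieldNormedType.Exports.

Local Open Scope classical_set_scope.
Local Open Scope ring_scope.

(** * Norms and inner products *)

Section RealNorm.
Context {R : realType}.
Implicit Types (V : normedZmodType R[i]) (z w : R[i]).

(** A nonzero rank one operator between vectors of different components is not approximable, so a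
    single unitary is replaced by the maps [W x], one per component. They act on all modules at
    once; this lets [f], built from one auxiliary module, be compared with the unitary [U] of every
    [C]. The auxiliary module must live at every point and respect any infinite rank bound: [X] is
    countable, and square summable sequences labelled by an enumeration of [X] will do.
    Approximability is always refuted through quasilocality: blocks between sets that are far apart
    are uniformly small. Disjoint footprints make the selected vectors orthonormal, so an infinite
    sum of rank one operators is a partial isometry, and its image is a contraction for algebraic
    reasons. Local finiteness supplies the complementary half: over a finite set only finitely many
    pairs of points have to be covered. This breaks down where one point carries infinitely many
    orthonormal vectors, or where one [y] might lie in [G x] for infinitely many [x]; both are
    settled by a shift along a sequence of vectors essentially living on one bounded set. *)

Definition nrm V (v : V) : R := complex.Re `|v|.

Lemma nrmE V (v : V) : `|v| = (nrm v)%:C%C.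
Proof.
have := normr_ge0 v; rewrite lecE /= => /andP[/eqP h _].
by rewrite /nrm; case: (`|v|) h => a b /= ->.
Qed.

Lemma nrm_ge0 V (v : V) : 0 <= nrm v.
Proof. by have := normr_ge0 v; rewrite nrmE ler0c. Qed.

Lemma nrm0 V : nrm (0 : V) = 0.
Proof. by rewrite /nrm normr0. Qed.

Lemma nrm_eq0 V (v : V) : (nrm v == 0) = (v == 0).
Proof. by rewrite -[RHS]normr_eq0 nrmE -(inj_eq (@complexI R)). Qed.

Lemma nrm_gt0 V (v : V) : (0 < nrm v) = (v != 0).
Proof. by rewrite lt_def nrm_eq0 nrm_ge0 andbT. Qed.

Lemma nrmN V (v : V) : nrm (- v) = nrm v.
Proof. by rewrite /nrm normrN. Qed.

Lemma nrmD V (v w : V) : nrm (v + w) <= nrm v + nrm w.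
Proof. by have := ler_normD v w; rewrite !nrmE -rmorphD lecR. Qed.

Lemma nrmB V (v w : V) : nrm (v - w) = nrm (w - v).
Proof. by rewrite -nrmN opprB. Qed.

Lemma nrm_sub V (v w : V) : nrm v <= nrm w + nrm (v - w).
Proof. by apply: le_trans (nrmD _ _); rewrite addrC subrK. Qed.

Lemma nrmZ (V : normedModType R[i]) z (v : V) : nrm (z *: v) = nrm z * nrm v.
Proof. by apply: (@complexI R); rewrite rmorphM /= -!nrmE normrZ. Qed.

Lemma nrmM z w : nrm (z * w) = nrm z * nrm w.
Proof. by apply: (@complexI R); rewrite rmorphM /= -!nrmE normrM. Qed.

Lemma nrm_conj z : nrm (Num.conj z) = nrm z.
Proof. by rewrite /nrm norm_conjC. Qed.

Lemma nrm_real (r : R) : nrm r%:C%C = `|r|.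
Proof. by rewrite /nrm normc_def /= expr0n addr0 sqrtr_sqr. Qed.

Lemma nrm1 : nrm (1 : R[i]) = 1.
Proof. by rewrite /nrm normr1. Qed.

Lemma Re_le_nrm z : complex.Re z <= nrm z.
Proof.
have := normc_ge_Re z; rewrite nrmE lecR; apply: le_trans; exact: ler_norm.
Qed.

Lemma ReD z w : complex.Re (z + w) = complex.Re z + complex.Re w.
Proof. by case: z; case: w. Qed.

Lemma ReN z : complex.Re (- z) = - complex.Re z.
Proof. by case: z. Qed.

Lemma Re_conj z : complex.Re (Num.conj z) = complex.Re z.
Proof. by case: z. Qed.

Lemma conj_mul_nrm z : z * Num.conj z = (nrm z ^+ 2)%:C%C.
Proof. by rewrite -normCK nrmE rmorphXn. Qed.

End RealNorm.

Section InnerProduct.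
Context {R : realType}.
Implicit Types (H K : hilbertType R[i]).

Definition ip H (x y : H) : R[i] := inner x y.

Lemma ipE H (x y : H) : inner x y = ip x y. Proof. by []. Qed.

Lemma ipDl H (x y z : H) : ip (x + y) z = ip x z + ip y z.
Proof. exact: linearDl. Qed.
Lemma ipZl H a (x z : H) : ip (a *: x) z = a * ip x z.
Proof. exact: linearZl_LR. Qed.
Lemma ipNl H (x z : H) : ip (- x) z = - ip x z.
Proof. exact: linearNl. Qed.
Lemma ip0l H (z : H) : ip 0 z = 0.
Proof. exact: linear0l. Qed.
Lemma ipBl H (x y z : H) : ip (x - y) z = ip x z - ip y z.
Proof. by rewrite ipDl ipNl. Qed.
Lemma ipC H (x y : H) : ip x y = Num.conj (ip y x).
Proof. by rewrite /ip hermC expr0 mul1r. Qed.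
Lemma ipDr H (x y z : H) : ip z (x + y) = ip z x + ip z y.
Proof. by rewrite ipC ipDl rmorphD (ipC z x) (ipC z y). Qed.
Lemma ipZr H a (x z : H) : ip z (a *: x) = Num.conj a * ip z x.
Proof. by rewrite ipC ipZl rmorphM (ipC z x). Qed.
Lemma ipNr H (x z : H) : ip z (- x) = - ip z x.
Proof. by rewrite ipC ipNl rmorphN (ipC z x). Qed.
Lemma ip0r H (z : H) : ip z 0 = 0.
Proof. by rewrite ipC ip0l rmorph0. Qed.
Lemma ipBr H (x y z : H) : ip z (x - y) = ip z x - ip z y.
Proof. by rewrite ipDr ipNr. Qed.

Lemma ip_suml H I (s : seq I) (P : pred I) (F : I -> H) z :
  ip (\sum_(i <- s | P i) F i) z = \sum_(i <- s | P i) ip (F i) z.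
Proof.
by apply: (big_morph (fun x => ip x z)) => [x y|]; [exact: ipDl|exact: ip0l].
Qed.

Lemma ipxx H (x : H) : ip x x = (nrm x ^+ 2)%:C%C.
Proof. by rewrite /ip -inner_norm nrmE rmorphXn. Qed.

Lemma ip_ext H (u v : H) : (forall w, ip u w = ip v w) -> u = v.
Proof.
move=> h; apply/eqP; rewrite -subr_eq0 -nrm_eq0 -(@eqrXn2 _ 2) ?nrm_ge0 //.
by rewrite expr0n; apply/eqP/(@complexI R); rewrite -ipxx ipBl h subrr.
Qed.

Lemma nrm_sqrD H (x y : H) :
  nrm (x + y) ^+ 2 = nrm x ^+ 2 + nrm y ^+ 2 + 2 * complex.Re (ip x y).
Proof.
have nE u : nrm u ^+ 2 = complex.Re (ip u u) by rewrite ipxx.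
rewrite !nE ipDl !ipDr (ipC y x) !ReD Re_conj; ring.
Qed.

Lemma nrm_pyth H (x y : H) : ip x y = 0 ->
  nrm (x + y) ^+ 2 = nrm x ^+ 2 + nrm y ^+ 2.
Proof. by move=> h; rewrite nrm_sqrD h /= mulr0 addr0. Qed.

Lemma cauchy_schwarz H (x y : H) : nrm (ip x y) <= nrm x * nrm y.
Proof.
have [->|y0] := eqVneq y 0; first by rewrite ip0r !nrm0 mulr0.
have ny : 0 < nrm y by rewrite nrm_gt0.
have ny2 : nrm y ^+ 2 != 0 by rewrite expf_neq0 // gt_eqF.
rewrite -(@ler_pXn2r _ 2) ?nnegrE ?mulr_ge0 ?nrm_ge0 // exprMn.
set c := ip x y.
pose a : R[i] := c * ((nrm y ^+ 2)^-1)%:C%C.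
have ha : nrm a = nrm c * (nrm y ^+ 2)^-1.
  by rewrite nrmM nrm_real ger0_norm // invr_ge0 sqr_ge0.
have := sqr_ge0 (nrm (x + - (a *: y))).
rewrite nrm_sqrD nrmN nrmZ ipNr ipZr.
have -> : Num.conj a * ip x y = (nrm c ^+ 2 * (nrm y ^+ 2)^-1)%:C%C.
  rewrite /a rmorphM /= rmorphM /= -conj_mul_nrm -/c.
  rewrite -[Num.conj (_%:C)%C]/(((nrm y ^+ 2)^-1)%:C^*)%C conjc_real; ring.
rewrite ReN ha /= => h.
have := mulr_ge0 (sqr_ge0 (nrm y)) h.
have -> : nrm y ^+ 2 * (nrm x ^+ 2 + (nrm c * (nrm y ^+ 2)^-1 * nrm y) ^+ 2 +
     2 * - (nrm c ^+ 2 * (nrm y ^+ 2)^-1)) = nrm x ^+ 2 * nrm y ^+ 2 - nrm c ^+ 2.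
  by field; rewrite gt_eqF.
by rewrite subr_ge0.
Qed.

(** The cross terms of the two signs are opposite, so one of them is nonnegative. This is the
    induction step for the choice of signs. *)
Lemma parallelogram_max H (x y : H) :
  nrm x ^+ 2 + nrm y ^+ 2 <= nrm (x + y) ^+ 2 \/
  nrm x ^+ 2 + nrm y ^+ 2 <= nrm (x - y) ^+ 2.
Proof.
rewrite !nrm_sqrD ipNr nrmN ReN.
case: (lerP 0 (complex.Re (ip x y))) => h; [left|right]; lra.
Qed.

Lemma is_adjointC H K (t : H -> K) (s : K -> H) :
  is_adjoint t s -> is_adjoint s t.
Proof. by move=> h x y; rewrite !ipE ipC -ipE -h !ipE -ipC. Qed.

End InnerProduct.

(** * Bounded operators *)

Section RawOperators.
Context {R : realType}.
Implicit Types (H K L : hilbertType R[i]).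

(** A predicate on bare functions with a real bound, so that composites, rank one maps and pointwise
    limits need no bundled structure; [bop_bounded_opE] returns to [bounded_op]. *)
Definition bop H K (t : H -> K) : Prop :=
  (forall a x y, t (a *: x + y) = a *: t x + t y) /\
  exists2 M : R, 0 <= M & forall v, nrm (t v) <= M * nrm v.

Section BopTheory.
Variables (H K : hilbertType R[i]) (t : H -> K).
Hypothesis bt : bop t.

Lemma bopD x y : t (x + y) = t x + t y.
Proof. by have [h _] := bt; have := h 1 x y; rewrite !scale1r. Qed.

Lemma bop0 : t 0 = 0.
Proof. by apply: (@addrI _ (t 0)); rewrite -bopD !addr0. Qed.

Lemma bopZ a x : t (a *: x) = a *: t x.
Proof. by have [h _] := bt; have := h a x 0; rewrite bop0 !addr0. Qed.

Lemma bopN x : t (- x) = - t x.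
Proof. by rewrite -scaleN1r bopZ scaleN1r. Qed.

Lemma bopB x y : t (x - y) = t x - t y.
Proof. by rewrite bopD bopN. Qed.

Lemma bop_sum I (s : seq I) (P : pred I) (F : I -> H) :
  t (\sum_(i <- s | P i) F i) = \sum_(i <- s | P i) t (F i).
Proof. exact: (big_morph t bopD bop0). Qed.
End BopTheory.

Lemma bop_comp H K L (s : K -> L) (t : H -> K) :
  bop s -> bop t -> bop (s \o t).
Proof.
move=> [ls [M M0 hM]] [lt [N N0 hN]]; split=> [a x y|].
  by rewrite /= lt ls.
exists (M * N) => [|v]; first exact: mulr_ge0.
by apply: le_trans (hM _) _; rewrite -mulrA ler_wpM2l.
Qed.

Lemma bop_lin H K a (s t : H -> K) :
  bop s -> bop t -> bop (fun v => a *: s v + t v).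
Proof.
move=> [ls [M M0 hM]] [lt [N N0 hN]]; split=> [b x y|].
  rewrite lt ls !scalerDr !scalerA [a * b]mulrC.
  by rewrite -!addrA; congr (_ + _); rewrite addrCA.
exists (nrm a * M + N) => [|v]; first by rewrite addr_ge0 ?mulr_ge0 ?nrm_ge0.
apply: le_trans (nrmD _ _) _; rewrite nrmZ mulrDl -mulrA lerD // ler_wpM2l //.
exact: nrm_ge0.
Qed.

Lemma bop_cst0 H K : bop ((fun=> 0) : H -> K).
Proof.
split=> [a x y|]; first by rewrite scaler0 addr0.
by exists 0 => // v; rewrite nrm0 mul0r.
Qed.

Lemma bop_sub H K (s t : H -> K) : bop s -> bop t -> bop (fun v => s v - t v).
Proof.
move=> bs bt; have := bop_lin (-1) bt bs.
by congr bop; apply/funext => v; rewrite scaleN1r addrC.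
Qed.

Lemma bop_bounded_op H K (b : bounded_op H K) : bop b.
Proof.
split=> [a x y|]; first exact: linearP.
have [M M0 hM] := pinfty_ex_gt0 ((linear_boundedP _).1 (bounded_opP b)).
exists (complex.Re M) => [|v].
  by move: M0; rewrite ltcE => /andP[_ /ltW].
have := hM v; rewrite !nrmE -[M]RRe_real ?gtr0_real //.
by rewrite -rmorphM lecR.
Qed.

Lemma bop_bounded_opE H K (t : H -> K) : bop t ->
  exists b : bounded_op H K, b = t :> (H -> K).
Proof.
move=> bt; have [lt [M M0 hM]] := bt.
pose lt' := GRing.isLinear.Build _ _ _ _ t lt.
pose T : {linear H -> K} := HB.pack t lt'.
have hT : bounded_near T (nbhs (0 : H)).
  apply/linear_boundedP; exists M%:C%C; split=> [|r Mr v].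
    by rewrite ger0_real // ler0c.
  rewrite [`|T v|]nrmE (le_trans (y := (M * nrm v)%:C%C)) ?lecR ?hM //.
  by rewrite rmorphM /= -nrmE ler_wpM2r // ltW.
by exists (BoundedOp hT).
Qed.

Lemma op_norm_ge H K (t : H -> K) v : bop t -> nrm v <= 1 ->
  nrm (t v) <= op_norm t.
Proof.
move=> [_ [M M0 hM]] v1; apply: sup_upper_bound; last first.
  exists v => //=; rewrite nrmE.
  by rewrite -(rmorph1 (real_complex R)) lecR.
split; first by exists (nrm (t v)), v => //=; rewrite nrmE -(rmorph1 (real_complex R)) lecR.
exists M => _ [w /= w1 <-]; apply: le_trans (hM w) _.
rewrite -[leRHS]mulr1 ler_wpM2l //.
by move: w1; rewrite nrmE -(rmorph1 (real_complex R)) lecR.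
Qed.

Lemma op_norm_le H K (t : H -> K) c : 0 <= c ->
  (forall v, nrm (t v) <= c * nrm v) -> op_norm t <= c.
Proof.
move=> c0 h; apply: sup_le_ub.
  by exists (nrm (t 0)), 0 => //=; rewrite normr0.
move=> _ [w /= w1 <-]; apply: le_trans (h w) _.
rewrite -[leRHS]mulr1 ler_wpM2l //.
by move: w1; rewrite nrmE -(rmorph1 (real_complex R)) lecR.
Qed.

Lemma op_normP H K (t : H -> K) v : bop t -> nrm (t v) <= op_norm t * nrm v.
Proof.
move=> bt; have [->|v0] := eqVneq v 0; first by rewrite bop0 // !nrm0 mulr0.
have nv : 0 < nrm v by rewrite nrm_gt0.
have := @op_norm_ge _ _ t (((nrm v)^-1)%:C%C *: v) bt.
rewrite bopZ // !nrmZ nrm_real ger0_norm ?invr_ge0 ?nrm_ge0 //.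
by rewrite mulVf ?gt_eqF // => /(_ (lexx _)); rewrite ler_pdivrMl // mulrC.
Qed.

Lemma lt_op_norm H K (t : H -> K) d : d < op_norm t ->
  exists2 v, nrm v <= 1 & d < nrm (t v).
Proof.
move=> /sup_gt[]; first by exists (nrm (t 0)), 0 => //=; rewrite normr0.
move=> _ [v /= v1 <-] dv; exists v => //.
by move: v1; rewrite nrmE -(rmorph1 (real_complex R)) lecR.
Qed.

End RawOperators.

(** * Density and Cauchy sequences with real radii *)

Section Topology.
Context {R : realType}.
Implicit Types (H : hilbertType R[i]).

Lemma ball_nrm (V : normedModType R[i]) (x y : V) (e : R) : nrm (x - y) < e -> ball x (e%:C%C : R[i]) y.
Proof. by move=> h; rewrite -ball_normE /= nrmE ltcR. Qed.

Lemma dense_approx (V : normedModType R[i]) (S : set V) : dense S ->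
  forall x (e : R), 0 < e -> exists2 s, S s & nrm (x - s) < e.
Proof.
move=> dS x e e0.
have e0' : 0 < (e%:C%C : R[i]) by rewrite ltcR.
have [] := dS (ball x (e%:C%C : R[i])) _ _.
- by exists x; exact: ballxx.
- exact: ball_open.
- by move=> s [hs Ss]; exists s => //; move: hs; rewrite -ball_normE /= nrmE ltcR.
Qed.

Lemma approx_dense (V : normedModType R[i]) (S : set V) :
  (forall x (e : R), 0 < e -> exists2 s, S s & nrm (x - s) < e) -> dense S.
Proof.
move=> h O [x Ox] oO.
have /nbhs_ballP[e /= e0 he] := open_nbhs_nbhs (conj oO Ox).
have re0 : 0 < complex.Re e by move: e0; rewrite ltcE => /andP[].
have [s Ss hs] := h x _ re0.
exists s; split=> //; apply: he.
by rewrite -[e]RRe_real ?gtr0_real //; exact: ball_nrm.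
Qed.

Lemma cauchy_nrm H (u : nat -> H) :
  (forall e : R, 0 < e -> exists N, forall m n, (N <= m)%N -> (N <= n)%N ->
     nrm (u m - u n) < e) ->
  exists l, forall e : R, 0 < e -> exists N, forall n, (N <= n)%N ->
     nrm (u n - l) < e.
Proof.
move=> h; have /cauchy_cvgP/cvg_ex[l ul] : cauchy (u @ \oo).
  apply/cauchy_ballP => e e0; have re : e \is Num.real by exact: gtr0_real.
  have re0 : 0 < complex.Re e by move: e0; rewrite ltcE => /andP[].
  have [N hN] := h _ re0.
  exists ([set u n | n in [set n | (N <= n)%N]],
          [set u n | n in [set n | (N <= n)%N]]) => /=.
    by split; exists N => // n Nn; exists n.
  move=> [_ _] /= [[m Nm <-] [n Nn <-]]; rewrite -[e]RRe_real //.
  exact: ball_nrm (hN _ _ Nm Nn).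
exists l => e e0.
have /cvg_ballP/(_ e%:C%C) := ul; rewrite ltcR => /(_ e0) [N _ hN].
exists N => n /hN; rewrite /= -ball_normE /= nrmE ltcR nrmB //.
Qed.

End Topology.

Lemma pos_eps_le0 (R : realType) (x C : R) : 0 <= C ->
  (forall e, 0 < e -> x <= C * e) -> x <= 0.
Proof.
move=> C0 h; rewrite leNgt; apply/negP => x0.
have := h (x / (2 * (C + 1))); rewrite divr_gt0 ?mulr_gt0 ?ltr_wpDl // => /(_ isT).
have -> : C * (x / (2 * (C + 1))) = (C / (2 * (C + 1))) * x by rewrite mulrCA mulrC.
rewrite leNgt => /negP; apply; rewrite gtr_pMl // ltr_pdivrMr ?mulr_gt0 ?ltr_wpDl //.
by lra.
Qed.

(** Absorbs an error divided by a bound [m] that may vanish; hence the [m + 1]. *)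
Lemma mul_div_le (R : realType) (m q b : R) : 0 <= m -> 0 <= q -> 0 <= b ->
  m * (q / (m + 1) * b) <= q * b.
Proof.
move=> m0 q0 b0; have m1 : 0 < m + 1 by rewrite ltr_wpDl.
have d0 : 0 <= q / (m + 1) by rewrite divr_ge0 // ltW.
rewrite -[in leRHS](divfK (lt0r_neq0 m1) q).
have := mulr_ge0 d0 b0; nra.
Qed.

(** * Orthonormal sequences and partial isometries *)

Section Orthonormal.
Context {R : realType}.
Implicit Types (H K : hilbertType R[i]).

Definition orthon H (a : nat -> H) : Prop :=
  forall m n, ip (a m) (a n) = (m == n)%:R.

Definition lim_to (H : normedModType R[i]) (u : nat -> H) (l : H) : Prop :=
  forall e : R, 0 < e -> exists N, forall n, (N <= n)%N -> nrm (u n - l) < e.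

Lemma lim_to_unique (H : normedModType R[i]) (u : nat -> H) l l' : lim_to u l -> lim_to u l' -> l = l'.
Proof.
move=> h h'; apply/eqP; rewrite -subr_eq0 -nrm_eq0 eq_le nrm_ge0 andbT.
apply: (@pos_eps_le0 _ _ 2) => // e e0.
have [N hN] := h _ e0; have [N' hN'] := h' _ e0.
have := hN (maxn N N') (leq_maxl _ _); have := hN' (maxn N N') (leq_maxr _ _).
set w := u _; have := nrmD (w - l') (- (w - l)).
by rewrite nrmN addrC opprB addrA subrK; lra.
Qed.

Lemma lim_to_lin (H : normedModType R[i]) a (u v : nat -> H) l l' : lim_to u l -> lim_to v l' ->
  lim_to (fun n => a *: u n + v n) (a *: l + l').
Proof.
move=> h h' e e0.
have e1 : 0 < e / 2 / (nrm a + 1) by rewrite !divr_gt0 // ltr_wpDl ?nrm_ge0.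
have e2 : 0 < e / 2 by rewrite divr_gt0.
have [N hN] := h _ e1; have [N' hN'] := h' _ e2.
exists (maxn N N') => n; rewrite geq_max => /andP[/hN hn /hN' hn'].
have -> : a *: u n + v n - (a *: l + l') = a *: (u n - l) + (v n - l').
  by rewrite scalerBr opprD addrACA.
apply: le_lt_trans (nrmD _ _) _; rewrite nrmZ.
have : nrm a * nrm (u n - l) <= e / 2.
  have a1 : 0 < nrm a + 1 by rewrite ltr_wpDl ?nrm_ge0.
  move: hn; rewrite ltr_pdivlMr // => /ltW; apply: le_trans.
  by rewrite mulrC ler_wpM2l ?nrm_ge0 // lerDl.
by lra.
Qed.

Lemma lim_to_nrm_le H (u : nat -> H) l B : lim_to u l ->
  (forall n, nrm (u n) <= B) -> nrm l <= B.
Proof.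
move=> h hB; rewrite -subr_le0; apply: (@pos_eps_le0 _ _ 1) => // e e0.
have [N /(_ _ (leqnn _))] := h _ e0; have := hB N; have := nrm_sub l (u N).
by rewrite (nrmB l); lra.
Qed.

Lemma lim_to_bop H K (t : H -> K) (u : nat -> H) l : bop t -> lim_to u l ->
  lim_to (t \o u) (t l).
Proof.
move=> bt h e e0; have [_ [M M0 hM]] := bt.
have M1 : 0 < M + 1 by rewrite ltr_wpDl.
have [N hN] := h _ (divr_gt0 e0 M1); exists N => n /hN.
rewrite ltr_pdivlMr //= => hn; rewrite -bopB //.
apply: le_lt_trans (hM _) (le_lt_trans _ hn).
by rewrite mulrC ler_wpM2l ?nrm_ge0 // lerDl.
Qed.

Lemma lim_to_ip H (u : nat -> H) l w (z : R[i]) : lim_to u l ->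
  (exists N, forall n, (N <= n)%N -> ip (u n) w = z) -> ip l w = z.
Proof.
move=> h [N0 hz]; apply/eqP; rewrite -subr_eq0 -nrm_eq0 eq_le nrm_ge0 andbT.
apply: (@pos_eps_le0 _ _ (nrm w)) => [|e e0]; first exact: nrm_ge0.
have [N hN] := h _ e0.
rewrite -(hz _ (leq_maxl N0 N)) -ipBl (le_trans (cauchy_schwarz _ _)) // mulrC.
by rewrite ler_wpM2l ?nrm_ge0 // nrmB ltW // hN // leq_maxr.
Qed.

Lemma lim_to_const (H : normedModType R[i]) (u : nat -> H) l :
  (exists N, forall n, (N <= n)%N -> u n = l) -> lim_to u l.
Proof.
by move=> [N h] e e0; exists N => n /h ->; rewrite subrr nrm0.
Qed.

Lemma orthon_nrm H (a : nat -> H) n : orthon a -> nrm (a n) = 1.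
Proof.
move=> oa; apply/eqP; rewrite -(@eqrXn2 _ 2) ?nrm_ge0 // expr1n.
by apply/eqP/(@complexI R); rewrite -ipxx oa eqxx rmorph1.
Qed.

Lemma orthon_sum_nrm H (a : nat -> H) (c : nat -> R[i]) m n : orthon a ->
  nrm (\sum_(m <= k < n) c k *: a k) ^+ 2 = \sum_(m <= k < n) nrm (c k) ^+ 2.
Proof.
move=> oa; elim: n => [|n IH]; first by rewrite !big_geq // nrm0 expr0n.
have [mn|nm] := leqP m n; last by rewrite !big_geq // nrm0 expr0n.
rewrite !big_nat_recr //= nrm_pyth.
  by rewrite IH nrmZ orthon_nrm // mulr1.
rewrite ip_suml big_nat big1 // => k /andP[_ kn].
by rewrite ipZl ipZr oa (ltn_eqF kn) !mulr0.
Qed.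

Lemma ip_orthon_sum H (a : nat -> H) (c : nat -> R[i]) n j : orthon a ->
  (j < n)%N -> ip (\sum_(0 <= k < n) c k *: a k) (a j) = c j.
Proof.
move=> oa jn; rewrite ip_suml big_mkord (bigD1 (Ordinal jn)) //=.
rewrite ipZl oa eqxx mulr1 big1 ?addr0 // => i ij.
by rewrite ipZl oa (_ : _ == _ = false) ?mulr0 //; apply/negbTE.
Qed.

Lemma bessel H (b : nat -> H) v n : orthon b ->
  \sum_(0 <= k < n) nrm (ip v (b k)) ^+ 2 <= nrm v ^+ 2.
Proof.
move=> ob; rewrite -(orthon_sum_nrm _ _ _ ob).
set p := \sum_(_ <= _ < _) _.
have -> : v = p + (v - p) by rewrite addrC subrK.
rewrite nrm_pyth ?lerDl ?sqr_ge0 // /p ip_suml big_nat big1 // => k /andP[_ kn].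
by rewrite -/p ipZl [ip (b k) _]ipC ipBl ip_orthon_sum // subrr rmorph0 mulr0.
Qed.

Lemma sum_tail_small (c : nat -> R) B : (forall k, 0 <= c k) ->
  (forall n, \sum_(0 <= k < n) c k <= B) ->
  forall e, 0 < e -> exists N, forall m n, (N <= m)%N -> (m <= n)%N ->
    \sum_(m <= k < n) c k < e.
Proof.
move=> c0 hB e e0.
pose S := [set \sum_(0 <= k < n) c k | n in [set: nat]].
have hS : has_sup S.
  split; first by exists (\sum_(0 <= k < 0) c k), 0%N.
  by exists B => _ [n _ <-].
have [_ [N _ <-] hN] := sup_adherent e0 hS.
exists N => m n Nm mn.
have : \sum_(0 <= k < n) c k <= sup S.
  by apply: sup_upper_bound => //; exists n.
rewrite (big_cat_nat (n := m)) //=.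
suff : \sum_(0 <= k < N) c k <= \sum_(0 <= k < m) c k by lra.
by rewrite [leRHS](big_cat_nat (n := N)) //= lerDl sumr_ge0.
Qed.

Lemma orthon_series H (a : nat -> H) (c : nat -> R[i]) B : orthon a ->
  (forall n, \sum_(0 <= k < n) nrm (c k) ^+ 2 <= B) ->
  exists l, lim_to (fun n => \sum_(0 <= k < n) c k *: a k) l.
Proof.
move=> oa hB; apply: cauchy_nrm => e e0.
have [|N hN] := sum_tail_small _ hB (exprn_gt0 2 e0).
  by move=> k; exact: sqr_ge0.
have W m n : (N <= m)%N -> (m <= n)%N ->
    nrm (\sum_(0 <= k < n) c k *: a k - \sum_(0 <= k < m) c k *: a k) < e.
  move=> Nm mn; rewrite (big_cat_nat (n := m)) //= addrAC subrr add0r.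
  rewrite -(@ltr_pXn2r _ 2) ?nnegrE ?nrm_ge0 ?ltW //.
  by rewrite orthon_sum_nrm // hN.
exists N => m n Nm Nn; have [mn|/ltnW nm] := leqP m n; last exact: W.
by rewrite nrmB; exact: W.
Qed.

(* The partial isometry sending each [b k] to [a k] and killing the           *)
(* orthogonal complement of their span.                                       *)
Lemma orthon_isometry H K (b : nat -> H) (a : nat -> K) : orthon b -> orthon a ->
  exists s : H -> K, bop s /\
    forall v, lim_to (fun n => \sum_(0 <= k < n) ip v (b k) *: a k) (s v).
Proof.
move=> ob oa.
have /boolp.choice[s hs] v : exists l,
    lim_to (fun n => \sum_(0 <= k < n) ip v (b k) *: a k) l.
  by apply: orthon_series oa (fun n => bessel v n ob).
exists s; split=> //; split=> [c x y|].
  apply: lim_to_unique (hs _) _; have := lim_to_lin c (hs x) (hs y).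
  congr lim_to; apply/funext => n; rewrite scaler_sumr -big_split /=.
  by apply: eq_bigr => k _; rewrite ipDl ipZl scalerDl scalerA.
exists 1 => // v; rewrite mul1r; apply: lim_to_nrm_le (hs v) _ => n.
rewrite -(@ler_pXn2r _ 2) ?nnegrE ?nrm_ge0 //.
by rewrite orthon_sum_nrm // bessel.
Qed.

(** The adjoint is the same construction with [a] and [b] exchanged, so [E] serves both. The last
    clauses read the support of the infinite sum off its terms: a bounded map that kills every term
    kills the limit. *)
Lemma partial_isometry H K (b : nat -> H) (a : nat -> K) : orthon b -> orthon a ->
  exists s : H -> K, exists s' : K -> H,
    [/\ bop s /\ bop s', is_adjoint s s', forall v, s (s' (s v)) = s v,
        forall n, s (b n) = a n /\ s' (a n) = b n &
        (forall (p : K -> K) v, bop p ->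
           (forall k, ip v (b k) *: p (a k) = 0) -> p (s v) = 0) /\
        (forall (p : H -> H) v, bop p ->
           (forall k, ip v (a k) *: p (b k) = 0) -> p (s' v) = 0)].
Proof.
move=> ob oa; have [s [bs hs]] := orthon_isometry ob oa.
have [s' [bs' hs']] := orthon_isometry oa ob.
have E H' K' (b' : nat -> H') (a' : nat -> K') s0 : orthon b' -> orthon a' ->
    (forall v, lim_to (fun n => \sum_(0 <= k < n) ip v (b' k) *: a' k) (s0 v)) ->
    [/\ forall v k, ip (s0 v) (a' k) = ip v (b' k),
        forall n, s0 (b' n) = a' n &
        forall (p : K' -> K') v, bop p ->
           (forall k, ip v (b' k) *: p (a' k) = 0) -> p (s0 v) = 0].
  move=> ob' oa' h0; split=> [v k|n|p v bp hp].
  - apply: lim_to_ip (h0 v) _; exists k.+1 => n kn.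
    exact: (ip_orthon_sum (fun k => ip v (b' k))).
  - apply: lim_to_unique (h0 _) _; apply: lim_to_const; exists n.+1 => m nm.
    rewrite big_mkord (bigD1 (Ordinal nm)) //= ob' eqxx scale1r.
    rewrite big1 ?addr0 // => i ij; rewrite ob' (_ : _ == _ = false) ?scale0r //.
    by apply/negbTE; rewrite eq_sym.
  - apply: lim_to_unique (lim_to_bop bp (h0 v)) _; apply: lim_to_const.
    exists 0%N => n _ /=; rewrite bop_sum // big1 // => k _.
    by rewrite bopZ // hp.
have [E1 E2 E3] := E _ _ _ _ _ ob oa hs.
have [E1' E2' E3'] := E _ _ _ _ _ oa ob hs'.
exists s, s'; split=> //.
- move=> x y; rewrite !ipE ipC.
  apply/eqP; rewrite -subr_eq0 -nrm_eq0 eq_le nrm_ge0 andbT.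
  (* For the finite sums [p] and [p'] adjointness is an identity; both sides are within [e] of
     them. *)
  apply: (@pos_eps_le0 _ _ (nrm x + nrm y)) => [|e e0].
    by rewrite addr_ge0 ?nrm_ge0.
  have [N hN] := hs x _ e0; have [N' hN'] := hs' y _ e0.
  pose n := maxn N N'.
  pose p n := \sum_(0 <= k < n) ip x (b k) *: a k.
  pose p' n := \sum_(0 <= k < n) ip y (a k) *: b k.
  have pp : Num.conj (ip y (p n)) = ip x (p' n).
    rewrite -ipC /p ip_suml [RHS]ipC /p' ip_suml rmorph_sum /=.
    by apply: eq_bigr => k _; rewrite !ipZl rmorphM /= -!ipC mulrC.
  have -> : Num.conj (ip y (s x)) - ip x (s' y) =
      Num.conj (ip y (s x - p n)) - ip x (s' y - p' n).
    by rewrite !ipBr rmorphB /= pp; ring.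
  apply: le_trans (nrmD _ _) _; rewrite nrmN nrm_conj mulrDl addrC.
  apply: lerD; apply: le_trans (cauchy_schwarz _ _) _;
    rewrite ler_wpM2l ?nrm_ge0 // nrmB ltW //.
  + by apply: hN'; exact: leq_maxr.
  + by apply: hN; exact: leq_maxl.
- move=> v; apply: lim_to_unique (hs _) _; have := hs v; congr lim_to.
  apply/funext => n; apply: eq_bigr => k _; by rewrite E1' E1.
Qed.

(* [t s] is then a projection, so that [s] has norm at most 1. *)
Lemma partial_isometry_contr H K (s : H -> K) (t : K -> H) :
  is_adjoint s t -> (forall v, s (t (s v)) = s v) -> forall v, nrm (s v) <= nrm v.
Proof.
move=> st sts v; set e := t (s v).
have A x y : ip (t x) y = ip x (s y) by rewrite /ip (is_adjointC st).
have nE (L : hilbertType R[i]) (u : L) : nrm u ^+ 2 = complex.Re (ip u u).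
  by rewrite ipxx.
have h1 : nrm (s v) ^+ 2 = complex.Re (ip e v) by rewrite nE -A.
have h2 : nrm e ^+ 2 = complex.Re (ip e v) by rewrite -h1 !nE /e A sts.
have h3 : complex.Re (ip e v) <= nrm e * nrm v.
  exact: le_trans (Re_le_nrm _) (cauchy_schwarz _ _).
have h4 : nrm e <= nrm v.
  have [->|e0] := eqVneq (nrm e) 0; first exact: nrm_ge0.
  have e1 : 0 < nrm e by rewrite lt_def e0 nrm_ge0.
  by rewrite -(ler_pM2l e1) -expr2 h2.
rewrite -(@ler_pXn2r _ 2) ?nnegrE ?nrm_ge0 // h1.
apply: le_trans h3 _; rewrite expr2 ler_wpM2r ?nrm_ge0 //.
Qed.

End Orthonormal.

(** Classical equality and choice, so that finite sets of points become duplicate-free lists. *)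
HB.instance Definition _ (X : coarseSpace) := gen_eqMixin (coarse_pt X).
HB.instance Definition _ (X : coarseSpace) := gen_choiceMixin (coarse_pt X).

(** * Rank one operators *)

Section RankOne.
Context {R : realType}.
Implicit Types (H K L : hilbertType R[i]).

Definition rk H K (a : K) (b : H) (v : H) : K := ip v b *: a.

Lemma bop_rk H K (a : K) (b : H) : bop (rk a b).
Proof.
split=> [c x y|]; first by rewrite /rk ipDl ipZl scalerDl scalerA.
exists (nrm b * nrm a) => [|v]; first by rewrite mulr_ge0 ?nrm_ge0.
rewrite /rk nrmZ mulrAC ler_wpM2r ?nrm_ge0 // mulrC; exact: cauchy_schwarz.
Qed.

Lemma rk_adjoint H K (a : K) (b : H) : is_adjoint (rk a b) (rk b a).
Proof. by move=> x y; rewrite !ipE /rk ipZl ipZr -ipC mulrC. Qed.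

Lemma rk_comp H K L (a : L) (b c : K) (d : H) v :
  rk a b (rk c d v) = ip c b *: rk a d v.
Proof. by rewrite /rk ipZl scalerA mulrC. Qed.

Lemma bop_rkE H K L (t : K -> L) (a : K) (b : H) v :
  bop t -> t (rk a b v) = rk (t a) b v.
Proof. by move=> bt; rewrite /rk bopZ. Qed.

Lemma rkZl H K c (a : K) (b : H) v : rk (c *: a) b v = c *: rk a b v.
Proof. by rewrite /rk !scalerA mulrC. Qed.

Lemma rkDl H K (a a' : K) (b : H) v : rk (a + a') b v = rk a b v + rk a' b v.
Proof. by rewrite /rk scalerDr. Qed.

Lemma rk_unit H (e : H) : nrm e = 1 -> rk e e e = e.
Proof. by move=> h; rewrite /rk ipxx h expr1n scale1r. Qed.

Lemma normalize H (v : H) : v != 0 -> nrm (((nrm v)^-1)%:C%C *: v) = 1.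
Proof.
move=> v0; rewrite nrmZ nrm_real ger0_norm ?invr_ge0 ?nrm_ge0 //.
by rewrite mulVf // nrm_eq0.
Qed.
End RankOne.

Lemma finite_uniq_seq (T : eqType) (K : set T) : finite_set K ->
  exists2 s : seq T, uniq s & K = [set` s].
Proof.
move=> /finite_seqP[s ->]; exists (undup s); first exact: undup_uniq.
by apply/seteqP; split => x /=; rewrite mem_undup.
Qed.

Lemma set_of_cons (T : eqType) (x : T) s : [set` x :: s] = [set x] `|` [set` s].
Proof.
apply/seteqP; split=> y /=; first by rewrite inE => /orP[/eqP ->|]; [left|right].
by rewrite inE => -[->|->]; rewrite ?eqxx ?orbT.
Qed.

(** * Coarse spaces and modules *)

Section CoarseSpaces.
Variable X : coarseSpace.

Definition comp (x : X) : set X := [set y | ent X [set (y, x)]].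

Lemma ent_sub E F : E `<=` F -> ent X F -> ent X E.
Proof. exact: coarse_sub (entP X) E F. Qed.
Lemma ent_setU E F : ent X E -> ent X F -> ent X (E `|` F).
Proof. exact: coarse_setU (entP X) E F. Qed.
Lemma ent_inv E : ent X E -> ent X (E^-1)%relation.
Proof. exact: coarse_inv (entP X) E. Qed.
(** Ordered like operators: [crel] of two supports contains the support of the composite, and
    [crel E F] is [(F \; E)]. *)
Definition crel (E F : set (X * X)) : set (X * X) :=
  [set p | exists2 z, E (p.1, z) & F (z, p.2)].
Lemma ent_comp E F : ent X E -> ent X F -> ent X (crel E F).
Proof. by move=> hE hF; exact: coarse_comp (entP X) F E hF hE. Qed.
Lemma ent_diag : ent X diagonal.
Proof. exact: coarse_diag (entP X). Qed.
Lemma ent_set0 : ent X set0.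
Proof. by apply: ent_sub ent_diag. Qed.

Lemma compxx x : comp x x.
Proof. by apply: ent_sub ent_diag => _ ->. Qed.

Lemma comp_sym x y : comp x y -> comp y x.
Proof. by move=> /ent_inv; apply: ent_sub => -[a b] [-> ->]. Qed.

Lemma comp_trans x y z : comp x y -> comp y z -> comp x z.
Proof.
move=> hy hz; apply: ent_sub (ent_comp hz hy) => -[a b] [-> ->].
by exists y.
Qed.

Lemma comp_ent E x y : ent X E -> E (y, x) -> comp x y.
Proof. by move=> eE Eyx; apply: ent_sub eE => _ ->. Qed.

Lemma ent_bigU (T : eqType) (s : seq T) (F : T -> set (X * X)) :
  (forall t, t \in s -> ent X (F t)) ->
  ent X [set p | exists2 t, t \in s & F t p].
Proof.
elim: s => [|t s IH] h; first by apply: ent_sub ent_set0 => p [].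
have h1 : ent X (F t) by apply: h; rewrite mem_head.
have h2 : ent X [set p | exists2 t, t \in s & F t p].
  by apply: IH => u us; apply: h; rewrite inE us orbT.
apply: ent_sub (ent_setU h1 h2) => p [u]; rewrite inE => /orP[/eqP ->|us] Fp.
  by left.
by right; exists u.
Qed.

Lemma ent_bigU_finite (T : Type) (A : set T) (F : T -> set (X * X)) :
  finite_set A -> (forall t, A t -> ent X (F t)) ->
  ent X [set p | exists2 t, A t & F t p].
Proof.
move=> fA h; pose e := (gen_eqMixin T); pose T' : eqType := HB.pack T e.
have /finite_seqP[s hs] : finite_set (A : set T') := fA.
apply: ent_sub (@ent_bigU T' s F _) => [p [t At Fp]|t ts].
  by exists t => //; have : A t := At; rewrite hs.
by apply: h; rewrite hs.
Qed.

Lemma finite_thicken E x : locally_finite X -> ent X E ->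
  finite_set (thicken E [set x]).
Proof.
move=> lf eE; apply: lf; exists (crel E E^-1%relation).
  by apply: ent_comp => //; exact: ent_inv.
by move=> [a b] [/= [_ -> Ea] [_ -> Eb]]; exists x.
Qed.

Lemma finite_thicken_set E A : locally_finite X -> ent X E -> finite_set A ->
  finite_set (thicken E A).
Proof.
move=> lf eE fA; have : finite_set (\bigcup_(x in A) thicken E [set x]).
  by apply: bigcup_finite => // x _; exact: finite_thicken.
by apply: sub_finite_set => y [a Aa Eya]; exists a => //; exists a.
Qed.

End CoarseSpaces.

Section Modules.
Context {R : realType} {X : coarseSpace}.
Implicit Types (C D B : coarse_module R X) (A : set X).

Lemma bop_ind C A : bop (ind C A).
Proof. exact: bop_bounded_op. Qed.

Lemma ind_adjoint C A : is_adjoint (ind C A) (ind C A).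
Proof. by have [] := ind_projection C A. Qed.

Lemma ip_ind C A (x y : C) : ip (ind C A x) y = ip x (ind C A y).
Proof. exact: ind_adjoint. Qed.

Lemma ind_idem C A v : ind C A (ind C A v) = ind C A v.
Proof. by rewrite -indI setIid. Qed.

Lemma nrm_ind C A v : nrm (ind C A v) <= nrm v.
Proof.
apply: (partial_isometry_contr (@ind_adjoint C A)) => w.
by rewrite !ind_idem.
Qed.

Lemma ind_subl C A A' v : A `<=` A' -> ind C A (ind C A' v) = ind C A v.
Proof. by move=> s; rewrite -indI setIidl. Qed.

Lemma ind_subr C A A' v : A `<=` A' -> ind C A' (ind C A v) = ind C A v.
Proof. by move=> s; rewrite -indI setIidr. Qed.

Lemma ind_disj C A A' v : A `&` A' = set0 -> ind C A (ind C A' v) = 0.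
Proof. by move=> s; rewrite -indI s ind0. Qed.

Lemma ind_le C A A' v : A `<=` A' -> nrm (ind C A v) <= nrm (ind C A' v).
Proof. by move=> s; rewrite -(ind_subl _ s); exact: nrm_ind. Qed.

Lemma ind_setC C A v : ind C A v + ind C (~` A) v = v.
Proof. by rewrite indC addrC subrK. Qed.

Lemma ind_setU C A A' v : A `&` A' = set0 ->
  ind C (A `|` A') v = ind C A v + ind C A' v.
Proof. by move=> h; rewrite indU ind_disj // subr0. Qed.

Lemma ip_ind_disj C A A' (v w : C) : A `&` A' = set0 ->
  ip (ind C A v) (ind C A' w) = 0.
Proof. by move=> h; rewrite ip_ind ind_disj // ip0r. Qed.

Lemma nrm_ind_setU C A A' v : A `&` A' = set0 ->
  nrm (ind C (A `|` A') v) ^+ 2 = nrm (ind C A v) ^+ 2 + nrm (ind C A' v) ^+ 2.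
Proof. by move=> h; rewrite ind_setU // nrm_pyth // ip_ind_disj. Qed.

Lemma ind_seq C (s : seq X) v : uniq s ->
  ind C [set` s] v = \sum_(x <- s) ind C [set x] v.
Proof.
elim: s => [|x s IH] /=; first by rewrite set_nil ind0 big_nil.
move=> /andP[xs us]; rewrite set_of_cons ind_setU ?big_cons ?IH //.
by apply/seteqP; split=> // y [/= ->]; rewrite (negbTE xs).
Qed.

Lemma nrm_ind_seq C (s : seq X) v : uniq s ->
  nrm (ind C [set` s] v) ^+ 2 = \sum_(x <- s) nrm (ind C [set x] v) ^+ 2.
Proof.
elim: s => [|x s IH] /=; first by rewrite set_nil ind0 big_nil nrm0 expr0n.
move=> /andP[xs us]; rewrite set_of_cons nrm_ind_setU ?big_cons ?IH //.
by apply/seteqP; split=> // y [/= ->]; rewrite (negbTE xs).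
Qed.

Hypothesis lf : locally_finite X.

(** A vector of the dense span lives on a finite union of [E]-bounded sets, finite by local
    finiteness; what is cut off is at most the distance to that vector. *)
Lemma ind_tail C (v : C) e : 0 < e ->
  exists2 K : set X, finite_set K & nrm (ind C (~` K) v) <= e.
Proof.
move=> e0; have [E [eE _ _] dE] := ind_dense C.
have [w [n [c [s [hs ->]]]] hw] := dense_approx dE v e0.
have /boolp.choice[A hA] i : exists A, rel_bounded E A /\ range (ind C A) (s i).
  by have [A ? ?] := hs i; exists A.
exists (\bigcup_i A i).
  by apply: bigcup_finite => // i _; apply: lf; exists E => //; have [] := hA i.
set K := \bigcup_i A i.
suff E0 : ind C (~` K) (\sum_(i < n) c i *: s i) = 0.
  apply: le_trans (ltW hw).
  rewrite -[in leLHS](subrK (\sum_(i < n) c i *: s i) v).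
  by rewrite (bopD (bop_ind _ _)) E0 addr0 nrm_ind.
rewrite (bop_sum (bop_ind _ _)) big1 // => i _.
have [_ [u _ <-]] := hA i; rewrite (bopZ (bop_ind _ _)) ind_disj ?scaler0 //.
apply/seteqP; split=> // x [/= nK Ax]; apply: nK; by exists i.
Qed.

(** A finite set carries all but [e] of [v], and over it the point projections add up. This amounts
    to the strong convergence of their sum. *)
Lemma ind_pointwise0 C A v : (forall x, A x -> ind C [set x] v = 0) ->
  ind C A v = 0.
Proof.
move=> h; apply/eqP; rewrite -nrm_eq0 eq_le nrm_ge0 andbT.
apply: (@pos_eps_le0 _ _ 1) => // e e0; rewrite mul1r.
have [K fK hK] := ind_tail v e0.
have [s us Es] := finite_uniq_seq (finite_setIr A fK).
have -> : ind C A v = ind C (A `&` K) v + ind C (A `&` ~` K) v.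
  rewrite -ind_setU -?setIUr ?setUv ?setIT //.
  by apply/seteqP; split=> // x [/= [_ ?] [_ ?]].
rewrite [in ind C (A `&` K) v]Es ind_seq // big_seq big1.
  by rewrite add0r; apply: le_trans hK; apply: ind_le => x [].
move=> x xs; apply: h.
by have : [set` s] x by []; rewrite -Es => -[].
Qed.

(** Approximability of bare functions, with a pointwise estimate in place of [op_norm]; [aprx_Amor]
    and [Amor_aprx] translate to and from morphisms. *)
Definition aprx C D (t : C -> D) : Prop :=
  bop t /\ forall e : R, 0 < e -> exists s : C -> D,
    [/\ bop s, ent X (op_support s) & forall v, nrm (t v - s v) <= e * nrm v].

Lemma aprx_bop C D (t : C -> D) : aprx t -> bop t.
Proof. by case. Qed.

Lemma aprx_Amor C D (t : C -> D) : aprx t -> exists m : Amor C D, m = t :> (C -> D).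
Proof.
move=> [/bop_bounded_opE[b <-] h].
have hb : approximable b.
  move=> e e0; have e2 : 0 < e / 2 by rewrite divr_gt0.
  have [s [/bop_bounded_opE[s' <-] es hs]] := h _ e2.
  exists s' => //; apply: le_lt_trans (op_norm_le (ltW e2) _) _ => //.
  lra.
by exists (AMor hb).
Qed.

Lemma Amor_aprx C D (m : Amor C D) : aprx m.
Proof.
split=> [|e e0]; first exact: bop_bounded_op.
have [s cs hs] := @Amor_approximable _ _ _ _ m _ e0.
exists s; split=> [||v]; [exact: bop_bounded_op|exact: cs|].
apply: le_trans (_ : _ <= op_norm ((Amor_op m : C -> D) \- s) * nrm v) _.
  apply: (@op_normP _ _ _ ((Amor_op m : C -> D) \- s)).
  by apply: bop_sub; exact: bop_bounded_op.
by rewrite ler_wpM2r ?nrm_ge0 // ltW.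
Qed.

(** [op_support] only speaks of points. On the left [ind_pointwise0] reduces to points, on the right
    [ind_tail] reduces to finitely many of them. *)
Lemma ctrl_sep C D (s : C -> D) A A' v : bop s ->
  (forall x y, A x -> A' y -> ~ op_support s (x, y)) ->
  ind D A (s (ind C A' v)) = 0.
Proof.
move=> bs h; apply: ind_pointwise0 => x Ax.
apply/eqP; rewrite -nrm_eq0 eq_le nrm_ge0 andbT; have [_ [M M0 hM]] := bs.
apply: (@pos_eps_le0 _ _ M) => // e e0.
have [K fK hK] := ind_tail (ind C A' v) e0.
rewrite -(ind_setC K (ind C A' v)).
rewrite (bopD bs) (bopD (bop_ind _ _)).
have -> : ind D [set x] (s (ind C K (ind C A' v))) = 0.
  have [q uq Eq] := finite_uniq_seq (finite_setIl A' fK).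
  rewrite -indI Eq ind_seq // (bop_sum bs) (bop_sum (bop_ind _ _)).
  rewrite big_seq big1 // => y yq; apply/eqP/negP => /negP nz.
  have [_ A'y] : (K `&` A') y by rewrite Eq.
  by apply: (h x y Ax A'y); exists v.
rewrite add0r; apply: le_trans (nrm_ind _ _) _; apply: le_trans (hM _) _.
by rewrite ler_wpM2l.
Qed.

(** The controlled approximant has no block between separated sets, so only the error remains. Every
    contradiction with approximability below goes through this estimate. *)
Lemma aprx_quasilocal C D (t : C -> D) e : aprx t -> 0 < e ->
  exists2 F, ent X F & forall A A',
    (forall x y, A x -> A' y -> ~ F (x, y)) ->
    forall v, nrm (ind D A (t (ind C A' v))) <= e * nrm v.
Proof.
move=> [bt h] e0; have [s [bs es hs]] := h _ e0.
exists (op_support s) => // A A' sep v.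
have -> : ind D A (t (ind C A' v)) =
    ind D A (t (ind C A' v) - s (ind C A' v)).
  by rewrite (bopB (bop_ind _ _)) (ctrl_sep _ bs sep) subr0.
apply: le_trans (nrm_ind _ _) _; apply: le_trans (hs _) _.
by rewrite ler_wpM2l ?nrm_ind // ltW.
Qed.

Lemma aprx_ctrl C D (t : C -> D) E : bop t -> ent X E ->
  (forall x y v, ~ E (x, y) -> ind D [set x] (t (ind C [set y] v)) = 0) ->
  aprx t.
Proof.
move=> bt eE h; split=> // e e0; exists t; split=> // [|v].
  apply: ent_sub eE => -[x y] [v /= nz]; apply: contrapT => nE.
  by move: nz; rewrite h ?eqxx.
by rewrite subrr nrm0 mulr_ge0 ?nrm_ge0 // ltW.
Qed.

Lemma aprx_limit C D (t : C -> D) : bop t ->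
  (forall e : R, 0 < e -> exists2 s : C -> D, aprx s &
     forall v, nrm (t v - s v) <= e * nrm v) -> aprx t.
Proof.
move=> bt h; split=> // e e0; have e2 : 0 < e / 2 by rewrite divr_gt0.
have [s [bs hs] ts] := h _ e2; have [r [br er sr]] := hs _ e2.
exists r; split=> // v.
have -> : t v - r v = (t v - s v) + (s v - r v) by rewrite addrA subrK.
apply: le_trans (nrmD _ _) _; have := ts v; have := sr v.
have -> : e * nrm v = e / 2 * nrm v + e / 2 * nrm v by rewrite -mulrDl -splitr.
by lra.
Qed.

Lemma aprx_ind C A : aprx (ind C A).
Proof.
apply: aprx_ctrl (bop_ind _ _) (ent_diag X) _ => x y v ne.
rewrite -indI ind_disj //; apply/seteqP; split=> // z [/= [-> _] xy].
by apply: ne; rewrite xy.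
Qed.

Lemma aprx_lin C D a (s t : C -> D) : aprx s -> aprx t ->
  aprx (fun v => a *: s v + t v).
Proof.
move=> [bs hs] [bt ht]; split=> [|e e0]; first exact: bop_lin.
have a1 : 0 < nrm a + 1 by rewrite ltr_wpDl ?nrm_ge0.
have [s' [bs' es' hs']] := hs _ (divr_gt0 (divr_gt0 e0 (ltr0Sn _ 1)) a1).
have [t' [bt' et' ht']] := ht _ (divr_gt0 e0 (ltr0Sn _ 1)).
exists (fun v => a *: s' v + t' v); split=> [||v]; first exact: bop_lin.
  apply: ent_sub (ent_setU es' et') => -[x y] [v /= nz].
  case: (eqVneq (ind D [set x] (s' (ind C [set y] v))) 0) => z1; last by left; exists v.
  case: (eqVneq (ind D [set x] (t' (ind C [set y] v))) 0) => z2; last by right; exists v.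
  by move: nz; rewrite (bopD (bop_ind _ _)) (bopZ (bop_ind _ _)) z1 z2 scaler0 addr0 eqxx.
have -> : a *: s v + t v - (a *: s' v + t' v) = a *: (s v - s' v) + (t v - t' v).
  by rewrite scalerBr opprD addrACA.
apply: le_trans (nrmD _ _) _; rewrite nrmZ.
have -> : e * nrm v = e / 2 * nrm v + e / 2 * nrm v by rewrite -mulrDl -splitr.
apply: lerD (ht' v); have h := hs' v.
apply: le_trans (ler_wpM2l (nrm_ge0 a) h) _.
by rewrite mul_div_le ?nrm_ge0 // ltW ?divr_gt0.
Qed.

Lemma aprx_comp C D B (s : D -> B) (t : C -> D) : aprx s -> aprx t ->
  aprx (s \o t).
Proof.
move=> [bs hs] [bt ht]; split=> [|e e0]; first exact: bop_comp.
have [_ [M M0 hM]] := bs; have [_ [N N0 hN]] := bt.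
have e2 : 0 < e / 2 by rewrite divr_gt0.
have M1 : 0 < M + 1 by rewrite ltr_wpDl.
(* [t'] is chosen before [s'], because the error of [s'] gets multiplied by the bound [N'] of
   [t']. *)
have [t' [bt' et' ht']] := ht _ (divr_gt0 e2 M1).
have [_ [N' N'0 hN']] := bt'.
have N1 : 0 < N' + 1 by rewrite ltr_wpDl.
have [s' [bs' es' hs']] := hs _ (divr_gt0 e2 N1).
exists (s' \o t'); split=> [||v]; first exact: bop_comp.
  apply: ent_sub (ent_comp es' et') => -[x y] [v /= nz].
  apply: contrapT => nE; move: nz.
  (* Splitting the middle space along [S]: off [S] nothing reaches [x] under [s'], and into [S]
     nothing comes from [y] under [t']. *)
  pose S := [set z | op_support s' (x, z)].
  rewrite -(ind_setC S (t' _)) (bopD bs') (bopD (bop_ind _ _)).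
  rewrite (@ctrl_sep _ _ s' [set x] (~` S)) //; last by move=> ? z -> /=.
  rewrite (@ctrl_sep _ _ t' S [set y])  //; last first.
    by move=> z ? Sz -> hz; apply: nE; exists z.
  by rewrite (bop0 bs') (bop0 (bop_ind _ _)) addr0 eqxx.
have -> : s (t v) - s' (t' v) = s (t v - t' v) + (s (t' v) - s' (t' v)).
  by rewrite (bopB bs) addrA subrK.
apply: le_trans (nrmD _ _) _.
have -> : e * nrm v = e / 2 * nrm v + e / 2 * nrm v by rewrite -mulrDl -splitr.
have e20 := ltW e2.
apply: lerD.
  apply: le_trans (hM _) (le_trans (ler_wpM2l M0 (ht' v)) _).
  by rewrite mul_div_le ?nrm_ge0.
apply: le_trans (hs' _) _; apply: le_trans (ler_wpM2l _ (hN' v)) _.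
  by rewrite divr_ge0 // ltW.
by rewrite mulrCA mul_div_le ?nrm_ge0.
Qed.

Definition Loc C x (v : C) : Prop := ind C (comp x) v = v.

Lemma Loc_bounded C x A (v : C) : A `<=` comp x -> ind C A v = v -> Loc x v.
Proof. by move=> s h; rewrite /Loc -h ind_subr. Qed.

(** A pair in an entourage stays in one component, so a component and its complement are separated
    for every entourage and quasilocality applies with all [e] at once. *)
Lemma aprx_Loc C D (t : C -> D) x v : aprx t -> Loc x v -> Loc x (t v).
Proof.
move=> at_ lv; suff h : ind D (~` comp x) (t v) = 0.
  by rewrite /Loc -[RHS](ind_setC (comp x)) h addr0.
apply/eqP; rewrite -nrm_eq0 eq_le nrm_ge0 andbT.
apply: (@pos_eps_le0 _ _ (nrm v)) => [|e e0]; first exact: nrm_ge0.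
have [F eF hF] := aprx_quasilocal at_ e0.
rewrite -lv mulrC lv; rewrite -[in leLHS]lv; apply: hF => y z ny xz Fyz.
by apply: ny; apply: comp_trans xz (comp_ent eF Fyz).
Qed.

Lemma LocZ C x a (v : C) : Loc x v -> Loc x (a *: v).
Proof. by move=> h; rewrite /Loc (bopZ (bop_ind _ _)) h. Qed.

Lemma LocD C x (v w : C) : Loc x v -> Loc x w -> Loc x (v + w).
Proof. by move=> h h'; rewrite /Loc (bopD (bop_ind _ _)) h h'. Qed.

(** Finitely many points of the component of [x] lie within one entourage of [x], which turns the
    finite set of [ind_tail] into a neighbourhood. *)
Lemma Loc_ent C x (v : C) e : Loc x v -> 0 < e -> exists2 F, ent X F &
  nrm (ind C (~` thicken F [set x]) v) <= e.
Proof.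
move=> lv e0; have [K fK hK] := ind_tail v e0.
exists [set p | exists2 y, (K `&` comp x) y & [set (y, x)] p].
  by apply: ent_bigU_finite => [|y []] //; exact: finite_setIl.
rewrite -lv -indI; apply: le_trans hK; apply: ind_le => y [/= nE xy] Ky.
by apply: nE; exists x => //; exists y.
Qed.

Lemma Loc_comp C x y (v : C) : comp x y -> Loc x v -> Loc y v.
Proof.
move=> xy; apply: Loc_bounded => z xz; apply: comp_trans xz; exact: comp_sym.
Qed.

Lemma aprx_rk_ctrl C D A A' (a : D) (b : C) : ent X (A `*` A') ->
  ind D A a = a -> ind C A' b = b -> aprx (rk a b).
Proof.
move=> eA ha hb; apply: aprx_ctrl (bop_rk a b) eA _ => x y v nE.
rewrite (bop_rkE _ _ _ (bop_ind _ _)) /rk.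
have [Ax|nAx] := pselect (A x); last first.
  by rewrite -ha ind_disj ?scaler0 //; apply/seteqP; split=> // z [/= ->].
rewrite ip_ind -hb ind_disj ?ip0r ?scale0r //.
by apply/seteqP; split=> // z [/= -> Ay]; apply: nE.
Qed.

Lemma ent_comp_finite x (K K' : set X) : finite_set K -> finite_set K' ->
  K `<=` comp x -> K' `<=` comp x -> ent X (K `*` K').
Proof.
move=> fK fK' hK hK'.
have h : ent X [set p | exists2 q, (K `*` K') q & [set q] p].
  apply: ent_bigU_finite; first exact: finite_setX.
  by move=> [a b] [/= /hK ha /hK' hb]; apply: comp_trans ha; exact: comp_sym.
by apply: ent_sub h => p Kp; exists p.
Qed.

(** Both vectors are truncated to finite subsets of one component, whose product is an entourage;
    the truncation errors enter linearly, weighted by the norms of [a] and [b]. *)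
Lemma aprx_rk C D x (a : D) (b : C) : Loc x a -> Loc x b -> aprx (rk a b).
Proof.
move=> la lb; apply: aprx_limit (bop_rk a b) _ => e e0.
have n1 : 0 < nrm a + nrm b + 1 by rewrite ltr_wpDl // addr_ge0 ?nrm_ge0.
have [K fK hK] := ind_tail a (divr_gt0 e0 n1).
have [K' fK' hK'] := ind_tail b (divr_gt0 e0 n1).
exists (rk (ind D (K `&` comp x) a) (ind C (K' `&` comp x) b)).
  apply: (@aprx_rk_ctrl _ _ (K `&` comp x) (K' `&` comp x)); rewrite ?ind_idem //.
  by apply: (@ent_comp_finite x); [exact: finite_setIl|exact: finite_setIl|
     move=> ? []|move=> ? []].
move=> v; rewrite 2!indI la lb.
have -> : rk a b v - rk (ind D K a) (ind C K' b) v =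
    ip v b *: (a - ind D K a) + ip v (b - ind C K' b) *: ind D K a.
  by rewrite ipBr scalerBl scalerBr addrA subrK.
rewrite -!indC; apply: le_trans (nrmD _ _) _; rewrite !nrmZ.
set d := e / _ in hK hK'.
have d0 : 0 < d by rewrite divr_gt0.
have -> : e = d * (nrm a + nrm b + 1) by rewrite divfK // gt_eqF.
have h1 : nrm (ip v b) * nrm (ind D (~` K) a) <= nrm v * nrm b * d.
  by apply: ler_pM; rewrite ?nrm_ge0 // cauchy_schwarz.
have h2 : nrm (ip v (ind C (~` K') b)) * nrm (ind D K a) <= nrm v * d * nrm a.
  apply: ler_pM; rewrite ?nrm_ge0 ?nrm_ind //.
  by apply: le_trans (cauchy_schwarz _ _) _; rewrite ler_wpM2l ?nrm_ge0.
have h3 : 0 <= d * nrm v by rewrite mulr_ge0 ?nrm_ge0 // ltW.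
nra.
Qed.

End Modules.

Lemma ind_notin (R : realType) (X : coarseSpace) (C : coarse_module R X) A x v :
  ~ A x -> ind C A v = v -> ind C [set x] v = 0.
Proof.
by move=> nA <-; apply: ind_disj; apply/seteqP; split=> // z [/= ->].
Qed.

(** A block outside [E] kills every term, hence the infinite sum. So infinitely many rank one
    operators with a common propagation bound assemble into one morphism. *)
Lemma controlled_isometry (R : realType) (X : coarseSpace)
    (C D : coarse_module R X) (b : nat -> C) (a : nat -> D) E :
  locally_finite X -> ent X E -> orthon b -> orthon a ->
  (forall n, exists A A', [/\ ind D A (a n) = a n, ind C A' (b n) = b n &
     A `*` A' `<=` E]) ->
  exists s s', [/\ aprx s, aprx s', is_adjoint s s',
     forall v, s (s' (s v)) = s v & forall n, s (b n) = a n].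
Proof.
move=> lf eE ob oa h.
have [s [s' [[bs bs'] adj sss hab [z1 z2]]]] := partial_isometry ob oa.
exists s, s'; split=> //; last by move=> n; have [] := hab n.
  apply: aprx_ctrl bs eE _ => x y v nE; apply: z1 (bop_ind _ _) _ => n.
  have [A [A' [ha hb AE]]] := h n.
  have [Ax|nAx] := pselect (A x); last by rewrite (ind_notin nAx ha) scaler0.
  by rewrite ip_ind (ind_notin _ hb) ?ip0r ?scale0r // => A'y; apply: nE; apply: AE.
apply: aprx_ctrl bs' (ent_inv eE) _ => x y v nE; apply: z2 (bop_ind _ _) _ => n.
have [A [A' [ha hb AE]]] := h n.
have [Ax|nAx] := pselect (A' x); last by rewrite (ind_notin nAx hb) scaler0.
by rewrite ip_ind (ind_notin _ ha) ?ip0r ?scale0r // => A'y; apply: nE; apply: AE.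
Qed.

(** * Full and faithful functors *)

Section Functor.
Context {R : realType} {k : rank_bound} {X Y : coarseSpace}.
Variable Phi : star_functor R k X Y.
Hypotheses (X_lf : locally_finite X) (Y_lf : locally_finite Y).
Implicit Types C D B : Aobj R k X.

Definition Phi_rel C D (t : C -> D) (T : Phi C -> Phi D) : Prop :=
  exists m : Amor C D, (m : C -> D) = t /\ (fmor Phi m : Phi C -> Phi D) = T.

(* Junk value [0] outside the approximable maps. *)
Definition ph C D (t : C -> D) : Phi C -> Phi D :=
  xget (fun=> 0) [set T | Phi_rel t T].

(** Morphisms with equal values may differ in their bundled proofs; linearity applied to [m] read as
    [0 *: m + m'] identifies their images. *)
Lemma fmor_ext C D (m m' : Amor C D) : m =1 m' ->
  (fmor Phi m : Phi C -> Phi D) = fmor Phi m'.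
Proof.
move=> h; apply/funext => v.
rewrite (@fmor_linear _ _ _ _ Phi _ _ 0 m m' m); last first.
  by move=> w; rewrite scale0r add0r h.
by rewrite scale0r add0r.
Qed.

Lemma ph_fmor C D (m : Amor C D) : ph m = fmor Phi m.
Proof.
rewrite /ph; case: xgetP => [T _ [m' [mm' <-]]|h].
  by apply: fmor_ext => v; rewrite mm'.
by exfalso; apply: (h (fmor Phi m)); exists m.
Qed.

Lemma ph_aprx C D (t : C -> D) : aprx t -> aprx (ph t).
Proof. by move=> /aprx_Amor[m <-]; rewrite ph_fmor; exact: Amor_aprx. Qed.

Lemma bop_ph C D (t : C -> D) : aprx t -> bop (ph t).
Proof. by move=> /ph_aprx/aprx_bop. Qed.

Lemma ph_comp C D B (s : D -> B) (t : C -> D) (st : C -> B) :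
  aprx s -> aprx t -> (forall v, st v = s (t v)) ->
  forall v, ph st v = ph s (ph t v).
Proof.
move=> as_ at_ h v; have := aprx_comp X_lf as_ at_.
have -> : s \o t = st by apply/funext => w; rewrite h.
move: as_ at_ h => /aprx_Amor[ms <-] /aprx_Amor[mt <-] h /aprx_Amor[m mE].
move: h; rewrite -mE => h.
by rewrite !ph_fmor (@fmor_comp _ _ _ _ Phi _ _ _ ms mt m).
Qed.

Lemma ph_lin C D a (s t u : C -> D) : aprx s -> aprx t ->
  (forall v, u v = a *: s v + t v) -> forall v, ph u v = a *: ph s v + ph t v.
Proof.
move=> as_ at_ h v; have := aprx_lin a as_ at_.
have -> : (fun v => a *: s v + t v) = u by apply/funext => w; rewrite h.
move: as_ at_ h => /aprx_Amor[ms <-] /aprx_Amor[mt <-] h /aprx_Amor[m mE].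
move: h; rewrite -mE => h.
by rewrite !ph_fmor (@fmor_linear _ _ _ _ Phi _ _ a ms mt m).
Qed.

Lemma aprx0 C D : aprx ((fun=> 0) : C -> D).
Proof.
apply: aprx_ctrl (bop_cst0 _ _) (ent_set0 X) _ => x y v _.
by rewrite (bop0 (bop_ind _ _)).
Qed.

Lemma ph0 C D v : ph ((fun=> 0) : C -> D) v = 0.
Proof.
rewrite (@ph_lin C D (-1) (fun=> 0) (fun=> 0)); try exact: aprx0.
  by rewrite scaleN1r addNr.
by move=> w; rewrite scaleN1r addNr.
Qed.

Lemma ph_scale C D a (s u : C -> D) : aprx s ->
  (forall v, u v = a *: s v) -> forall v, ph u v = a *: ph s v.
Proof.
move=> as_ h v; rewrite (@ph_lin C D a s (fun=> 0)) ?ph0 ?addr0 //.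
  exact: aprx0.
by move=> w; rewrite h addr0.
Qed.

Lemma ph_adjoint C D (t : C -> D) (s : D -> C) : aprx t -> aprx s ->
  is_adjoint t s -> is_adjoint (ph t) (ph s).
Proof.
move=> /aprx_Amor[mt <-] /aprx_Amor[ms <-] h; rewrite !ph_fmor.
exact: fmor_adjoint.
Qed.

(** The laws of a [star_functor] mention no norms. The relation [s s' s = s] is algebraic, so it
    survives [ph], and it bounds the norm by [partial_isometry_contr]. *)
Lemma ph_contr C D (s : C -> D) (s' : D -> C) : aprx s -> aprx s' ->
  is_adjoint s s' -> (forall v, s (s' (s v)) = s v) ->
  forall v, nrm (ph s v) <= nrm v.
Proof.
move=> h h' adj sss; apply: (partial_isometry_contr (ph_adjoint h h' adj)) => v.
have h2 := aprx_comp X_lf h' h.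
rewrite -(@ph_comp _ _ _ s' s (s' \o s)) //.
exact: esym (ph_comp h h2 (fun w => esym (sss w)) v).
Qed.

Lemma ph_full C D (T : Phi C -> Phi D) : full_functor Phi -> aprx T ->
  exists2 t : C -> D, aprx t & ph t = T.
Proof.
move=> full /aprx_Amor[m <-]; have [t tE] := full _ _ m.
by exists t; [exact: Amor_aprx|rewrite ph_fmor; apply/funext].
Qed.

Lemma ph_inj C D (s t : C -> D) : faithful_functor Phi -> aprx s -> aprx t ->
  ph s =1 ph t -> s =1 t.
Proof.
move=> faith /aprx_Amor[ms <-] /aprx_Amor[mt <-]; rewrite !ph_fmor.
exact: faith.
Qed.

Section Transport.
Variables (M : Aobj R k X) (x : X) (e : M) (xi : Phi M).
Hypotheses (e1 : nrm e = 1) (xe : Loc x e) (xi1 : nrm xi = 1).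
Hypothesis xiP : ph (rk e e) xi = xi.

(* The partial unitary [H_C -> H_(Phi C)] implementing [Phi] on the vectors   *)
(* supported in the coarse component of [x].                                  *)
Definition transp C (v : C) : Phi C := ph (rk v e) xi.

Lemma transp_app C D (t : C -> D) (v : C) : aprx t -> Loc x v ->
  ph t (transp v) = transp (t v).
Proof.
move=> at_ lv; rewrite /transp (@ph_comp _ _ _ t (rk v e)) //.
  exact: aprx_rk lv xe.
by move=> w; rewrite bop_rkE //; exact: aprx_bop.
Qed.

Lemma transp_e : transp e = xi. Proof. exact: xiP. Qed.

Lemma transp_lin C a (v w : C) : Loc x v -> Loc x w ->
  transp (a *: v + w) = a *: transp v + transp w.
Proof.
move=> lv lw; rewrite /transp (@ph_lin _ _ a (rk v e) (rk w e)) //.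
- exact: aprx_rk lv xe.
- exact: aprx_rk lw xe.
- by move=> u; rewrite rkDl rkZl.
Qed.

Lemma transp_scale C a (v : C) : Loc x v -> transp (a *: v) = a *: transp v.
Proof.
move=> lv; rewrite /transp (@ph_scale _ _ a (rk v e)) //.
  exact: aprx_rk lv xe.
by move=> u; rewrite rkZl.
Qed.

(** Moving [ph (rk w e)] to the other side produces [rk e w] after [rk v e], which is [ip v w] times
    [rk e e], and [xi] is fixed by the image of the latter. *)
Lemma transp_ip C (v w : C) : Loc x v -> Loc x w ->
  ip (transp v) (transp w) = ip v w.
Proof.
move=> lv lw; have a1 := aprx_rk X_lf lw xe; have a2 := aprx_rk X_lf xe lw.
have adj := ph_adjoint a2 a1 (rk_adjoint _ _).
rewrite {2}/transp -[LHS]adj ipE -(@ph_comp _ _ _ _ _ (fun u => rk e w (rk v e u))) //.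
  rewrite (@ph_scale _ _ (ip v w) (rk e e)) ?xiP ?ipZl ?ipxx ?xi1 ?expr1n ?mulr1 //.
    exact: aprx_rk xe xe.
  by move=> u; rewrite rk_comp.
exact: aprx_rk lv xe.
Qed.

Lemma transp_nrm C (v : C) : Loc x v -> nrm (transp v) = nrm v.
Proof.
move=> lv; apply/eqP; rewrite -(@eqrXn2 _ 2) ?nrm_ge0 //; apply/eqP.
by apply/(@complexI R); rewrite -!ipxx transp_ip.
Qed.

Lemma transp_Loc C y (v : C) : Loc x v -> Loc y xi -> Loc y (transp v).
Proof.
by move=> lv ly; apply: aprx_Loc ly => //; apply: ph_aprx; exact: aprx_rk lv xe.
Qed.

(* The compression of an operator of [End (Phi M)] to the range of            *)
(* [ph (rk e e)] is a scalar, hence [xi] lies in a single component.          *)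
Lemma Loc_of_ind y : full_functor Phi -> ind (Phi M) [set y] xi != 0 -> Loc y xi.
Proof.
move=> full nz; set T := ind (Phi M) (comp y); set P := ph (rk e e).
have aP : aprx P by apply: ph_aprx; exact: aprx_rk xe xe.
have PP : is_adjoint P P by apply: ph_adjoint (rk_adjoint _ _); exact: aprx_rk xe xe.
(* [P] preserves components. Taking adjoints then shows that [P] and [T] commute. *)
have TPT v : T (P (T v)) = P (T v).
  by apply: aprx_Loc => //; rewrite /Loc ind_idem.
have TP : T xi = P (T xi).
  have ipP u v : ip (P u) v = ip u (P v) by exact: PP.
  have ipT u v : ip (T u) v = ip u (T v) by exact: ip_ind.
  apply: ip_ext => w; rewrite -[in RHS]TPT [RHS]ipT [RHS]ipP [RHS]ipT.
  by rewrite -[in LHS]xiP ipT -/P ipP TPT.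
have [q aq qT] := ph_full full (@aprx_ind _ _ (Phi M) (comp y)).
(* Compressing the preimage [q] of [T] by [rk e e] leaves a scalar. As [T] is idempotent the scalar
   is 0 or 1, and 0 contradicts the mass at [y]. *)
have Txi : T xi = ip (q e) e *: xi.
  have ae := aprx_rk X_lf xe xe.
  have Eq : ph q xi = ph (fun v => q (rk e e v)) xi.
    by rewrite (ph_comp (st := fun v => q (rk e e v)) aq ae (fun=> erefl)) xiP.
  rewrite TP /T -qT Eq /P.
  have ac := aprx_comp X_lf aq ae.
  rewrite -(@ph_comp _ _ _ (rk e e) _ (fun v => rk e e (q (rk e e v)))) //.
  rewrite (@ph_scale _ _ (ip (q e) e) (rk e e)) ?xiP // => v.
  by rewrite bop_rkE ?rk_comp //; exact: aprx_bop.
move: Txi; set c := ip _ _ => Txi.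
have : c *: (c *: xi) = c *: xi.
  by rewrite -Txi -[in LHS](bopZ (bop_ind _ _)) -Txi /T ind_idem.
rewrite scalerA => /eqP; rewrite -subr_eq0 -scalerBl scaler_eq0 => /orP[]; last first.
  by rewrite -nrm_eq0 xi1 oner_eq0.
have -> : c * c - c = c * (c - 1) by ring.
rewrite mulf_eq0 => /orP[/eqP c0|].
  move: nz; rewrite -(@ind_subl _ _ (Phi M) [set y] (comp y)); last first.
    by move=> ? ->; exact: compxx.
  by rewrite -/T Txi c0 scale0r (bop0 (bop_ind _ _)) eqxx.
by rewrite subr_eq0 /Loc -/T Txi => /eqP ->; rewrite scale1r.
Qed.

End Transport.

(** Faithfulness enters here: [rk e e] is nonzero, hence so is its image, and any nonzero vector in
    the range of that idempotent can be normalised. *)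
Lemma exists_xi (M : Aobj R k X) x (e : M) : faithful_functor Phi -> nrm e = 1 -> Loc x e ->
  exists2 xi : Phi M, nrm xi = 1 & ph (rk e e) xi = xi.
Proof.
move=> faith e1 xe; have ae := aprx_rk X_lf xe xe.
have [v nz] : exists v, ph (rk e e) v != 0.
  apply: contrapT => h; have : rk e e e = 0.
    apply: (ph_inj faith ae (aprx0 M M)) => v; rewrite ph0.
    by apply/eqP; apply: contrapT => /negP nz; apply: h; exists v.
  by rewrite rk_unit // => e0; have := oner_eq0 R; rewrite -e1 e0 nrm0 eqxx.
set w := ph _ v in nz.
exists (((nrm w)^-1)%:C%C *: w); first exact: normalize.
rewrite (bopZ (bop_ph ae)); congr (_ *: _).
rewrite /w -(@ph_comp _ _ _ (rk e e) (rk e e) (fun v => rk e e (rk e e v))) //.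
rewrite (@ph_scale _ _ 1 (rk e e)) ?scale1r // => u.
by rewrite rk_comp ipxx e1 expr1n.
Qed.

End Functor.

(** * Cofinal sequences of entourages and disjoint selection *)

Definition cofinal (X : coarseSpace) (E : nat -> set (X * X)) : Prop :=
  [/\ forall n, ent X (E n), forall m n, (m <= n)%N -> E m `<=` E n &
      forall F, ent X F -> exists n, F `<=` E n].

(** Each stage [B n] adds composites, transposes and the next generator. The subsets of the stages
    then form a coarse structure containing [G], and minimality gives cofinality. *)
Lemma countably_generated_cofinal (X : coarseSpace) :
  countably_generated X -> exists E, @cofinal X E.
Proof.
move=> [G /countable_injP[f finj] GE].
pose g n := [set p | exists2 S, G S & f S = n /\ S p].
have eG S : G S -> ent X S by move=> GS; rewrite GE => T [_]; apply.
have eg n : ent X (g n).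
  have [[S [GS fS]]|h] := pselect (exists S, G S /\ f S = n); last first.
    apply: ent_sub (ent_set0 X) => p [S GS [fS _]].
    by apply: h; exists S.
  apply: ent_sub (eG _ GS) => p [S' GS' [fS' pS']].
  by rewrite -(finj S' S) ?inE // fS' fS.
pose B := fix B n := if n is m.+1 then
  (B m `|` crel (B m) (B m)) `|` ((B m)^-1%relation `|` g m) else diagonal.
have B0 n : B n `<=` B n.+1 by move=> p Bp; left; left.
have Ble m n : (m <= n)%N -> B m `<=` B n.
  elim: n => [|n IH]; first by rewrite leqn0 => /eqP ->.
  by rewrite leq_eqVlt => /orP[/eqP -> //|/IH h]; exact: subset_trans (B0 n).
exists B; split=> // [n|F].
  elim: n => [|n IH]; first exact: ent_diag.
  apply: ent_setU; apply: ent_setU => //; [exact: ent_comp|exact: ent_inv].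
rewrite GE => /(_ [set E | exists n, E `<=` B n]); apply; split.
  split=> [|E E' EE' [n hn]|E E' [n hn] [m hm]|E [n hn]|E E' [n hn] [m hm]].
  - by exists 0%N.
  - by exists n; exact: subset_trans hn.
  - exists (maxn n m) => p [/hn|/hm]; apply: Ble; [exact: leq_maxl|exact: leq_maxr].
  - by exists n.+1 => -[a b] /hn h; right; left.
  - exists (maxn n m).+1 => -[a b] [z /hm ha /hn hb]; left; right; exists z.
      by apply: Ble ha; exact: leq_maxr.
    by apply: Ble hb; exact: leq_maxl.
by move=> S GS; exists (f S).+1 => p Sp; right; right; exists S.
Qed.

(* The selection principle behind all uniformity statements: a property that  *)
(* holds uniformly over the indices meeting any given finite set, but not     *)
(* uniformly, fails along a sequence of indices with disjoint footprints.     *)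
Lemma disjoint_selection (Z : coarseSpace) (E : nat -> set (Z * Z)) (I T : Type)
    (good : I -> set (Z * Z) -> Prop) (A : I -> set T) :
  cofinal E -> (forall i, finite_set (A i)) ->
  (forall i F F', F `<=` F' -> good i F -> good i F') ->
  (forall K, finite_set K -> exists2 F, ent Z F &
     forall i, A i `&` K !=set0 -> good i F) ->
  (exists2 F, ent Z F & forall i, good i F) \/
  exists i : nat -> I, (forall m n, m <> n -> A (i m) `&` A (i n) = set0) /\
    forall n, ~ good (i n) (E n).
Proof.
move=> [eE Ele cof] fA mono loc.
have [?|nunif] := pselect (exists2 F, ent Z F & forall i, good i F); first by left.
right.
have step n K : finite_set K -> exists i, A i `&` K = set0 /\ ~ good i (E n).
  move=> /loc[F eF hF]; apply: contrapT => h; apply: nunif.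
  (* Indices meeting [K] are good for [F], so an index bad for this union misses [K], and it is bad
     for [E n] as well. *)
  exists (E n `|` F); first exact: ent_setU.
  move=> i; have [AK|AK] := eqVneq (A i `&` K) set0; last first.
    by apply: mono (hF i _); [exact: subsetUr|exact/set0P].
  apply: contrapT => ng; apply: h; exists i; split=> // g.
  by apply: ng; apply: mono g; exact: subsetUl.
have [i0 _] := step 0%N set0 (finite_set0 _).
have /boolp.choice[f hf] (q : nat * set T) : exists i, finite_set q.2 ->
    A i `&` q.2 = set0 /\ ~ good i (E q.1).
  have [/(step q.1)[i hi]|nf] := pselect (finite_set q.2); first by exists i.
  by exists i0.
pose K := fix K n := if n is m.+1 then K m `|` A (f (m, K m)) else set0.
have fK n : finite_set (K n).
  by elim: n => [|n IH] //=; rewrite finite_setU.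
have Kle m n : (m < n)%N -> A (f (m, K m)) `<=` K n.
  elim: n => // n IH; rewrite ltnS leq_eqVlt => /orP[/eqP -> |/IH h] x Ax.
    by right.
  by left; exact: h.
exists (fun n => f (n, K n)); split=> [m n mn|n]; last first.
  by have [] := hf (n, K n) (fK n).
have W a b : (a < b)%N -> A (f (a, K a)) `&` A (f (b, K b)) = set0.
  move=> ab; have [h _] := hf (b, K b) (fK b).
  apply/seteqP; split=> // x [xa xb]; suff : (A (f (b, K b)) `&` K b) x by rewrite h.
  by split=> //; apply: Kle xa.
by have [mn'|nm|//] := ltngtP m n; [exact: W|rewrite setIC; exact: W].
Qed.

Lemma orthon_disjoint (R : realType) (X : coarseSpace) (C : coarse_module R X)
    (v : nat -> C) (A : nat -> set X) :
  (forall m n, m <> n -> A m `&` A n = set0) ->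
  (forall n, nrm (v n) = 1) -> (forall n, ind C (A n) (v n) = v n) -> orthon v.
Proof.
move=> dA v1 hv m n; have [->|mn] := eqVneq m n.
  by rewrite ipxx v1 expr1n.
by rewrite -hv -(hv n) ip_ind_disj // dA //; exact/eqP.
Qed.

Lemma sum_uniq_subset (R : realType) (T : eqType) (s s' : seq T) (f : T -> R) :
  uniq s -> uniq s' -> {subset s <= s'} -> (forall t, 0 <= f t) ->
  \sum_(t <- s) f t <= \sum_(t <- s') f t.
Proof.
move=> us us' ss' f0.
have <- : \sum_(t <- [seq t <- s' | t \in s]) f t = \sum_(t <- s) f t.
  apply: perm_big; apply: uniq_perm; rewrite ?filter_uniq // => t.
  by rewrite mem_filter; apply/andb_idr => /ss'.
rewrite big_filter [leRHS](bigID (mem s)) /= lerDl sumr_ge0 // => t _.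
Qed.

(* Choosing the signs greedily, a signed sum has at least the size given by   *)
(* the random one. *)
Lemma greedy_signs (R : realType) (H : hilbertType R[i]) (T : eqType)
    (s : seq T) (g : T -> H) (u : H) : uniq s ->
  exists a : T -> bool, nrm u ^+ 2 + \sum_(t <- s) nrm (g t) ^+ 2 <=
    nrm (u + \sum_(t <- s) (-1) ^+ a t *: g t) ^+ 2.
Proof.
elim: s u => [|t s IH] u /=; first by exists (fun=> false); rewrite !big_nil !addr0.
move=> /andP[ts us].
have [b hb] : exists b : bool,
    nrm u ^+ 2 + nrm (g t) ^+ 2 <= nrm (u + (-1) ^+ b *: g t) ^+ 2.
  have [h|h] := parallelogram_max u (g t).
    by exists false; rewrite expr0 scale1r.
  by exists true; rewrite expr1 scaleN1r.
have [a ha] := IH (u + (-1) ^+ b *: g t) us.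
exists (fun t' => if t' == t then b else a t').
rewrite !big_cons eqxx !addrA.
have -> : \sum_(j <- s) (-1) ^+ (if j == t then b else a j) *: g j =
          \sum_(j <- s) (-1) ^+ a j *: g j.
  rewrite !big_seq; apply: eq_bigr => j js; case: eqP => // jt.
  by move: ts; rewrite -jt js.
by apply: le_trans ha; rewrite lerD2r.
Qed.

(** * Rank one projections on both sides *)

Section Frames.
Context {R : realType} {k : rank_bound} {X Y : coarseSpace}.
Variable Phi : star_functor R k X Y.

(* Unit vectors at the points of [D] with matching unit vectors in the        *)
(* ranges of the images of the corresponding rank one projections.            *)
Record frame (M : Aobj R k X) (D : set X) (e : X -> M) (xi : X -> Phi M) :
    Prop := Frame {
  frame_e1 : forall x, D x -> nrm (e x) = 1;
  frame_ind : forall x, D x -> ind M [set x] (e x) = e x;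
  frame_xi1 : forall x, D x -> nrm (xi x) = 1;
  frame_xi : forall x, D x -> ph (rk (e x) (e x)) (xi x) = xi x }.

Hypotheses (X_lf : locally_finite X) (Y_lf : locally_finite Y).
Hypotheses (full : full_functor Phi).
Variables (M : Aobj R k X) (D : set X) (e : X -> M) (xi : X -> Phi M).
Hypothesis fr : frame D e xi.
Implicit Types C : Aobj R k X.

Local Notation W x := (transp (e x) (xi x)).

Lemma frame_Loc x : D x -> Loc x (e x).
Proof. by move=> /(frame_ind fr); apply: Loc_bounded => _ ->; exact: compxx. Qed.

(** Turns a question about [T (xi x)] in [Y] into one about [t (e x)] in [X], where [t] is the
    preimage of [T] under [ph]. *)
Lemma W_pull C (t : M -> C) T x : D x -> aprx t -> ph t = T ->
  W x (t (e x)) = T (xi x).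
Proof.
move=> Dx at_ <-; have lx := frame_Loc Dx.
by rewrite -(transp_app X_lf (xi x) lx at_ lx) transp_e // (frame_xi fr).
Qed.

Lemma W_app C C' (t : C -> C') x v : D x -> aprx t -> Loc x v ->
  ph t (W x v) = W x (t v).
Proof. by move=> Dx at_ lv; rewrite (transp_app X_lf _ (frame_Loc Dx)). Qed.

Lemma W_nrm C x (v : C) : D x -> Loc x v -> nrm (W x v) = nrm v.
Proof.
move=> Dx; apply: transp_nrm => //; first exact: frame_Loc.
- exact: (frame_xi1 fr).
- exact: (frame_xi fr).
Qed.

Lemma W_e x : D x -> W x (e x) = xi x.
Proof. by move=> Dx; rewrite transp_e // (frame_xi fr). Qed.

Lemma W_lin C a x (v w : C) : D x -> Loc x v -> Loc x w ->
  W x (a *: v + w) = a *: W x v + W x w.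
Proof. by move=> Dx lv lw; rewrite (transp_lin X_lf _ (frame_Loc Dx)). Qed.

Lemma W_scale C a x (v : C) : D x -> Loc x v -> W x (a *: v) = a *: W x v.
Proof. by move=> Dx lv; rewrite (transp_scale X_lf _ (frame_Loc Dx)). Qed.

Lemma W_sub C x (v w : C) : D x -> Loc x v -> Loc x w ->
  W x (v - w) = W x v - W x w.
Proof.
by move=> Dx lv lw; rewrite addrC -scaleN1r W_lin // scaleN1r addrC.
Qed.

Lemma Loc0 C x : Loc x (0 : C).
Proof. by rewrite /Loc (bop0 (bop_ind _ _)). Qed.

Lemma Loc_sum C x (I : eqType) (s : seq I) (g : I -> C) :
  (forall i, i \in s -> Loc x (g i)) -> Loc x (\sum_(i <- s) g i).
Proof.
move=> h; rewrite /Loc (bop_sum (bop_ind _ _)) !big_seq.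
by apply: eq_bigr => i /h.
Qed.

Lemma W_sum C x (I : eqType) (s : seq I) (c : I -> R[i]) (g : I -> C) :
  D x -> (forall i, i \in s -> Loc x (g i)) ->
  W x (\sum_(i <- s) c i *: g i) = \sum_(i <- s) c i *: W x (g i).
Proof.
move=> Dx; elim: s => [|i s IH] lg.
  rewrite !big_nil; have := W_scale 0 Dx (@Loc0 C x).
  by rewrite !scale0r.
have lg' j : j \in s -> Loc x (g j) by move=> js; apply: lg; rewrite inE js orbT.
rewrite !big_cons W_lin ?IH //; first by apply: lg; rewrite mem_head.
by apply: Loc_sum => j /lg'; exact: LocZ.
Qed.

Lemma frame_Loc_ind x y : D x -> ind (Phi M) [set y] (xi x) != 0 -> Loc y (xi x).
Proof.
move=> Dx; apply: (Loc_of_ind X_lf Y_lf (frame_Loc Dx)) => //.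
- exact: (frame_xi1 fr).
- exact: (frame_xi fr).
Qed.

End Frames.

(** * Gliding hump: pullbacks of point projections stay near [x] *)

Section Spread.
Context {R : realType} {k : rank_bound} {X Y : coarseSpace}.
Variable Phi : star_functor R k X Y.
Hypotheses (X_lf : locally_finite X) (Y_lf : locally_finite Y).
Hypotheses (full : full_functor Phi).
Variable EX : nat -> set (X * X).
Hypotheses (EX_cof : cofinal EX).
Variables (M : Aobj R k X) (D : set X) (e : X -> M) (xi : X -> Phi M).
Hypothesis fr : frame D e xi.
Variable t : Y -> M -> M.
Hypothesis at_ : forall y, aprx (t y).
Hypothesis tP : forall y, ph (t y) = ind (Phi M) [set y].

(** [t y (e x)] is the pullback under [W x] of the part of [xi x] at [y]; this is the squared mass
    of these pullbacks away from [x]. *)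
Definition spread E x (s : seq Y) : R :=
  \sum_(y <- s) nrm (ind M (~` thicken E [set x]) (t y (e x))) ^+ 2.

Lemma thickenS (E E' : set (X * X)) (A : set X) : E `<=` E' ->
  thicken E A `<=` thicken E' A.
Proof. by move=> EE' z [a Aa Eza]; exists a => //; exact: EE'. Qed.

Lemma ind_thickenC E E' (C : coarse_module R X) A (v : C) : E `<=` E' ->
  nrm (ind C (~` thicken E' A) v) <= nrm (ind C (~` thicken E A) v).
Proof. by move=> h; apply: ind_le => z nz hz; apply: nz; exact: thickenS hz. Qed.

Lemma aprx_spread (s : M -> M) (c : R) : aprx s -> 0 < c -> exists2 F, ent X F &
  forall x, D x -> nrm (ind M (~` thicken F [set x]) (s (e x))) <= c.
Proof.
move=> as_ c0; have [F eF hF] := aprx_quasilocal X_lf as_ c0.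
exists F => // x Dx; rewrite -(frame_ind fr Dx) -[leRHS]mulr1 -(frame_e1 fr Dx).
by apply: hF => z _ nz -> Fz; apply: nz; exists x.
Qed.

(** The signs on [L] are already fixed. Each [t y] with [y] in [L] is approximable, so after
    enlarging the entourage these points account for at most [c ^+ 2] of the spread; more than
    [c ^+ 2] is left to new points, whose signs are free. [L'] also carries nearly all of [xi x], so
    that later signs hardly matter at [x]. *)
Lemma spread_step (c : R) : 0 < c ->
  (forall E, ent X E -> exists2 x, D x & exists2 s, uniq s & 2 * c ^+ 2 < spread E x s) ->
  forall n (L : seq Y) (a : Y -> bool), uniq L ->
  exists x L' a', [/\ D x /\ uniq L', {subset L <= L'}, {in L, a =1 a'},
    nrm (ind (Phi M) (~` [set` L']) (xi x)) <= c / 8 &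
    c < nrm (ind M (~` thicken (EX n) [set x])
           (\sum_(y <- L') (-1) ^+ a' y *: t y (e x)))].
Proof.
move=> c0 hbad n L a uL; have [eX _ _] := EX_cof.
(* With [eta = c / m] the points of [L] contribute at most [size L] times [eta ^+ 2], hence at most
   [c ^+ 2]. *)
set m : R := (size L)%:R + 1.
have m0 : 0 < m by rewrite ltr_wpDl.
pose eta := c / m; have eta0 : 0 < eta by rewrite divr_gt0.
have /boolp.choice[F hF] y : exists F, ent X F /\
    forall x, D x -> nrm (ind M (~` thicken F [set x]) (t y (e x))) <= eta.
  by have [F ? ?] := aprx_spread (at_ y) eta0; exists F.
pose E := EX n `|` [set p | exists2 y, y \in L & F y p].
have eE : ent X E.
  by apply: ent_setU => //; apply: ent_bigU => y _; have [] := hF y.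
have [x Dx [s us hs]] := hbad _ eE.
have c8 : 0 < c / 8 by rewrite divr_gt0.
have [_ /finite_uniq_seq[q uq ->] hq] := ind_tail Y_lf (xi x) c8.
pose N := [seq y <- undup (s ++ q) | y \notin L].
have uN : uniq N by rewrite filter_uniq // undup_uniq.
have uLN : uniq (L ++ N).
  rewrite cat_uniq uL uN andbT /=; apply/hasPn => y; rewrite mem_filter.
  by case/andP.
have subs y : (y \in s) || (y \in q) -> y \in L ++ N.
  move=> h; rewrite mem_cat mem_filter mem_undup mem_cat h andbT.
  by case: (y \in L).
have badL : spread E x L <= c ^+ 2.
  have : spread E x L <= \sum_(y <- L) eta ^+ 2.
    rewrite /spread !big_seq; apply: ler_sum => y yL.
    rewrite ler_pXn2r ?nnegrE ?nrm_ge0 ?(ltW eta0) //; have [_ h] := hF y.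
    apply: le_trans (h _ Dx); apply: ind_thickenC => p Fp.
    by right; exists y.
  move=> /le_trans; apply; rewrite big_const_seq count_predT iter_addr_0.
  rewrite -mulr_natl.
  have hm : (size L)%:R <= m ^+ 2 by rewrite expr2 /m; have := ler0n R (size L); nra.
  rewrite /eta exprMn exprVn mulrCA ger_pMr ?exprn_gt0 //.
  by rewrite ler_pdivrMr ?exprn_gt0 // mul1r.
have badN : c ^+ 2 < spread E x N.
  have : spread E x s <= spread E x (L ++ N).
    apply: sum_uniq_subset => // [y ys|y]; last exact: sqr_ge0.
    by apply: subs; rewrite ys.
  rewrite {2}/spread big_cat /= -/(spread E x L) -/(spread E x N); lra.
pose g y := ind M (~` thicken E [set x]) (t y (e x)).
(* The greedy choice starts from the signed sum over [L], so the old terms cannot cancel the new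
   ones. *)
have [b hb] := @greedy_signs _ M _ N g (\sum_(y <- L) (-1) ^+ a y *: g y) uN.
pose a' y := if y \in L then a y else b y.
exists x, (L ++ N), a'; split=> //.
- by move=> y yL; rewrite mem_cat yL.
- by move=> y yL; rewrite /a' yL.
- apply: le_trans hq; apply: ind_le => y nL yq; apply: nL => /=.
  by apply: subs; rewrite [y \in q]yq orbT.
have EnE : EX n `<=` E by exact: subsetUl.
apply: lt_le_trans (ind_thickenC _ _ EnE).
rewrite -(@ltr_pXn2r _ 2) ?nnegrE ?nrm_ge0 ?ltW //.
rewrite (bop_sum (bop_ind _ _)) big_cat /=.
under eq_bigr do rewrite (bopZ (bop_ind _ _)).
under [X in _ < nrm (_ + X) ^+ 2]eq_bigr do rewrite (bopZ (bop_ind _ _)).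
have -> : \sum_(y <- L) (-1) ^+ a' y *: ind M (~` thicken E [set x]) (t y (e x)) =
    \sum_(y <- L) (-1) ^+ a y *: g y.
  by rewrite !big_seq; apply: eq_bigr => y yL; rewrite /a' yL.
have -> : \sum_(y <- N) (-1) ^+ a' y *: ind M (~` thicken E [set x]) (t y (e x)) =
    \sum_(y <- N) (-1) ^+ b y *: g y.
  rewrite !big_seq; apply: eq_bigr => y; rewrite mem_filter /a' => /andP[].
  by move=> /negbTE ->.
apply: lt_le_trans hb; apply: lt_le_trans badN _; rewrite lerDr; exact: sqr_ge0.
Qed.

Lemma spread_small (c : R) : 0 < c -> exists2 E, ent X E &
  forall x s, D x -> uniq s -> spread E x s <= 2 * c ^+ 2.
Proof.
move=> c0; apply: contrapT => hno.
have hbad E : ent X E -> exists2 x, D x & exists2 s, uniq s & 2 * c ^+ 2 < spread E x s.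
  move=> eE; apply: contrapT => h; apply: hno; exists E => // x s Dx us.
  by rewrite leNgt; apply/negP => lt; apply: h; exists x => //; exists s.
have step := spread_step c0 hbad.
pose St := (X * (seq Y * (Y -> bool)))%type.
have /boolp.choice[f hf] (q : nat * (seq Y * (Y -> bool))) : exists r : St,
   uniq q.2.1 -> [/\ D r.1 /\ uniq r.2.1, {subset q.2.1 <= r.2.1},
    {in q.2.1, q.2.2 =1 r.2.2},
    nrm (ind (Phi M) (~` [set` r.2.1]) (xi r.1)) <= c / 8 &
    c < nrm (ind M (~` thicken (EX q.1) [set r.1])
           (\sum_(y <- r.2.1) (-1) ^+ r.2.2 y *: t y (e r.1)))].
  have [u|nu] := pselect (uniq q.2.1).
    by have [x [L' [a' h]]] := step q.1 q.2.1 q.2.2 u; exists (x, (L', a')).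
  (* Filler for lists with repetitions; [uS] excludes them. *)
  by have [x _ _] := hbad _ (ent_set0 X); exists (x, q.2).
pose S := fix S n := if n is m.+1 then (f (m, S m)).2 else ([::], fun=> false).
pose xs n := (f (n, S n)).1.
have uS n : uniq (S n).1.
  by elim: n => [//|n IH] /=; have [[]] := hf (n, S n) IH.
have hS n := hf (n, S n) (uS n).
have SS n : {subset (S n).1 <= (S n.+1).1} by have [] := hS n.
have aS n : {in (S n).1, (S n).2 =1 (S n.+1).2} by have [] := hS n.
have Sle m n : (m <= n)%N -> {subset (S m).1 <= (S n).1} /\
    {in (S m).1, (S m).2 =1 (S n).2}.
  elim: n => [|n IH]; first by rewrite leqn0 => /eqP ->.
  rewrite leq_eqVlt => /orP[/eqP ->|]; first by split=> y.
  move=> /IH[h1 h2]; split=> [y /h1/SS //|y ym].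
  by rewrite h2 // aS //; exact: h1.
(* The limit of the sign choices: [V] below is the diagonal operator with sign -1 on [T] and +1
   elsewhere. *)
pose T := [set y | exists n, y \in (S n).1 /\ (S n).2 y].
have TS n y : y \in (S n).1 -> `[< T y >] = (S n).2 y.
  move=> yn; apply/asboolP/idP => [[m [ym Sy]]|Sy]; last by exists n.
  have [mn|/ltnW nm] := leqP m n.
    by have [_ h] := Sle _ _ mn; rewrite -(h y ym).
  by have [_ h] := Sle _ _ nm; rewrite (h y yn).
pose V (v : Phi M) : Phi M := (-2) *: ind (Phi M) T v + v.
have aV : aprx V.
  apply: aprx_lin; first exact: aprx_ind.
  have := @aprx_ind _ _ (Phi M) setT; congr aprx.
  by apply/funext => v; rewrite indT.
have [u au uV] := ph_full full aV.
have VT y v : V (ind (Phi M) [set y] v) = (-1) ^+ `[< T y >] *: ind (Phi M) [set y] v.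
  rewrite /V -indI; have [Ty|nTy] := pselect (T y).
    rewrite (_ : T `&` [set y] = [set y]); last first.
      by apply/seteqP; split=> [z []|z ->].
    rewrite asboolT // expr1 -{2}[ind _ _ _]scale1r -scalerDl; congr (_ *: _).
    by ring.
  rewrite (_ : T `&` [set y] = set0); last first.
    by apply/seteqP; split=> [z [Tz zy]|z //]; apply: nTy; rewrite -zy.
  by rewrite ind0 scaler0 add0r asboolF // expr0 scale1r.
have Vn v : nrm (V v) <= 3 * nrm v.
  apply: le_trans (nrmD _ _) _; rewrite nrmZ nrmN.
  have n2 : nrm (2 : R[i]) <= 2 by have := nrmD (1 : R[i]) 1; rewrite nrm1.
  have := @nrm_ind _ _ (Phi M) T v; have := nrm_ge0 (ind (Phi M) T v); nra.
have c2 : 0 < c / 2 by rewrite divr_gt0.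
have [F eF hF] := aprx_spread au c2.
have [eX _ cofX] := EX_cof; have [n Fn] := cofX _ eF.
have [[Dx uL] _ _ tl big] := hS n; rewrite -/(xs n) /= in Dx uL tl big.
set x := xs n in Dx tl big; set L := (S n.+1).1 in uL tl big.
have lx := frame_Loc fr Dx.
set w := \sum_(y <- _) _ in big.
have lty y : Loc x (t y (e x)) by apply: aprx_Loc.
have lw : Loc x w.
  by apply: Loc_sum => y _; apply: LocZ.
(* [W x] carries [w] to [V] applied to the part of [xi x] over [L]; the rest has norm at most
   [c / 8] and [V] is bounded by 3. Thus [u (e x)] keeps at least [5 / 8] of [c] away from [x],
   against the bound [c / 2]. *)
have hd : nrm (u (e x) - w) <= 3 * (c / 8).
  have lu : Loc x (u (e x)) by exact: aprx_Loc.
  have ld : Loc x (u (e x) - w).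
    by rewrite -scaleN1r addrC; apply: LocD => //; exact: LocZ.
  rewrite -(W_nrm X_lf fr Dx ld) (W_sub X_lf fr) // (W_pull X_lf fr Dx au uV).
  rewrite (W_sum X_lf fr) //.
  have -> : \sum_(y <- L) (-1) ^+ (S n.+1).2 y *: transp (e x) (xi x) (t y (e x)) =
      V (ind (Phi M) [set` L] (xi x)).
    rewrite ind_seq // (bop_sum (aprx_bop aV)) !big_seq.
    apply: eq_bigr => y yL; rewrite VT (TS _ _ yL); congr (_ *: _).
    exact: (W_pull X_lf fr Dx (at_ y) (tP y)).
  rewrite -(bopB (aprx_bop aV)) -indC; apply: le_trans (Vn _) _.
  by rewrite ler_pM2l.
have h1 : nrm (ind M (~` thicken (EX n) [set x]) (u (e x))) <= c / 2.
  by apply: le_trans (ind_thickenC _ _ Fn) (hF _ Dx).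
have := nrm_sub (ind M (~` thicken (EX n) [set x]) w)
                (ind M (~` thicken (EX n) [set x]) (u (e x))).
rewrite -(bopB (bop_ind _ _)) => h2.
have := @nrm_ind _ _ M (~` thicken (EX n) [set x]) (w - u (e x)).
rewrite nrmB; lra.
Qed.

End Spread.

(** * Concentration of [xi x] on a uniformly bounded set *)

Section Concentration.
Context {R : realType} {k : rank_bound} {X Y : coarseSpace}.
Variable Phi : star_functor R k X Y.
Hypotheses (X_lf : locally_finite X) (Y_lf : locally_finite Y).
Hypotheses (full : full_functor Phi).
Variables (EX : nat -> set (X * X)) (EY : nat -> set (Y * Y)).
Hypotheses (EX_cof : cofinal EX) (EY_cof : cofinal EY).
Variables (M : Aobj R k X) (D : set X) (e : X -> M) (xi : X -> Phi M).
Hypothesis fr : frame D e xi.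
Local Notation W x := (transp (e x) (xi x)).

(** Quasilocality lets the part of [z n] on [A' n] reach [A n] with at most [d / 4], and the
    remaining part has norm at most [d / 4]. It is applied to images [S] of partial isometries over
    [X] that would move mass arbitrarily far. *)
Lemma quasilocal_contradiction (P Q : coarse_module R Y) (S : P -> Q)
    (z : nat -> P) (A A' : nat -> set Y) (d : R) :
  aprx S -> (forall v, nrm (S v) <= nrm v) -> 0 < d ->
  (forall n, nrm (z n) <= 1) ->
  (forall n, nrm (ind P (~` A' n) (z n)) <= d / 4) ->
  (forall n, d <= nrm (ind Q (A n) (S (z n)))) ->
  (forall F, ent Y F -> exists n, forall y y', A n y -> A' n y' -> ~ F (y, y')) ->
  False.
Proof.
move=> aS Sc d0 z1 zA SA sep.
have d4 : 0 < d / 4 by rewrite divr_gt0.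
have [F eF hF] := aprx_quasilocal Y_lf aS d4.
have [n hn] := sep _ eF.
have h1 := hF _ _ hn (z n).
have := SA n; rewrite -[in S _](ind_setC (A' n) (z n)).
rewrite (bopD (aprx_bop aS)) (bopD (bop_ind _ _)) => h2.
have := nrmD (ind Q (A n) (S (ind P (A' n) (z n))))
             (ind Q (A n) (S (ind P (~` A' n) (z n)))).
have h3 := le_trans (nrm_ind (A n) _) (le_trans (Sc _) (zA n)).
have h4 : d / 4 * nrm (z n) <= d / 4.
  by rewrite -[leRHS]mulr1 ler_wpM2l // ltW.
lra.
Qed.

Section WithPullback.
Variable t : Y -> M -> M.
Hypothesis at_ : forall y, aprx (t y).
Hypothesis tP : forall y, ph (t y) = ind (Phi M) [set y].

Let W_t x y : D x -> W x (t y (e x)) = ind (Phi M) [set y] (xi x).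
Proof. by move=> Dx; apply: (W_pull X_lf fr). Qed.

Let Loc_t x y : D x -> Loc x (t y (e x)).
Proof. by move=> Dx; apply: aprx_Loc => //; exact: frame_Loc fr _ Dx. Qed.

(** With the factor 9 the truncation near [x] keeps at least 8/9 of the vector, so the discarded
    part is at most 1/8 of the truncation, as [trunc_spec] needs. *)
Definition inner_point (E : set (X * X)) x : set Y :=
  [set y | t y (e x) != 0 /\
     9 * nrm (ind M (~` thicken E [set x]) (t y (e x))) <= nrm (t y (e x))].

(** At a point that is not inner, the whole vector is at most 9 times its part away from [x], and
    the squares of those parts sum to [spread]. *)
Lemma outer_mass E x c (q : seq Y) : D x -> uniq q ->
  spread e t E x q <= c ^+ 2 -> 0 <= c ->
  nrm (ind (Phi M) ([set` q] `\` inner_point E x) (xi x)) <= 9 * c.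
Proof.
move=> Dx uq hq c0.
pose N := [seq y <- q | ~~ `[< inner_point E x y >]].
have -> : [set` q] `\` inner_point E x = [set` N].
  apply/seteqP; split=> y /=; rewrite mem_filter.
    by move=> [-> nI]; rewrite andbT; apply/asboolPn.
  by move=> /andP[/asboolPn nI ->].
have uN : uniq N by rewrite filter_uniq.
rewrite -(@ler_pXn2r _ 2) ?nnegrE ?nrm_ge0 ?mulr_ge0 // nrm_ind_seq //.
apply: (@le_trans _ _ (9 ^+ 2 * spread e t E x N)).
  rewrite /spread mulr_sumr !big_seq; apply: ler_sum => y.
  rewrite mem_filter => /andP[/asboolPn nI yq].
  rewrite -W_t // (W_nrm X_lf fr Dx (Loc_t y Dx)) -exprMn.
  rewrite ler_pXn2r ?nnegrE ?mulr_ge0 ?nrm_ge0 //.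
  have [->|nz] := eqVneq (t y (e x)) 0; first by rewrite nrm0 mulr_ge0 ?nrm_ge0.
  by rewrite leNgt; apply/negP => h; apply: nI; split=> //; exact: ltW.
rewrite exprMn ler_wpM2l ?sqr_ge0 //; apply: le_trans hq.
apply: sum_uniq_subset => // y; last exact: sqr_ge0.
by rewrite mem_filter => /andP[].
Qed.

(* The normalised truncation of [U^* 1_y U e_x]; [U] maps it close to the     *)
(* point [y].                                                                 *)
Definition trunc E x y : M := let v := ind M (thicken E [set x]) (t y (e x)) in
  ((nrm v)^-1)%:C%C *: v.

Lemma trunc_spec E x y : D x -> ent X E -> inner_point E x y ->
  [/\ Loc x (trunc E x y), nrm (trunc E x y) = 1,
      ind M (thicken E [set x]) (trunc E x y) = trunc E x y &
      nrm (ind (Phi M) (~` [set y]) (W x (trunc E x y))) <= 8^-1].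
Proof.
move=> Dx eE [nz hin]; have lt_ := Loc_t y Dx.
set v := ind M (thicken E [set x]) (t y (e x)).
have na : 0 < nrm (t y (e x)) by rewrite nrm_gt0.
set w := ind M (~` thicken E [set x]) (t y (e x)) in hin.
have vw : t y (e x) = v + w by rewrite ind_setC.
have nv : 8 * nrm (t y (e x)) <= 9 * nrm v.
  by have := nrmD v w; rewrite -vw; lra.
have v0 : 0 < nrm v by lra.
have lv : Loc x v.
  apply: (@Loc_bounded _ _ _ _ (thicken E [set x])); last exact: ind_idem.
  by move=> z [_ -> Ez]; exact: comp_ent Ez.
have lw : Loc x w by apply: aprx_Loc lt_ => //; exact: aprx_ind.
rewrite /trunc -/v; split.
- exact: LocZ.
- by apply: normalize; rewrite -nrm_gt0.
- by rewrite (bopZ (bop_ind _ _)) ind_idem.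
rewrite (W_scale X_lf fr) //.
(* The first term lives at [y], so off [y] only the image of the small discarded part [w] is
   seen. *)
have -> : W x v = ind (Phi M) [set y] (xi x) - W x w.
  by rewrite -W_t // -(W_sub X_lf fr) // vw addrK.
rewrite (bopZ (bop_ind _ _)) (bopB (bop_ind _ _)) [ind _ (~` _) _ in X in X - _]ind_disj ?setICl //.
rewrite sub0r nrmZ nrmN nrm_real ger0_norm ?invr_ge0 ?nrm_ge0 //.
rewrite ler_pdivrMl //; apply: le_trans (nrm_ind _ _) _.
rewrite (W_nrm X_lf fr) //; lra.
Qed.

(** For one [x] the inner points in the finite list [q x] lie in one component, which settles the
    indices near a finite set. For the others the truncations are exactly supported near [x], hence
    orthonormal over disjoint footprints, and the isometry taking those at [y'] to those at [y] has
    propagation [E] composed with its transpose. *)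
Lemma inner_points_bounded E (q : X -> seq Y) : ent X E ->
  exists2 F, ent Y F & forall x, D x ->
    rel_bounded F ([set` q x] `&` inner_point E x).
Proof.
move=> eE; pose G x := [set` q x] `&` inner_point E x.
have Gnz x y : D x -> G x y -> ind (Phi M) [set y] (xi x) != 0.
  move=> Dx [_ [nz _]]; rewrite -W_t // -nrm_gt0 (W_nrm X_lf fr Dx) ?nrm_gt0 //.
  exact: Loc_t.
have Gcomp x y y' : D x -> G x y -> G x y' -> comp y y'.
  move=> Dx Gy Gy'; apply: contrapT => ny; have := Gnz _ _ Dx Gy'.
  have ly := frame_Loc_ind X_lf Y_lf full fr Dx (Gnz _ _ Dx Gy).
  by rewrite (ind_notin ny ly) eqxx.
have fG x : finite_set (G x) by exact: finite_setIl.
pose good (i : X * (Y * Y)) F := D i.1 -> G i.1 i.2.1 -> G i.1 i.2.2 -> F i.2.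
pose A (i : X * (Y * Y)) := thicken E [set i.1].
have [||||] := @disjoint_selection Y EY (X * (Y * Y)) X good A EY_cof.
- by move=> i; exact: finite_thicken.
- by move=> i F F' FF' g Dx Gy Gy'; apply: FF'; exact: g.
- move=> K fK; pose K' := thicken (E^-1)%relation K `&` D.
  exists [set p | exists2 x, K' x & (G x `*` G x) p].
    apply: ent_bigU_finite => [|x [_ Dx]].
      by apply: finite_setIl; apply: finite_thicken_set fK => //; exact: ent_inv.
    have [->|/set0P[y Gy]] := eqVneq (G x) set0.
      by apply: ent_sub (ent_set0 Y) => p [].
    by apply: (@ent_comp_finite _ y) => // y' Gy'; exact: Gcomp Dx Gy Gy'.
  move=> i [z [[_ -> Ezx] Kz]] Dx Gy Gy'; exists i.1 => //; split=> //.
  by exists z.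
- move=> [F eF hF]; exists F => // x Dx [y y'] [/= Gy Gy'].
  exact: (hF (x, (y, y'))).
move=> [i [dA ng]]; exfalso.
have {ng}hi n : [/\ D (i n).1, G (i n).1 (i n).2.1, G (i n).1 (i n).2.2 &
    ~ EY n (i n).2].
  have := ng n; rewrite /good => h; split; apply: contrapT => h'; apply: h => *;
    by apply: contrapT => h''; apply: h'.
pose a n := trunc E (i n).1 (i n).2.1; pose b n := trunc E (i n).1 (i n).2.2.
have ha n : [/\ Loc (i n).1 (a n), nrm (a n) = 1,
      ind M (thicken E [set (i n).1]) (a n) = a n &
      nrm (ind (Phi M) (~` [set (i n).2.1]) (W (i n).1 (a n))) <= 8^-1].
  by have [Dx [_ Gy] _ _] := hi n; exact: trunc_spec.
have hb n : [/\ Loc (i n).1 (b n), nrm (b n) = 1,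
      ind M (thicken E [set (i n).1]) (b n) = b n &
      nrm (ind (Phi M) (~` [set (i n).2.2]) (W (i n).1 (b n))) <= 8^-1].
  by have [Dx _ [_ Gy] _] := hi n; exact: trunc_spec.
have oa : orthon a by apply: (orthon_disjoint dA) => n; have [] := ha n.
have ob : orthon b by apply: (orthon_disjoint dA) => n; have [] := hb n.
have [|s [s' [as_ as' adj sss sba]]] :=
    controlled_isometry X_lf (ent_comp eE (ent_inv eE)) ob oa.
  move=> n; exists (thicken E [set (i n).1]), (thicken E [set (i n).1]).
  split; [by have [] := ha n|by have [] := hb n|].
  by move=> [z z'] [[_ -> Ez] [_ -> Ez']]; exists (i n).1.
(* For [d = 1/2] the tail 1/8 from [trunc_spec] is exactly [d / 4], and the mass at the target point
   is at least 7/8. *)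
apply: (@quasilocal_contradiction _ _ (ph s) (fun n => W (i n).1 (b n))
  (fun n => [set (i n).2.1]) (fun n => [set (i n).2.2]) (2^-1)).
- exact: ph_aprx.
- exact: ph_contr adj sss.
- by rewrite invr_gt0.
- by move=> n; have [Dx _ _ _] := hi n; have [lb b1 _ _] := hb n;
    rewrite (W_nrm X_lf fr) // b1.
- by move=> n; have [_ _ _ /le_trans] := hb n; apply; lra.
- move=> n; have [Dx _ _ _] := hi n; have [lb _ _ _] := hb n.
  have [la a1 _ ta] := ha n.
  rewrite (W_app X_lf fr) // sba; set u := W _ _ in ta *.
  have : nrm u = 1 by rewrite (W_nrm X_lf fr).
  have := nrmD (ind (Phi M) [set (i n).2.1] u) (ind (Phi M) (~` [set (i n).2.1]) u).
  rewrite ind_setC; lra.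
- move=> F eF; have [_ _ cof] := EY_cof; have [n Fn] := cof _ eF.
  exists n => y y' -> -> /Fn; have [_ _ _] := hi n.
  by case: ((i n).2).
Qed.

End WithPullback.

Theorem concentration (eps : R) : 0 < eps -> exists2 F, ent Y F &
  forall x, D x -> exists G, [/\ finite_set G, rel_bounded F G,
    nrm (ind (Phi M) (~` G) (xi x)) <= eps &
    forall y, G y -> ind (Phi M) [set y] (xi x) != 0].
Proof.
move=> e0.
have /boolp.choice[t ht] y : exists t : M -> M, aprx t /\ ph t = ind (Phi M) [set y].
  by have [t ? ?] := ph_full full (@aprx_ind _ _ (Phi M) [set y]); exists t.
have at_ y : aprx (t y) by have [] := ht y.
have tP y : ph (t y) = ind (Phi M) [set y] by have [] := ht y.
(* The spread is then at most [(eps / 18) ^+ 2], so [outer_mass] costs [9 * (eps / 18) = eps / 2];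
   the other half is the tail outside [q x]. *)
have c0 : 0 < eps / 36 by rewrite divr_gt0.
have [E eE hE] := spread_small X_lf Y_lf full EX_cof fr at_ tP c0.
have e2 : 0 < eps / 2 by rewrite divr_gt0.
have /boolp.choice[q hq] x : exists q : seq Y, uniq q /\
    nrm (ind (Phi M) (~` [set` q]) (xi x)) <= eps / 2.
  have [K /finite_uniq_seq[q uq ->] hK] := ind_tail Y_lf (xi x) e2.
  by exists q.
have [F eF hF] := inner_points_bounded at_ tP q eE.
exists F => // x Dx; exists ([set` q x] `&` inner_point t E x); split.
- exact: finite_setIl.
- exact: hF.
- have [uq tl] := hq x.
  have -> : ~` ([set` q x] `&` inner_point t E x) =
      ~` [set` q x] `|` ([set` q x] `\` inner_point t E x).
    apply/seteqP; split=> y /=.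
      by move=> h; have [yq|] := pselect (y \in q x); [right; split=> // hi; apply: h|left].
    by move=> [nq [] //|[_ nI] []].
  rewrite ind_setU; last by apply/seteqP; split=> // y [nq []].
  apply: le_trans (nrmD _ _) _.
  have h1 : spread e t E x (q x) <= (eps / 18) ^+ 2.
    apply: le_trans (hE _ _ Dx uq) _; have := sqr_ge0 (eps / 36).
    rewrite (_ : eps / 18 = 2 * (eps / 36)); last by lra.
    by rewrite exprMn; lra.
  have e18 : 0 <= eps / 18 by lra.
  have := outer_mass at_ tP Dx uq h1 e18; lra.
- move=> y [_ [nz _]]; rewrite -(W_pull X_lf fr Dx (at_ y) (tP y)) -nrm_gt0.
  by rewrite (W_nrm X_lf fr Dx) ?nrm_gt0 //; apply: aprx_Loc => //; exact: frame_Loc fr _ Dx.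
Qed.

End Concentration.

(** * The coarse embedding *)

Section Embedding.
Context {R : realType} {k : rank_bound} {X Y : coarseSpace}.
Variable Phi : star_functor R k X Y.
Hypotheses (X_lf : locally_finite X) (Y_lf : locally_finite Y).
Hypotheses (full : full_functor Phi).
Variables (EX : nat -> set (X * X)) (EY : nat -> set (Y * Y)).
Hypotheses (EX_cof : cofinal EX) (EY_cof : cofinal EY).
Variables (M : Aobj R k X) (e : X -> M) (xi : X -> Phi M).
Hypothesis fr : frame setT e xi.
Variables (F1 : set (Y * Y)) (G : X -> set Y) (f : X -> Y).
Hypotheses (F1_ent : ent Y F1) (G_fin : forall x, finite_set (G x)).
Hypothesis G_bd : forall x, rel_bounded F1 (G x).
Hypothesis G_mass : forall x, nrm (ind (Phi M) (~` G x) (xi x)) <= 10^-1.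
Hypothesis G_nz : forall x y, G x y -> ind (Phi M) [set y] (xi x) != 0.
Hypothesis Gf : forall x, G x (f x).
Local Notation W x := (transp (e x) (xi x)).

Let T (x : X) : [set: X] x. Proof. by []. Qed.

Lemma xi_nrm x : nrm (xi x) = 1. Proof. exact: (frame_xi1 fr). Qed.

Lemma xi_Loc x y : G x y -> Loc y (xi x).
Proof. by move=> /G_nz; apply: (frame_Loc_ind X_lf Y_lf full fr). Qed.

Lemma ph_ind_xi x : ph (ind M [set x]) (xi x) = xi x.
Proof.
have lx := frame_Loc fr (T x).
rewrite -(W_e fr (T x)) (W_app X_lf fr) ?(frame_ind fr) //; exact: aprx_ind.
Qed.

Lemma xi_orth x x' : x <> x' -> ip (xi x) (xi x') = 0.
Proof.
move=> xx'; rewrite -ph_ind_xi -(ph_ind_xi x').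
have adj := ph_adjoint (Phi := Phi) (@aprx_ind _ _ M [set x']) (@aprx_ind _ _ M [set x'])
  (@ind_adjoint _ _ M [set x']).
rewrite -[LHS]adj ipE -(ph_comp X_lf (st := fun=> 0)) ?ph0 ?ip0l //; try exact: aprx_ind.
by move=> v; rewrite ind_disj //; apply/seteqP; split=> // z [/= -> /esym].
Qed.

(** Either vector can be the base of a transport, and both sides are the norm of [t (e x)] for the
    preimage [t] of the projection to [A]. *)
Lemma range_mass x (z : Phi M) A : nrm z = 1 -> ph (rk (e x) (e x)) z = z ->
  nrm (ind (Phi M) A z) = nrm (ind (Phi M) A (xi x)).
Proof.
move=> z1 zP; have [t at_ tA] := ph_full full (@aprx_ind _ _ (Phi M) A).
have lx := frame_Loc fr (T x).
rewrite -(W_pull X_lf fr (T x) at_ tA) (W_nrm X_lf fr) //; last exact: aprx_Loc.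
rewrite -tA -[in LHS]zP -[ph (rk _ _) z]/(transp (e x) z (e x)).
by rewrite (transp_app X_lf _ lx) // (transp_nrm X_lf lx) //; exact: aprx_Loc.
Qed.

(** [W x' (e x)] is another unit vector in the range of [ph (rk (e x) (e x))]. Hence the position in
    [Y] of the image of [e x] does not depend on the base point of the transport. *)
Lemma transfer_mass x x' A : comp x' x ->
  nrm (ind (Phi M) A (W x' (e x))) = nrm (ind (Phi M) A (xi x)).
Proof.
move=> xx'; have lx := frame_Loc fr (T x).
have lx' : Loc x' (e x) by apply: Loc_comp lx; exact: comp_sym.
apply: range_mass; first by rewrite (W_nrm X_lf fr) // (frame_e1 fr).
rewrite (W_app X_lf fr) // ?rk_unit ?(frame_e1 fr) //; exact: (aprx_rk X_lf lx lx).
Qed.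

Lemma f_comp E x x' : ent X E -> E (x, x') -> comp (f x') (f x).
Proof.
move=> eE Exx'; have xx' := comp_ent eE Exx'.
have lx' : Loc x' (e x).
  by apply: Loc_comp (frame_Loc fr (T x)); exact: comp_sym.
have lv : Loc (f x') (W x' (e x)).
  by apply: (transp_Loc X_lf Y_lf (frame_Loc fr (T x'))) => //; exact: xi_Loc.
apply: contrapT => nc; have := G_nz (Gf x).
by rewrite -nrm_eq0 -(transfer_mass _ xx') (ind_notin nc lv) nrm0 eqxx.
Qed.

Lemma G_mass_ge x : 9 / 10 <= nrm (ind (Phi M) (G x) (xi x)).
Proof.
have := nrmD (ind (Phi M) (G x) (xi x)) (ind (Phi M) (~` G x) (xi x)).
by rewrite ind_setC xi_nrm; have := G_mass x; lra.
Qed.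

(** An isometry of propagation [E] taking each [e x'] to [e x] sends [xi x'], which sits near
    [f x'], to [W x' (e x)], which sits near [f x] by [transfer_mass]. *)
Lemma f_coarse E : ent X E -> exists2 F, ent Y F &
  forall x x', E (x, x') -> F (f x, f x').
Proof.
move=> eE; pose good (i : X * X) F := E i -> F (f i.1, f i.2).
pose A (i : X * X) := [set i.1] `|` [set i.2].
have [||||] := @disjoint_selection Y EY (X * X) X good A EY_cof.
- by move=> i; rewrite finite_setU; split; exact: finite_set1.
- by move=> i F F' FF' g Ei; apply: FF'; exact: g.
(* [K'] contains both ends of every pair of [E] that has one end in [K]. *)
- move=> K fK; pose K' := K `|` (thicken E K `|` thicken (E^-1)%relation K).
  have fK' : finite_set K'.
    rewrite !finite_setU; split=> //; split; apply: finite_thicken_set => //.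
    exact: ent_inv.
  exists [set p | exists2 i, ((K' `*` K') `&` E) i & [set (f i.1, f i.2)] p].
    apply: ent_bigU_finite; first by apply: finite_setIl; exact: finite_setX.
    by move=> [x x'] [_ Exx']; exact: f_comp Exx'.
  move=> [x x'] [z [Az Kz]] Ei; exists (x, x') => //; split=> //.
  case: Az => /= zE; rewrite zE in Kz; split=> /=.
  + by left.
  + by right; right; exists x.
  + by right; left; exists x'.
  + by left.
- by move=> [F eF hF]; exists F => // x x'; exact: (hF (x, x')).
move=> [i [dA ng]]; exfalso.
have Ei n : E (i n) by apply: contrapT => nE; apply: (ng n).
have ngn n : ~ EY n (f (i n).1, f (i n).2) by move=> h; apply: (ng n).
have dAi m n : m <> n -> A (i m) `&` A (i n) = set0 by exact: dA.
have eAi1 n : ind M (A (i n)) (e (i n).1) = e (i n).1.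
  by rewrite -[in LHS](frame_ind fr (T (i n).1)) ind_subr ?(frame_ind fr) // => z ->; left.
have eAi2 n : ind M (A (i n)) (e (i n).2) = e (i n).2.
  by rewrite -[in LHS](frame_ind fr (T (i n).2)) ind_subr ?(frame_ind fr) // => z ->; right.
have oa : orthon (fun n => e (i n).1).
  by apply: orthon_disjoint dAi _ eAi1 => n; exact: (frame_e1 fr).
have ob : orthon (fun n => e (i n).2).
  by apply: orthon_disjoint dAi _ eAi2 => n; exact: (frame_e1 fr).
have [|s [s' [as_ as' adj sss sba]]] := controlled_isometry X_lf eE ob oa.
  move=> n; exists [set (i n).1], [set (i n).2]; rewrite !(frame_ind fr) //.
  by split=> // -[z z'] [/= -> ->]; have := Ei n; case: (i n).
have comp_i n : comp (i n).2 (i n).1.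
  by apply: (comp_ent eE); have := Ei n; case: (i n).
apply: (@quasilocal_contradiction _ _ Y_lf _ _ (ph s) (fun n => xi (i n).2)
  (fun n => G (i n).1) (fun n => G (i n).2) (9 / 10)).
- exact: ph_aprx.
- exact: ph_contr adj sss.
- by rewrite divr_gt0.
- by move=> n; rewrite xi_nrm.
- by move=> n; apply: le_trans (G_mass _) _; lra.
- move=> n; rewrite -(W_e fr (T (i n).2)) (W_app X_lf fr) ?sba //; last first.
    exact: frame_Loc fr _ _.
  by rewrite transfer_mass //; exact: G_mass_ge.
- move=> F eF; have [_ _ cof] := EY_cof.
  have [n Fn] := cof _ (ent_comp F1_ent (ent_comp eF F1_ent)).
  exists n => y y' Gy Gy' Fyy'; apply: (ngn n); apply: Fn.
  exists y; first by apply: (G_bd (x := (i n).1)); split.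
  by exists y' => //; apply: (G_bd (x := (i n).2)); split.
Qed.

(** [ph (ind M [set x])] is self-adjoint and fixes [xi x], so only the part of [t (e x')] at [x]
    contributes, and [W x'] is isometric on it. *)
Lemma coefficient_bound (t : M -> M) x x' : aprx t ->
  nrm (ip (ph t (xi x')) (xi x)) <= nrm (ind M [set x] (t (e x'))).
Proof.
move=> at_; have lx' := frame_Loc fr (T x').
have lt' : Loc x' (t (e x')) by exact: aprx_Loc.
have li : Loc x' (ind M [set x] (t (e x'))).
  by apply: aprx_Loc lt' => //; exact: aprx_ind.
rewrite -(W_nrm X_lf fr (T x') li) -(W_app X_lf fr) //; last exact: aprx_ind.
rewrite -(W_app X_lf fr) // (W_e fr) // -[in leLHS](ph_ind_xi x).
have adj := ph_adjoint (Phi := Phi) (@aprx_ind _ _ M [set x]) (@aprx_ind _ _ M [set x])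
  (@ind_adjoint _ _ M [set x]).
rewrite -[ip _ _]adj ipE; apply: le_trans (cauchy_schwarz _ _) _.
by rewrite xi_nrm mulr1.
Qed.

(** Fullness pulls [S] back to an approximable operator over [X], whose blocks far off the diagonal
    are at most 1/4. *)
Lemma coefficient_contradiction (S : Phi M -> Phi M) (x x' : nat -> X) :
  aprx S -> (forall n, 2^-1 <= nrm (ip (S (xi (x' n))) (xi (x n)))) ->
  (forall n, ~ EX n (x n, x' n)) -> False.
Proof.
move=> aS hS nE; have [t at_ tS] := ph_full full aS.
have q0 : 0 < (4^-1 : R) by rewrite invr_gt0.
have [F eF hF] := aprx_quasilocal X_lf at_ q0.
have [_ _ cof] := EX_cof; have [n Fn] := cof _ eF.
have := hF [set x n] [set x' n] _ (e (x' n)).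
rewrite (frame_ind fr) // (frame_e1 fr) // => /(_ _) h.
have {}h := h (fun y y' hy hy' Fy => nE n (Fn _ (eq_ind_r (fun u => F (u, x' n))
   (eq_ind_r (fun u => F (y, u)) Fy (esym hy')) (esym hy)))).
have := coefficient_bound (x n) (x' n) at_; rewrite tS; have := hS n; lra.
Qed.

(** Infinitely many such [x] would contain a sequence with consecutive terms ever farther apart,
    while all [xi (z n)] have most of their mass near [y]. The shift of these orthonormal vectors,
    compressed to the bounded set [L], is controlled, yet its preimage has large blocks far off the
    diagonal. A dimension count would not do: the part of [Phi M] over [L] may be infinite
    dimensional. *)
Lemma preimage_finite y : finite_set [set x | G x y].
Proof.
set Z := [set x | G x y]; apply: contrapT => iZ.
have nonempty K : finite_set K -> exists2 z, Z z & ~ K z.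
  move=> fK; apply: contrapT => h; apply: iZ; apply: sub_finite_set fK => z Zz.
  by apply: contrapT => nK; apply: h; exists z.
have [eX _ _] := EX_cof.
have /boolp.choice[h hh] (q : nat * (X * set X)) : exists z, finite_set q.2.2 ->
    [/\ Z z, ~ q.2.2 z & ~ EX q.1 (z, q.2.1)].
  have [fK|nfK] := pselect (finite_set q.2.2); last by exists q.2.1.
  have [|z Zz nz] := nonempty (q.2.2 `|` thicken (EX q.1) [set q.2.1]).
    by rewrite finite_setU; split=> //; exact: finite_thicken.
  exists z => _; split=> // hz; apply: nz; [by left|right; by exists q.2.1].
have [z0 Zz0 _] := nonempty set0 (finite_set0 _).
pose S := fix S n : X * set X := if n is m.+1 then
  (h (m, ((S m).1, (S m).2 `|` [set (S m).1])), (S m).2 `|` [set (S m).1])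
  else (z0, set0).
have fS n : finite_set (S n).2.
  by elim: n => [|n IH] //=; rewrite finite_setU; split.
have hS n : [/\ Z (S n.+1).1, ~ (S n.+1).2 (S n.+1).1 & ~ EX n ((S n.+1).1, (S n).1)].
  by have [] := hh (n, ((S n).1, (S n).2 `|` [set (S n).1])) (fS n.+1).
pose z n := (S n).1.
have Zz n : Z (z n) by case: n => [//|n]; have [] := hS n.
have Kz m n : (m < n)%N -> (S n).2 (z m).
  elim: n => // n IH; rewrite ltnS leq_eqVlt => /orP[/eqP ->|/IH ?]; first by right.
  by left.
have inj m n : (m < n)%N -> z m <> z n.
  case: n => // n mn zmn; have [_ nz _] := hS n; apply: nz.
  by rewrite -/(z n.+1) -zmn; exact: Kz.
have oz : orthon (fun n => xi (z n)).
  move=> m n; have [->|mn] := eqVneq m n; first by rewrite ipxx xi_nrm expr1n.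
  rewrite xi_orth //; case: (ltngtP m n) mn => // [mn _|nm _]; first exact: inj.
  by move=> /esym; exact: inj.
have oz' : orthon (fun n => xi (z n.+1)) by move=> m n; rewrite oz.
have [s [s' [[bs _] adj sss sba _]]] := partial_isometry oz oz'.
have sc := partial_isometry_contr adj sss.
pose L := [set y' | F1 (y', y)].
have eL : ent Y (L `*` L).
  apply: ent_sub (ent_comp F1_ent (ent_inv F1_ent)) => -[a b] [/= La Lb].
  by exists y.
have GL n : G (z n) `<=` L by move=> y' Gy'; apply: (G_bd (x := z n)); split=> //; exact: Zz.
have tl n : nrm (ind (Phi M) (~` L) (xi (z n))) <= 10^-1.
  apply: le_trans (G_mass (z n)); apply: ind_le => y' nL Gy'; apply: nL; exact: GL Gy'.
pose S' v := ind (Phi M) L (s (ind (Phi M) L v)).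
have bL := @bop_ind _ _ (Phi M) L.
have aS' : aprx S'.
  apply: aprx_ctrl (bop_comp bL (bop_comp bs bL)) eL _ => a b v nab.
  have [La|nLa] := pselect (L a); last by rewrite /S' ind_disj //;
    apply/seteqP; split=> // u [/= ->].
  rewrite /= (@ind_disj _ _ (Phi M) L [set b]); last first.
    by apply/seteqP; split=> // u [/= Lu ub]; apply: nab; rewrite -ub.
  by rewrite (bop0 bs) (bop0 bL) (bop0 (bop_ind _ _)).
apply: (@coefficient_contradiction S' (fun n => z n.+1) z aS') => [n|n]; last first.
  by have [] := hS n.
rewrite /S' ip_ind.
pose r n := ind (Phi M) (~` L) (xi (z n)).
have xr m : ind (Phi M) L (xi (z m)) = xi (z m) - r m by rewrite -[in RHS](ind_setC L (xi (z m))) addrK.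
have [sz _] := sba n.
have nL : nrm (s (ind (Phi M) L (xi (z n)))) <= 1.
  by apply: le_trans (sc _) _; apply: le_trans (nrm_ind _ _) _; rewrite xi_nrm.
(* The coefficient is 1 up to two tail errors of at most 1/10 each. *)
rewrite [in X in ip _ X]xr ipBr {1}xr (bopB bs) sz ipBl ipxx xi_nrm expr1n.
set a := ip (s (r n)) _; set b := ip _ (r n.+1).
have ha : nrm a <= 10^-1.
  apply: le_trans (cauchy_schwarz _ _) _; rewrite xi_nrm mulr1.
  exact: le_trans (sc _) (tl n).
have hb : nrm b <= 10^-1.
  apply: le_trans (cauchy_schwarz _ _) _; rewrite -[leRHS]mul1r.
  by apply: ler_pM; rewrite ?nrm_ge0 //; exact: tl.
have := nrmD (1 - a - b) (a + b); have := nrmD a b.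
have -> : 1 - a - b + (a + b) = 1 by ring.
rewrite nrm1 /=.
have : (10^-1 : R) * 10 = 1 by rewrite mulVf.
have -> : nrm (1%:C%C - a - b) = nrm (1 - a - b) by rewrite rmorph1.
lra.
Qed.

(** The footprints now lie in [Y], and [preimage_finite] leaves only finitely many [x] over a finite
    set. The vectors [g x] are cut off to [G x]: disjoint footprints make them orthonormal, and [F]
    bounds the propagation up to [F1] on both sides. *)
Lemma f_expanding F : ent Y F -> exists2 E, ent X E &
  forall x x', F (f x, f x') -> E (x, x').
Proof.
move=> eF; pose good (i : X * X) E := F (f i.1, f i.2) -> E i.
pose A (i : X * X) := G i.1 `|` G i.2.
have ZK K : finite_set K -> finite_set [set x | G x `&` K !=set0].
  move=> fK; have : finite_set (\bigcup_(y in K) [set x | G x y]).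
    by apply: bigcup_finite => // y _; exact: preimage_finite.
  by apply: sub_finite_set => x [y [Gy Ky]]; exists y.
(* The rank one operator taking [xi x'] to [xi x] is approximable over [Y]; its preimage has a
   nonzero block at [(x, x')], so the two points share a component. *)
have single x x' : F (f x, f x') -> ent X [set (x, x')].
  move=> Fx; have cf := comp_ent eF Fx.
  have l1 : Loc (f x') (xi x).
    by apply: Loc_comp (comp_sym cf) (xi_Loc (Gf x)).
  have [t at_ tS] := ph_full full (aprx_rk Y_lf l1 (xi_Loc (Gf x'))).
  have := coefficient_bound x x' at_; rewrite tS /rk ipxx xi_nrm expr1n scale1r.
  rewrite ipxx xi_nrm expr1n nrm_real normr1 => h.
  apply: contrapT => nc.
  have lt' : Loc x' (t (e x')) by apply: aprx_Loc => //; exact: frame_Loc fr _ _.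
  by move: h; rewrite (ind_notin nc lt') nrm0 ler10.
have [||||] := @disjoint_selection X EX (X * X) Y good A EX_cof.
- by move=> i; rewrite finite_setU.
- by move=> i E E' EE' g Fi; apply: EE'; exact: g.
- move=> K fK; pose Z := [set x | G x `&` K !=set0].
  pose K2 := thicken F (f @` Z) `|` thicken (F^-1)%relation (f @` Z).
  pose Z2 := Z `|` [set x | G x `&` K2 !=set0].
  have fZ2 : finite_set Z2.
    rewrite finite_setU; split; first exact: ZK.
    have fZ : finite_set (f @` Z) by apply: finite_image; exact: ZK.
    apply: ZK; rewrite finite_setU; split; apply: finite_thicken_set => //.
    exact: ent_inv.
  exists [set p | exists2 i, ((Z2 `*` Z2) `&` [set i | F (f i.1, f i.2)]) i & [set i] p].
    apply: ent_bigU_finite; first by apply: finite_setIl; exact: finite_setX.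
    by move=> [x x'] [_ Fxx']; exact: single Fxx'.
  move=> [x x'] [y [Ay Ky]] Fi; exists (x, x') => //; split=> //.
  case: Ay => /= Gy; split=> /=.
  + by left; exists y.
  + right; exists (f x'); split=> //; right; exists (f x) => //.
    by exists x => //; exists y.
  + right; exists (f x); split=> //; left; exists (f x') => //.
    by exists x' => //; exists y.
  + by left; exists y.
- by move=> [E eE hE]; exists E => // x x'; exact: (hE (x, x')).
move=> [i [dA ng]]; exfalso.
have Fi n : F (f (i n).1, f (i n).2) by apply: contrapT => nF; apply: (ng n).
have ngn n : ~ EX n ((i n).1, (i n).2).
  by move=> h; apply: (ng n) => _; move: h; case: (i n).
pose h x := ind (Phi M) (G x) (xi x).
pose g x := ((nrm (h x))^-1)%:C%C *: h x.
have h0 x : 0 < nrm (h x) by have := G_mass_ge x; rewrite -/(h x); lra.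
have g1 x : nrm (g x) = 1 by apply: normalize; rewrite -nrm_gt0.
have gG x : ind (Phi M) (G x) (g x) = g x.
  by rewrite (bopZ (bop_ind _ _)) /h ind_idem.
have oa : orthon (fun n => g (i n).1).
  apply: orthon_disjoint dA _ _ => n //.
  by rewrite -{1}gG ind_subr ?gG //; exact: subsetUl.
have ob : orthon (fun n => g (i n).2).
  apply: orthon_disjoint dA _ _ => n //.
  by rewrite -{1}gG ind_subr ?gG //; exact: subsetUr.
have [|s [s' [as_ as' adj sss sba]]] :=
    controlled_isometry Y_lf (ent_comp F1_ent (ent_comp eF F1_ent)) ob oa.
  move=> n; exists (G (i n).1), (G (i n).2); split=> // -[y y'] [/= Gy Gy'].
  exists (f (i n).1); first by apply: (G_bd (x := (i n).1)); split.
  exists (f (i n).2); first exact: Fi.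
  by apply: (G_bd (x := (i n).2)); split.
have sc := partial_isometry_contr adj sss.
apply: (@coefficient_contradiction s _ _ as_ _ ngn) => n.
set x := (i n).1; set x' := (i n).2.
have xE : xi x' = (nrm (h x'))%:C%C *: g x' + ind (Phi M) (~` G x') (xi x').
  rewrite /g scalerA -rmorphM /= mulfV ?gt_eqF // rmorph1 scale1r.
  by rewrite ind_setC.
rewrite [in s _]xE (bopD (aprx_bop as_)) (bopZ (aprx_bop as_)) sba -/x ipDl ipZl.
have -> : ip (g x) (xi x) = (nrm (h x))%:C%C.
  rewrite -{1}gG ip_ind /g ipZl -/(h x) ipxx -rmorphM /= expr2 mulrA.
  by rewrite mulVf ?gt_eqF // mul1r.
set b := ip (s _) _; rewrite -rmorphM /=.
have hb : nrm b <= 10^-1.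
  apply: le_trans (cauchy_schwarz _ _) _; rewrite xi_nrm mulr1.
  exact: le_trans (sc _) (G_mass x').
have := nrm_sub ((nrm (h x') * nrm (h x))%:C%C : R[i]) (((nrm (h x') * nrm (h x))%:C%C : R[i]) + b).
rewrite opprD addNKr nrmN nrm_real ger0_norm ?mulr_ge0 ?nrm_ge0 //.
have := G_mass_ge x; have := G_mass_ge x'; rewrite -/(h x) -/(h x') => a1 a2.
(* The main term is a product of two masses of at least 9/10 and the error [b] is at most 1/10,
   which leaves more than 1/2. *)
have : 81 / 100 <= nrm (h x') * nrm (h x).
  rewrite (_ : 81 / 100 = 9 / 10 * (9 / 10)); last by lra.
  by apply: ler_pM => //; lra.
have : (10^-1 : R) * 10 = 1 by rewrite mulVf.
lra.
Qed.

End Embedding.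

(** * Fibres of infinite dimension *)

Section OneFibre.
Context {R : realType} {k : rank_bound} {X Y : coarseSpace}.
Variable Phi : star_functor R k X Y.
Hypotheses (X_lf : locally_finite X) (Y_lf : locally_finite Y).
Variable EY : nat -> set (Y * Y).
Hypothesis EY_cof : cofinal EY.
Variables (M : Aobj R k X) (e : X -> M) (xi : X -> Phi M).
Hypothesis fr : frame setT e xi.
Local Notation W x := (transp (e x) (xi x)).
Variables (C : Aobj R k X) (x : X) (y0 : Y) (A : set X) (d : R).
Hypotheses (A_comp : A `<=` comp x) (A_ent : ent X (A `*` A)).
Hypotheses (xi_y0 : Loc y0 (xi x)) (d0 : 0 < d).

Let L n := thicken (EY n) [set y0].
Let T : [set: X] x. Proof. by []. Qed.

Let in_Loc (v : C) : ind C A v = v -> Loc x v.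
Proof. exact: Loc_bounded. Qed.

Let tail (v : C) (c : R) : ind C A v = v -> 0 < c ->
  exists n, nrm (ind (Phi C) (~` L n) (W x v)) <= c.
Proof.
move=> /in_Loc lv c0.
have lw : Loc y0 (W x v) by apply: (transp_Loc X_lf Y_lf (frame_Loc fr T)).
have [F eF hF] := Loc_ent Y_lf lw c0; have [_ _ cof] := EY_cof.
by have [n Fn] := cof _ eF; exists n; apply: le_trans (ind_thickenC _ _ Fn) hF.
Qed.

Let L_le m n : (m <= n)%N -> forall v : Phi C,
  nrm (ind (Phi C) (~` L n) v) <= nrm (ind (Phi C) (~` L m) v).
Proof. by have [_ le _] := EY_cof; move=> /le mn v; exact: ind_thickenC. Qed.

Definition onb (ws : seq C) : Prop :=
  uniq ws /\ forall u, u \in ws -> ind C A u = u /\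
    forall u', u' \in ws -> ip u' u = (u' == u)%:R.

Hypothesis escape : forall F, ent Y F -> exists v : C, [/\ ind C A v = v,
  nrm v <= 1 & d < nrm (ind (Phi C) (~` thicken F [set y0]) (W x v))].

(* Gram-Schmidt: the escaping vectors may be taken orthogonal to the previous *)
(* ones, whose images do not escape. *)
Lemma escape_orthogonal (ws : seq C) m0 : onb ws -> exists w : C,
  [/\ ind C A w = w, nrm w = 1, forall u, u \in ws -> ip w u = 0 &
      d / 2 < nrm (ind (Phi C) (~` L m0) (W x w))].
Proof.
move=> [uws hws].
(* Outside [L m], the images of the earlier vectors add up to at most [d / 2], so half of the
   escaping mass survives the orthogonalisation. *)
pose c := d / 2 / ((size ws)%:R + 1).
have s1 : 0 < (size ws)%:R + 1 :> R by rewrite ltr_wpDl.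
have c0 : 0 < c by rewrite !divr_gt0.
have [m m0m hm] : exists2 m, (m0 <= m)%N &
    forall u, u \in ws -> nrm (ind (Phi C) (~` L m) (W x u)) <= c.
  have : forall u, u \in ws -> ind C A u = u by move=> u /hws[].
  elim: (ws) => [|u s IH] hs; first by exists m0.
  have [|m mm0 hm] := IH; first by move=> u' us; apply: hs; rewrite inE us orbT.
  have [n hn] := tail (hs u (mem_head _ _)) c0.
  exists (maxn m n) => [|u']; first by rewrite leq_max mm0.
  rewrite inE => /orP[/eqP ->|/hm].
    by apply: le_trans hn; apply: L_le; exact: leq_maxr.
  by apply: le_trans; apply: L_le; exact: leq_maxl.
have [eY _ _] := EY_cof.
have [v [Av v1 hv]] := escape (eY m).
pose p := \sum_(u <- ws) ip v u *: u.
have bA := @bop_ind _ _ C A.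
have Ap : ind C A p = p.
  rewrite /p (bop_sum bA) !big_seq; apply: eq_bigr => u uw.
  by rewrite (bopZ bA); have [-> _] := hws _ uw.
have ipp u : u \in ws -> ip p u = ip v u.
  move=> uw; rewrite ip_suml (bigD1_seq u) //= ipZl.
  have [_ h] := hws _ uw; rewrite (h u uw) eqxx mulr1 big_seq_cond big1 ?addr0 //.
  by move=> u' /andP[uw' uu']; rewrite ipZl h // (negbTE uu') mulr0.
pose w0 := v - p.
have w0_orth u : u \in ws -> ip w0 u = 0 by move=> uw; rewrite ipBl ipp // subrr.
have w0p : ip w0 p = 0.
  rewrite ipC ip_suml big_seq big1 ?rmorph0 // => u uw.
  by rewrite ipZl [ip u _]ipC w0_orth // rmorph0 mulr0.
have w01 : nrm w0 <= 1.
  rewrite -(@ler_pXn2r _ 2) ?nnegrE ?nrm_ge0 // expr1n.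
  apply: (@le_trans _ _ (nrm v ^+ 2)); last by rewrite expr_le1 ?nrm_ge0.
  have vE : v = w0 + p by rewrite subrK.
  by rewrite [in leRHS]vE (nrm_pyth w0p) lerDl sqr_ge0.
have Aw0 : ind C A w0 = w0 by rewrite (bopB bA) Av Ap.
have hw0 : d / 2 < nrm (ind (Phi C) (~` L m) (W x w0)).
  rewrite (W_sub X_lf fr T) //; [|exact: in_Loc|exact: in_Loc].
  rewrite (bopB (bop_ind _ _)).
  have hp : nrm (ind (Phi C) (~` L m) (W x p)) <= d / 2.
    have lws u : u \in ws -> Loc x u by move=> /hws[/in_Loc].
    rewrite (W_sum X_lf fr _ T lws) (bop_sum (bop_ind _ _)).
    have : nrm (\sum_(u <- ws) ind (Phi C) (~` L m) (ip v u *: W x u)) <=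
        \sum_(u <- ws) c.
      have hs : {subset ws <= ws} by [].
      elim: {1 3 4}(ws) hs => [|u s IH] hs; first by rewrite !big_nil nrm0.
      rewrite !big_cons; apply: le_trans (nrmD _ _) (lerD _ _); last first.
        by apply: IH => u' us; apply: hs; rewrite inE us orbT.
      have uw : u \in ws by apply: hs; rewrite mem_head.
      rewrite (bopZ (bop_ind _ _)) nrmZ -[leRHS]mul1r.
      apply: ler_pM; rewrite ?nrm_ge0 //; last exact: hm.
      apply: le_trans (cauchy_schwarz _ _) _.
      have [_ /(_ _ uw)] := hws _ uw; rewrite ipxx eqxx => u1.
      have -> : nrm u = 1.
        apply/eqP; rewrite -(@eqrXn2 _ 2) ?nrm_ge0 // expr1n; apply/eqP.
        by apply/(@complexI R); rewrite u1 rmorph1.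
      by rewrite mulr1.
    move=> /le_trans; apply; rewrite big_const_seq count_predT iter_addr_0.
    have d20 : 0 <= d / 2 by rewrite ltW // divr_gt0.
    have := mul_div_le (ler0n R (size ws)) d20 ler01.
    by rewrite !mulr1 mulr_natl.
  have := nrm_sub (ind (Phi C) (~` L m) (W x v)) (ind (Phi C) (~` L m) (W x p)).
  move: hv; rewrite -/(L m); lra.
have w00 : 0 < nrm w0.
  rewrite -(W_nrm X_lf fr T (in_Loc Aw0)); apply: lt_le_trans (nrm_ind (~` L m) _).
  by apply: lt_trans hw0; rewrite divr_gt0.
exists (((nrm w0)^-1)%:C%C *: w0); split.
- by rewrite (bopZ bA) Aw0.
- by apply: normalize; rewrite -nrm_gt0.
- by move=> u uw; rewrite ipZl w0_orth // mulr0.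
- apply: lt_le_trans hw0 _; rewrite (W_scale X_lf fr _ T (in_Loc Aw0)).
  rewrite (bopZ (bop_ind _ _)) nrmZ nrm_real ger0_norm ?invr_ge0 ?nrm_ge0 //.
  rewrite mulrC ler_pdivlMr //; apply: le_trans (L_le m0m _).
  by rewrite -[leRHS]mulr1 ler_wpM2l ?nrm_ge0.
Qed.

(** The shift of the orthonormal [w n] acts inside the bounded set [A], hence is controlled, but its
    image moves vectors living on [L (N (w n))] to vectors with mass ever farther out. *)
Lemma escape_False : False.
Proof.
have d16 : 0 < d / 16 by rewrite divr_gt0.
have /boolp.choice[N hN] (v : C) : exists n, ind C A v = v ->
    nrm (ind (Phi C) (~` L n) (W x v)) <= d / 16.
  have [Av|nA] := pselect (ind C A v = v); last by exists 0%N.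
  by have [n hn] := tail Av d16; exists n.
have [eY _ cof] := EY_cof.
have /boolp.choice[m hm] (q : nat * C) : exists m,
    crel (EY q.1) (EY (N q.2)) `<=` EY m.
  by apply: cof; exact: ent_comp.
(* The head of the list is the latest vector: stage [n.+1] escapes relative to [w n] and [EY n.+1].
   At stage 0 the default head is 0. *)
have /boolp.choice[h hh] (q : nat * seq C) : exists w : C, onb q.2 ->
  [/\ ind C A w = w, nrm w = 1, forall u, u \in q.2 -> ip w u = 0 &
      d / 2 < nrm (ind (Phi C) (~` L (m (q.1, head 0 q.2))) (W x w))].
  have [ows|nq] := pselect (onb q.2); last by exists 0.
  by have [w hw] := escape_orthogonal (m (q.1, head 0 q.2)) ows; exists w.
pose S := fix S n := if n is j.+1 then h (j, S j) :: S j else [::].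
have oS n : onb (S n).
  elim: n => [|n IH] /=; first by split.
  have [Aw w1 ow _] := hh (n, S n) IH; set w := h _ in Aw w1 ow *.
  have wS : w \notin S n.
    apply/negP => /ow; rewrite ipxx w1 expr1n => /eqP; rewrite rmorph1 oner_eq0 //.
  have [uS hS] := IH; split=> [|u]; first by rewrite /= wS.
  rewrite inE => /orP[/eqP ->|us]; split=> //.
  - move=> u'; rewrite inE => /orP[/eqP ->|us']; first by rewrite ipxx w1 expr1n eqxx.
    rewrite ipC ow // rmorph0; case: eqP => // uw.
    by rewrite -uw us' in wS.
  - by have [] := hS _ us.
  - move=> u'; rewrite inE => /orP[/eqP ->|us']; last by have [_] := hS _ us; exact.
    by rewrite ow //; case: eqP => // uw; rewrite uw us in wS.
pose w n := h (n, S n).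
have hw n := hh (n, S n) (oS n).
have wS a b : (a < b)%N -> w a \in S b.
  elim: b => // b IH; rewrite ltnS leq_eqVlt => /orP[/eqP ->|/IH wab].
    by rewrite /= mem_head.
  by rewrite /= inE wab orbT.
have ow : orthon w.
  have W1 a b : (a < b)%N -> ip (w b) (w a) = 0.
    by move=> ab; have [_ _ o _] := hw b; apply: o; exact: wS.
  move=> a b; case: (ltngtP a b) => [ab|ba|->].
  - by rewrite ipC W1 // rmorph0.
  - exact: W1.
  - by have [_ w1 _ _] := hw b; rewrite ipxx w1 expr1n.
have ow' : orthon (fun n => w n.+1) by move=> a b; rewrite ow.
have Aw n : ind C A (w n) = w n by have [] := hw n.
have [|s [s' [as_ as' adj sss sba]]] := controlled_isometry X_lf A_ent ow ow'.
  by move=> n; exists A, A; split; [exact: Aw|exact: Aw|].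
apply: (@quasilocal_contradiction _ _ Y_lf _ _ (ph s) (fun n => W x (w n))
  (fun n => ~` L (m (n.+1, w n))) (fun n => L (N (w n))) (d / 2)).
- exact: ph_aprx.
- exact: ph_contr adj sss.
- by rewrite divr_gt0.
- move=> n; rewrite (W_nrm X_lf fr T (in_Loc (Aw n))).
  by have [_ -> _ _] := hw n.
- by move=> n; apply: le_trans (hN _ (Aw n)) _; lra.
- move=> n; rewrite (W_app X_lf fr T as_ (in_Loc (Aw n))) sba.
  by have [_ _ _ /ltW] := hw n.+1.
- move=> F eF; have [n Fn] := cof _ eF; exists n => y y' nL [_ -> Ly'] Fyy'.
  apply: nL; exists y0 => //; apply: (hm (n.+1, w n)); exists y' => //=.
  have [_ le _] := EY_cof; exact: le (leqnSn n) _ (Fn _ Fyy').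
Qed.

End OneFibre.

(** In finite dimension a basis would give this uniformity over the unit ball; [escape_False] gives
    it in every dimension. *)
Lemma fibre_concentration (R : realType) (k : rank_bound) (X Y : coarseSpace)
    (Phi : star_functor R k X Y) (EY : nat -> set (Y * Y))
    (M C : Aobj R k X) (e : X -> M) (xi : X -> Phi M) x y0 (A : set X) (d : R) :
  locally_finite X -> locally_finite Y -> cofinal EY -> frame setT e xi ->
  A `<=` comp x -> ent X (A `*` A) -> Loc y0 (xi x) -> 0 < d ->
  exists2 F, ent Y F & forall v : C, ind C A v = v -> nrm v <= 1 ->
    nrm (ind (Phi C) (~` thicken F [set y0]) (transp (e x) (xi x) v)) <= d.
Proof.
move=> X_lf Y_lf EY_cof fr Ax eA ly d0; apply: contrapT => hno.
apply: (escape_False X_lf Y_lf EY_cof fr (C := C) Ax eA ly d0) => F eF.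
apply: contrapT => h; apply: hno; exists F => // v Av v1.
by rewrite leNgt; apply/negP => lt; apply: h; exists v.
Qed.

(** * Comparison of the approximate relation with the graph *)

Section Relation.
Context {R : realType} {k : rank_bound} {X Y : coarseSpace}.
Variable Phi : star_functor R k X Y.
Hypotheses (X_lf : locally_finite X) (Y_lf : locally_finite Y).
Hypotheses (full : full_functor Phi).
Variables (EX : nat -> set (X * X)) (EY : nat -> set (Y * Y)).
Hypotheses (EX_cof : cofinal EX) (EY_cof : cofinal EY).
Variables (M : Aobj R k X) (e : X -> M) (xi : X -> Phi M).
Hypothesis fr : frame setT e xi.
Variables (F1 : set (Y * Y)) (G : X -> set Y) (f : X -> Y).
Hypotheses (F1_ent : ent Y F1).
Hypothesis G_bd : forall x, rel_bounded F1 (G x).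
Hypothesis G_mass : forall x, nrm (ind (Phi M) (~` G x) (xi x)) <= 10^-1.
Hypothesis G_nz : forall x y, G x y -> ind (Phi M) [set y] (xi x) != 0.
Hypothesis Gf : forall x, G x (f x).
Local Notation W x := (transp (e x) (xi x)).

Variables (C : Aobj R k X) (U : C -> Phi C) (V : Phi C -> C).
Hypotheses (bU : bop U) (UV : is_adjoint U V) (VU : cancel U V).
Hypothesis implements : forall t : C -> C, aprx t -> ph t =1 U \o t \o V.

Lemma ip_U u v : ip (U u) (U v) = ip u v.
Proof. by rewrite -ipE UV VU. Qed.

Lemma nrm_U v : nrm (U v) = nrm v.
Proof.
apply/eqP; rewrite -(@eqrXn2 _ 2) ?nrm_ge0 //; apply/eqP.
by apply/(@complexI R); rewrite -!ipxx ip_U.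
Qed.

Lemma ph_rk_U x (v : C) z : Loc x v -> ph (rk v v) z = ip z (U v) *: U v.
Proof.
move=> lv; rewrite implements /=; last exact: (aprx_rk X_lf lv lv).
by rewrite /rk (bopZ bU) -[ip (V z) v]ipE (is_adjointC UV).
Qed.

(* Both [W x v] and [U v] span the range of the rank one projection           *)
(* [ph (rk v v)]. *)
Lemma nrm_ind_U x v B : Loc x v -> nrm v = 1 ->
  nrm (ind (Phi C) B (W x v)) = nrm (ind (Phi C) B (U v)).
Proof.
move=> lv v1; have Tx : [set: X] x by [].
have : W x v = ip (W x v) (U v) *: U v.
  rewrite -(ph_rk_U _ lv) (W_app X_lf fr Tx (aprx_rk X_lf lv lv) lv).
  by rewrite rk_unit.
set c := ip _ _ => cE.
have c1 : nrm c = 1.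
  have : nrm (W x v) = 1 by rewrite (W_nrm X_lf fr).
  by rewrite cE nrmZ nrm_U v1 mulr1.
by rewrite cE (bopZ (bop_ind _ _)) nrmZ c1 mul1r.
Qed.

(** An index records a point of [A], a unit vector under [A] and the two sets. Near a finite set
    [fibre_concentration] gives the uniformity; otherwise an isometry taking each [e x] to the
    recorded vector has an image moving mass from near [f x] to a distant set [B]. Since [B] is
    [F]-bounded, one point of it near [f x] is enough. *)
Lemma relation_near_graph E F (d : R) : ent X E -> ent Y F -> 0 < d -> d < 1 ->
  exists2 F', ent Y F' & forall B A x y, rel_bounded F B -> rel_bounded E A ->
    d < op_norm (ind (Phi C) B \o U \o ind C A) -> B y -> A x -> F' (y, f x).
Proof.
move=> eE eF d0 d1; have Tx x : [set: X] x by [].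
have d4 : 0 < d / 4 by rewrite divr_gt0.
(* The tail 1/10 of [G x] may exceed [d / 4], so [xi x] is localised again. The new set must meet
   [G x], which carries 9/10 of the mass. *)
have [Fd Fd_ent hFd] := concentration X_lf Y_lf full EX_cof EY_cof fr d4.
have /boolp.choice[Gd hGd] x : exists G, rel_bounded Fd G /\
    nrm (ind (Phi M) (~` G) (xi x)) <= d / 4.
  by have [H [_ ? ? _]] := hFd x (Tx x); exists H.
pose Fc := crel Fd F1.
have Gd_near x y : Gd x y -> Fc (y, f x).
  move=> Gy; have [y1 [Gdy1 Gy1]] : Gd x `&` G x !=set0.
    apply/set0P/eqP => dis.
    have h1 : nrm (ind (Phi M) (G x) (xi x)) <= d / 4.
      have [_ h] := hGd x; apply: le_trans h; apply: ind_le => z Gz Gdz.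
      by have : (Gd x `&` G x) z by []; rewrite dis.
    have := @G_mass_ge _ _ _ _ _ _ _ _ fr _ G_mass x; lra.
  exists y1; first by have [h _] := hGd x; apply: h; split.
  by apply: (G_bd (x := x)); split.
pose I := ((X * C) * (set Y * set X))%type.
pose valid (i : I) := [/\ rel_bounded F i.2.1, rel_bounded E i.2.2,
  i.2.2 i.1.1 & [/\ ind C i.2.2 i.1.2 = i.1.2, nrm i.1.2 = 1 &
  d < nrm (ind (Phi C) i.2.1 (U i.1.2))]].
pose good (i : I) (F' : set (Y * Y)) := valid i ->
  exists2 b, i.2.1 b & F' (b, f i.1.1).
(* Boundedness is built into the footprint so that it is finite for invalid indices too. *)
pose A (i : I) := [set z | i.2.2 z /\ rel_bounded E i.2.2].
have A_Loc (i : I) : valid i -> Loc i.1.1 i.1.2.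
  move=> [_ bE Ax [Av _ _]]; apply: (Loc_bounded _ Av) => z Az.
  by apply: (comp_ent eE); apply: bE; split.
suff [F' eF' hF'] : exists2 F', ent Y F' & forall i, good i F'.
  exists (crel F F'); first exact: ent_comp.
  move=> B A0 x y bF bE /lt_op_norm[v0 v01 /= hv0] By Ax.
  set u := ind C A0 v0 in hv0.
  have u1 : nrm u <= 1 by apply: le_trans (nrm_ind _ _) v01.
  have u0 : 0 < nrm u.
    rewrite -nrm_U; apply: lt_le_trans (nrm_ind B _); exact: lt_trans hv0.
  have [|b Bb F'b] := hF' ((x, ((nrm u)^-1)%:C%C *: u), (B, A0)).
    split=> //; split; [by rewrite (bopZ (bop_ind _ _)) ind_idem|
      by apply: normalize; rewrite -nrm_gt0|].
    rewrite (bopZ bU) (bopZ (bop_ind _ _)) nrmZ nrm_real.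
    rewrite ger0_norm ?invr_ge0 ?nrm_ge0 // mulrC ltr_pdivlMr //.
    apply: le_lt_trans hv0; rewrite -[leRHS]mulr1 ler_wpM2l // ltW //.
  by exists b => //; apply: bF; split.
have [||||] := @disjoint_selection Y EY I X good A EY_cof.
- move=> i; have [bE|nbE] := pselect (rel_bounded E i.2.2); last first.
    by apply: sub_finite_set (finite_set0 X) => z [].
  have fB : finite_set i.2.2 by apply: X_lf; exists E.
  by apply: sub_finite_set fB => z [].
- by move=> i F' F'' FF g /g[b Bb F'b]; exists b => //; exact: FF.
- move=> K fK; pose KX := thicken E K.
  have fKX : finite_set KX by exact: finite_thicken_set.
  have d2 : 0 < d / 2 by rewrite divr_gt0.
  have /boolp.choice[H hH] x : exists F, ent Y F /\ forall v : C,
      ind C (thicken E [set x]) v = v -> nrm v <= 1 ->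
      nrm (ind (Phi C) (~` thicken F [set f x]) (W x v)) <= d / 2.
    have Ac : thicken E [set x] `<=` comp x by move=> z [_ -> Ez]; exact: comp_ent Ez.
    have eA : ent X (thicken E [set x] `*` thicken E [set x]).
      apply: ent_sub (ent_comp eE (ent_inv eE)) => -[a b] [[_ -> Ea] [_ -> Eb]].
      by exists x.
    have lf : Loc (f x) (xi x) by exact: (xi_Loc X_lf Y_lf full fr G_nz).
    have [F' eF' hF'] := fibre_concentration C X_lf Y_lf EY_cof fr Ac eA lf d2.
    by exists F'.
  exists [set p | exists2 x, KX x & H x p].
    by apply: ent_bigU_finite => // x _; have [] := hH x.
  move=> i [z [[Az bE] Kz]] vi; have lv := A_Loc _ vi.
  move: vi => [_ _ Ax [Av v1 hv]].
  have KXx : KX i.1.1 by exists z => //; apply: bE; split.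
  apply: contrapT => nb; have [_ /(_ i.1.2)] := hH i.1.1.
  rewrite v1 lexx => h; have {}h := h _ isT.
  have := h _; rewrite -[in X in X = _]Av ind_subr ?Av; last first.
    by move=> a Aa; exists i.1.1 => //; apply: bE; split.
  move=> /(_ erefl) h'.
  have : nrm (ind (Phi C) i.2.1 (W i.1.1 i.1.2)) <= d / 2.
    apply: le_trans h'; apply: ind_le => b Bb [_ -> Hb]; apply: nb.
    by exists b => //; exists i.1.1.
  rewrite (nrm_ind_U _ lv v1); lra.
- by [].
move=> [i [dA ng]]; exfalso.
have vi n : valid (i n).
  by apply: contrapT => nv; apply: (ng n).
have nb n b : (i n).2.1 b -> ~ EY n (b, f (i n).1.1).
  by move=> Bb h; apply: (ng n) => _; exists b.
have AE n : A (i n) = (i n).2.2.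
  by have [_ bE _ _] := vi n; apply/seteqP; split=> [z []|z].
have ov : orthon (fun n => (i n).1.2).
  by apply: (orthon_disjoint dA) => n; rewrite ?AE; have [_ _ _ []] := vi n.
have oe : orthon (fun n => e (i n).1.1).
  apply: (orthon_disjoint dA) => n; first exact: (frame_e1 fr).
  rewrite AE -[in LHS](frame_ind fr (Tx (i n).1.1)) ind_subr ?(frame_ind fr) //.
  by move=> z ->; have [] := vi n.
have [|s [s' [as_ as' adj sss sba]]] := controlled_isometry X_lf eE oe ov.
  move=> n; have [_ bE Ax [Av _ _]] := vi n.
  exists (i n).2.2, [set (i n).1.1]; split=> //; first exact: (frame_ind fr).
  by move=> [a b] [/= Aa ->]; apply: bE; split.
apply: (@quasilocal_contradiction _ _ Y_lf _ _ (ph s) (fun n => xi (i n).1.1)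
  (fun n => (i n).2.1) (fun n => Gd (i n).1.1) d).
- exact: ph_aprx.
- exact: ph_contr adj sss.
- by [].
- by move=> n; rewrite (frame_xi1 fr).
- by move=> n; have [] := hGd (i n).1.1.
- move=> n; rewrite -(W_e fr (Tx (i n).1.1)).
  rewrite (W_app X_lf fr (Tx _) as_ (frame_Loc fr (Tx _))) sba.
  have [_ _ _ [_ v1 /ltW hv]] := vi n.
  by rewrite (nrm_ind_U _ (A_Loc _ (vi n)) v1).
- move=> F' eF'; have [_ _ cof] := EY_cof.
  have [n Fn] := cof _ (ent_comp eF' (ent_comp Fd_ent F1_ent)).
  exists n => b y' Bb Gy' F'b; apply: (nb n b Bb); apply: Fn.
  by exists y' => //; exact: Gd_near.
Qed.

(** The unitary itself provides a frame, [U (v x)], over the support of [C]. Concentration at level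
    [(1 - d) / 2] leaves mass at least [(1 + d) / 2], which exceeds [d]; faithfulness moves any [x]
    to a point of the support. *)
Lemma relation_large (d : R) : faithful_module C -> 0 < d -> d < 1 ->
  exists2 F0, ent Y F0 & exists2 E1, ent X E1 &
  forall x, exists x' B y, [/\ E1 (x, x'), rel_bounded F0 B, B y &
    d < op_norm (ind (Phi C) B \o U \o ind C [set x'])].
Proof.
move=> [_ [E1 eE1 hE1]] d0 d1.
pose D := [set x | exists v, ind C [set x] v != 0].
have /boolp.choice[v hv] x : exists v : C, D x -> nrm v = 1 /\ ind C [set x] v = v.
  have [[u nz]|nD] := pselect (D x); last by exists 0.
  exists (((nrm (ind C [set x] u))^-1)%:C%C *: ind C [set x] u) => _.
  by split; [exact: normalize|rewrite (bopZ (bop_ind _ _)) ind_idem].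
have lv x : D x -> Loc x (v x).
  by move=> /hv[_]; apply: Loc_bounded => _ ->; exact: compxx.
have frC : frame D v (fun x => U (v x)).
  split=> x Dx; try by have [] := hv x Dx.
    by rewrite nrm_U; have [] := hv x Dx.
  rewrite (ph_rk_U _ (lv x Dx)) ipxx nrm_U.
  by have [-> _] := hv x Dx; rewrite expr1n scale1r.
have ep0 : 0 < (1 - d) / 2 by lra.
have [F0 eF0 hF0] := concentration X_lf Y_lf full EX_cof EY_cof frC ep0.
exists F0 => //; exists E1 => // x.
have [//|x' Dx' Exx'] := hE1 x.
have [B [_ bB hB _]] := hF0 x' Dx'; have [v1 vE] := hv x' Dx'.
have h1 : d < nrm (ind (Phi C) B (U (v x'))).
  have := nrmD (ind (Phi C) B (U (v x'))) (ind (Phi C) (~` B) (U (v x'))).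
  rewrite ind_setC nrm_U v1; lra.
have h2 : d < op_norm (ind (Phi C) B \o U \o ind C [set x']).
  apply: lt_le_trans h1 _; rewrite -[in leLHS]vE.
  apply: (@op_norm_ge _ _ _ (ind (Phi C) B \o U \o ind C [set x'])).
    apply: bop_comp (bop_ind _ _); exact: bop_comp (bop_ind _ _) bU.
  by rewrite v1.
have [B0|/set0P[y By]] := eqVneq B set0; last by exists x', B, y.
by move: h1; rewrite B0 ind0 nrm0; lra.
Qed.

End Relation.

(** * The Hilbert space of square summable sequences *)

Section L2.
Variable R : realType.
Local Notation C := R[i].

Definition sqsum (f : nat -> C^o) (n : nat) : R := \sum_(0 <= k < n) nrm (f k) ^+ 2.

Definition sqsummable : {pred nat -> C^o} :=
  [pred f | `[< exists B, forall n, sqsum f n <= B >]].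

Lemma sqsum_ge0 f n : 0 <= sqsum f n.
Proof. by apply: sumr_ge0 => k _; exact: sqr_ge0. Qed.

Lemma sqsum_le f m n : (m <= n)%N -> sqsum f m <= sqsum f n.
Proof.
move=> mn; rewrite /sqsum [leRHS](big_cat_nat (n := m)) //= lerDl sumr_ge0 //.
by move=> k _; exact: sqr_ge0.
Qed.

(** A weighted bound for the square of a sum: [t = 1] gives closure under addition, and [t] the
    ratio of the two norms gives the sharp triangle inequality. *)
Lemma sqsumD t f g n : 0 < t ->
  sqsum (f + g) n <= (1 + t) * sqsum f n + (1 + t^-1) * sqsum g n.
Proof.
move=> t0; rewrite /sqsum !mulr_sumr -big_split /=; apply: ler_sum => k _.
set a := nrm (f k); set b := nrm (g k).
have h : nrm ((f + g) k) ^+ 2 <= (a + b) ^+ 2.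
  by rewrite ler_pXn2r ?nnegrE ?nrm_ge0 ?addr_ge0 ?nrm_ge0 //; exact: nrmD.
apply: le_trans h _.
have h1 : 0 <= t^-1 * (t * a - b) ^+ 2 by rewrite mulr_ge0 ?sqr_ge0 // invr_ge0 ltW.
have e : t^-1 * (t * a - b) ^+ 2 = t * a ^+ 2 - 2 * a * b + t^-1 * b ^+ 2.
  by field; rewrite gt_eqF.
rewrite e in h1; lra.
Qed.

Lemma sqsumZ (a : C) f n : sqsum (a *: f) n = nrm a ^+ 2 * sqsum f n.
Proof.
by rewrite /sqsum mulr_sumr; apply: eq_bigr => k _; rewrite -exprMn -nrmM.
Qed.

Lemma sqsummable_submod : submod_closed sqsummable.
Proof.
split=> [|a f g /asboolP[B hB] /asboolP[B' hB']]; apply/asboolP.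
  by exists 0 => n; rewrite /sqsum big1 // => k _; rewrite nrm0 expr0n.
exists (2 * (nrm a ^+ 2 * B) + 2 * B') => n.
apply: le_trans (sqsumD (a *: f) g n ltr01) _; rewrite invr1 sqsumZ.
have := hB n; have := hB' n; have := sqr_ge0 (nrm a); nra.
Qed.

HB.instance Definition _ :=
  GRing.isSubmodClosed.Build C (nat -> C^o) sqsummable sqsummable_submod.

Record l2 := L2 { l2val :> nat -> C^o; l2P : l2val \in sqsummable }.

HB.instance Definition _ := [isSub for l2val].
HB.instance Definition _ := [Choice of l2 by <:].
HB.instance Definition _ := [SubChoice_isSubLmodule of l2 by <:].

Definition l2sq (f : l2) : R := sup [set sqsum f n | n in [set: nat]].

Lemma l2_has_sup (f : l2) : has_sup [set sqsum f n | n in [set: nat]].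
Proof.
have /asboolP[B hB] := l2P f; split; first by exists (sqsum f 0), 0%N.
by exists B => _ [n _ <-].
Qed.

Lemma sqsum_l2sq (f : l2) n : sqsum f n <= l2sq f.
Proof. by apply: sup_upper_bound (l2_has_sup f) _ _; exists n. Qed.

Lemma l2sq_le (f : l2) B : (forall n, sqsum f n <= B) -> l2sq f <= B.
Proof.
move=> h; apply: sup_le_ub; first by exists (sqsum f 0), 0%N.
by move=> _ [n _ <-].
Qed.

Lemma l2sq_ge0 f : 0 <= l2sq f.
Proof. exact: le_trans (sqsum_ge0 f 0) (sqsum_l2sq f 0). Qed.

Lemma l2sq_lim (f : l2) : lim_to (fun n => (sqsum f n)%:C%C : C^o) (l2sq f)%:C%C.
Proof.
move=> e e0; have [_ [N _ <-] hN] := sup_adherent e0 (l2_has_sup f).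
exists N => n Nn; rewrite -rmorphB nrm_real distrC ger0_norm ?subr_ge0 ?sqsum_l2sq //.
by have := sqsum_le f Nn; rewrite -/(l2sq f) in hN *; lra.
Qed.

Definition psum (f g : nat -> C^o) n : C^o := \sum_(0 <= k < n) f k * Num.conj (g k).

(** Polarization: convergence of the inner product series is inherited from four series of
    squares. *)
Lemma polar (z w : C) : z * Num.conj w = 4^-1 *: ((nrm (z + w) ^+ 2)%:C%C : C^o) +
  (- 4^-1 *: ((nrm (z - w) ^+ 2)%:C%C : C^o) +
  ((4^-1 * 'i) *: ((nrm (z + 'i *: (w : C^o)) ^+ 2)%:C%C : C^o) +
   (- 4^-1 * 'i) *: ((nrm (z - 'i *: (w : C^o)) ^+ 2)%:C%C : C^o))).
Proof.
rewrite -!conj_mul_nrm !rmorphD !rmorphN rmorphM /= conjCi.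
rewrite /GRing.scale /=.
have i2 : 'i * 'i = -1 :> C by rewrite -expr2 sqrCi.
set a := Num.conj z; set b := Num.conj w; set i := 'i in i2 *.
have -> : 4^-1 * ((z + w) * (a + b)) + (- 4^-1 * ((z - w) * (a - b)) +
    (4^-1 * i * ((z + i * w) * (a + - i * b)) +
     - 4^-1 * i * ((z - i * w) * (a - - i * b)))) =
   4^-1 * (2 * (z * b + w * a) + 2 * (i * i) * (w * a - z * b)) by ring.
by rewrite i2; field.
Qed.

Lemma l2_inner_ex (f g : l2) : exists l : C^o, lim_to (psum f g) l.
Proof.
have z0 : lim_to (fun=> 0 : C^o) 0 by apply: lim_to_const; exists 0%N.
eexists; have h := lim_to_lin 4^-1 (@l2sq_lim (f + g))
  (lim_to_lin (- 4^-1) (@l2sq_lim (f - g))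
  (lim_to_lin (4^-1 * 'i) (@l2sq_lim (f + 'i *: g))
  (lim_to_lin (- 4^-1 * 'i) (@l2sq_lim (f - 'i *: g)) z0))).
move: h; congr (lim_to _ _); last first.
apply/funext => n; rewrite /psum /sqsum !rmorph_sum !scaler_sumr.
rewrite addr0 -!big_split /=; apply: eq_bigr => k _; exact: esym (polar _ _).
Qed.

Definition l2ip (f g : l2) : C := xget 0 [set l : C^o | lim_to (psum f g) l].

Lemma l2ipP (f g : l2) : lim_to (psum f g) (l2ip f g : C^o).
Proof. by rewrite /l2ip; case: xgetP => [l _ //|h]; have [l /h] := l2_inner_ex f g. Qed.

Lemma l2ip_linl a f f' g : l2ip (a *: f + f') g = a * l2ip f g + l2ip f' g.
Proof.
apply: (@lim_to_unique _ C^o) (l2ipP _ _) _.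
have := lim_to_lin a (l2ipP f g) (l2ipP f' g); congr lim_to.
apply/funext => n; rewrite /psum scaler_sumr -big_split /=.
by apply: eq_bigr => k _; rewrite mulrDl scalerAl.
Qed.

Lemma l2ip0l g : l2ip 0 g = 0.
Proof.
have := l2ip_linl (-1) 0 0 g; rewrite scaler0 addr0 => {1}->.
by rewrite mulN1r addNr.
Qed.

Lemma l2ipZl a f g : l2ip (a *: f) g = a * l2ip f g.
Proof. by have := l2ip_linl a f 0 g; rewrite addr0 l2ip0l addr0. Qed.

Lemma l2ipC f g : l2ip f g = Num.conj (l2ip g f).
Proof.
apply: (@lim_to_unique _ C^o) (l2ipP _ _) _ => e e0.
have [N hN] := l2ipP g f e0; exists N => n /hN.
have -> : psum f g n = Num.conj (psum g f n).
  rewrite /psum rmorph_sum; apply: eq_bigr => k _.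
  by rewrite rmorphM /= conjCK mulrC.
by rewrite -rmorphB nrm_conj.
Qed.

Lemma l2ipxx f : l2ip f f = (l2sq f)%:C%C.
Proof.
apply: (@lim_to_unique _ C^o) (l2ipP _ _) _.
have := l2sq_lim f; congr lim_to; apply/funext => n.
by rewrite /psum /sqsum rmorph_sum; apply: eq_bigr => k _; rewrite conj_mul_nrm.
Qed.

Lemma l2sq_eq0 f : l2sq f = 0 -> f = 0.
Proof.
move=> f0; apply/val_inj/funext => k /=; apply/eqP; rewrite -nrm_eq0 -sqrf_eq0 eq_le sqr_ge0 andbT.
rewrite -f0; apply: le_trans (sqsum_l2sq f k.+1).
by rewrite /sqsum big_nat_recr //= lerDr sumr_ge0 // => j _; exact: sqr_ge0.
Qed.

Definition l2norm (f : l2) : C := (Num.sqrt (l2sq f))%:C%C.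

Lemma l2norm_triangle f g : l2norm (f + g) <= l2norm f + l2norm g.
Proof.
rewrite /l2norm -rmorphD lecR.
have [->|f0] := eqVneq f 0; first by rewrite add0r lerDr sqrtr_ge0.
have [->|g0] := eqVneq g 0; first by rewrite addr0 lerDl sqrtr_ge0.
have pos h : h != 0 -> 0 < Num.sqrt (l2sq h).
  move=> h0; rewrite sqrtr_gt0 lt_def l2sq_ge0 andbT.
  by apply: contra h0 => /eqP/l2sq_eq0 ->.
have := pos _ f0; have := pos _ g0.
set a := Num.sqrt (l2sq f); set b := Num.sqrt (l2sq g) => b0 a0.
have aE : l2sq f = a ^+ 2 by rewrite sqr_sqrtr ?l2sq_ge0.
have bE : l2sq g = b ^+ 2 by rewrite sqr_sqrtr ?l2sq_ge0.
have ab : 0 <= a + b by rewrite addr_ge0 // ltW.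
rewrite -[leRHS](ger0_norm ab) -sqrtr_sqr ler_wsqrtr //.
apply: l2sq_le => n; have t0 : 0 < b / a by rewrite divr_gt0.
apply: le_trans (sqsumD _ _ _ t0) _.
have t1 : 0 <= 1 + b / a by rewrite addr_ge0 // ltW.
have t2 : 0 <= 1 + (b / a)^-1 by rewrite addr_ge0 // invr_ge0 ltW.
have h1 : (1 + b / a) * sqsum f n <= (1 + b / a) * a ^+ 2.
  by rewrite ler_wpM2l // -aE sqsum_l2sq.
have h2 : (1 + (b / a)^-1) * sqsum g n <= (1 + (b / a)^-1) * b ^+ 2.
  by rewrite ler_wpM2l // -bE sqsum_l2sq.
apply: le_trans (lerD h1 h2) _; rewrite le_eqVlt; apply/orP; left; apply/eqP.
by field; rewrite !gt_eqF.
Qed.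

Lemma l2normZ (a : C) f : l2norm (a *: f) = `|a| * l2norm f.
Proof.
rewrite /l2norm nrmE -rmorphM /=; congr (_%:C%C).
have -> : l2sq (a *: f) = nrm a ^+ 2 * l2sq f.
  apply: (@complexI R); rewrite -l2ipxx.
  by rewrite l2ipZl l2ipC l2ipZl rmorphM /= -l2ipC l2ipxx mulrA conj_mul_nrm -rmorphM.
by rewrite sqrtrM ?sqr_ge0 // sqrtr_sqr ger0_norm ?nrm_ge0.
Qed.

Lemma l2norm_eq0 f : l2norm f = 0 -> f = 0.
Proof.
move=> /(@complexI R) /eqP; rewrite sqrtr_eq0 => h; apply: l2sq_eq0.
by apply/eqP; rewrite eq_le h l2sq_ge0.
Qed.

HB.instance Definition _ :=
  Lmodule_isNormed.Build C l2 l2norm_triangle l2normZ l2norm_eq0.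

Lemma nrm_l2 (f : l2) : nrm f ^+ 2 = l2sq f.
Proof.
have -> : nrm f = Num.sqrt (l2sq f) by [].
by rewrite sqr_sqrtr ?l2sq_ge0.
Qed.

End L2.

(** * Completeness and Hilbert structure of the sequence space *)

Section Completeness.
Variable R : realType.

Lemma real_cauchy (u : nat -> R) :
  (forall e : R, 0 < e -> exists N, forall m n, (N <= m)%N -> (N <= n)%N ->
     `|u m - u n| < e) ->
  exists l, forall e : R, 0 < e -> exists N, forall n, (N <= n)%N -> `|u n - l| < e.
Proof.
move=> h; have /cauchy_cvgP/cvg_ex[l ul] : cauchy (u @ \oo).
  apply/cauchy_ballP => e e0; have [N hN] := h _ e0.
  exists ([set u n | n in [set n | (N <= n)%N]],
          [set u n | n in [set n | (N <= n)%N]]) => /=.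
    by split; exists N => // n Nn; exists n.
  by move=> [_ _] /= [[m Nm <-] [n Nn <-]]; rewrite -ball_normE; exact: hN.
exists l => e e0; have /cvg_ballP/(_ _ e0) [N _ hN] := ul.
by exists N => n /hN; rewrite /= -ball_normE /= distrC.
Qed.

Lemma nrm_le_Re_Im (z : R[i]) : nrm z <= `|complex.Re z| + `|complex.Im z|.
Proof.
rewrite {1}[z]complexE; apply: le_trans (nrmD _ _) _.
rewrite nrmM !nrm_real.
suff -> : nrm ('i%C : R[i]) = 1 by rewrite mul1r.
by rewrite /nrm normc_def /= expr0n add0r expr1n sqrtr1.
Qed.

Lemma abs_Re_le (z : R[i]) : `|complex.Re z| <= nrm z.
Proof. by have := normc_ge_Re z; rewrite nrmE lecR. Qed.

Lemma abs_Im_le (z : R[i]) : `|complex.Im z| <= nrm z.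
Proof.
have h : (nrm z) ^+ 2 = complex.Re z ^+ 2 + complex.Im z ^+ 2.
  by apply: (@complexI R); rewrite rmorphXn /= -nrmE -add_Re2_Im2.
rewrite -(@ler_pXn2r _ 2) ?nnegrE ?nrm_ge0 // real_normK ?num_real // h.
by rewrite lerDr sqr_ge0.
Qed.

Lemma complex_cauchy (u : nat -> R[i]^o) :
  (forall e : R, 0 < e -> exists N, forall m n, (N <= m)%N -> (N <= n)%N ->
     nrm (u m - u n) < e) -> exists l, lim_to u l.
Proof.
move=> h.
have [|a ha] := real_cauchy (u := fun n => complex.Re (u n)).
  move=> e /h[N hN]; exists N => m n Nm Nn; apply: le_lt_trans (hN _ _ Nm Nn).
  by apply: le_trans (abs_Re_le _); rewrite ReD ReN.
have [|b hb] := real_cauchy (u := fun n => complex.Im (u n)).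
  move=> e /h[N hN]; exists N => m n Nm Nn; apply: le_lt_trans (hN _ _ Nm Nn).
  by apply: le_trans (abs_Im_le _); case: (u m) => ? ?; case: (u n).
exists (a +i* b)%C => e e0; have e2 : 0 < e / 2 by rewrite divr_gt0.
have [N hN] := ha _ e2; have [N' hN'] := hb _ e2.
exists (maxn N N') => n; rewrite geq_max => /andP[/hN h1 /hN' h2].
apply: le_lt_trans (nrm_le_Re_Im _) _.
have -> : complex.Re (u n - (a +i* b)%C) = complex.Re (u n) - a by case: (u n).
have -> : complex.Im (u n - (a +i* b)%C) = complex.Im (u n) - b by case: (u n).
lra.
Qed.

(** A Cauchy filter contains balls of radius [1 / (n + 1)]; their centres form a Cauchy sequence,
    and its limit is a limit of the filter. *)
Lemma seq_complete (V : normedModType R[i]) :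
  (forall u : nat -> V, (forall e : R, 0 < e -> exists N, forall m n,
      (N <= m)%N -> (N <= n)%N -> nrm (u m - u n) < e) ->
    exists l, lim_to u l) ->
  forall F : set_system V, ProperFilter F -> cauchy F -> cvg F.
Proof.
move=> h F PF /cauchyP cF.
have ep n : 0 < ((n.+1%:R^-1 : R)%:C%C : R[i]) by rewrite ltcR invr_gt0.
have /boolp.choice[x hx] n : exists x : V, F (ball x ((n.+1%:R^-1 : R)%:C%C : R[i])).
  exact: cF.
have small e : 0 < e -> exists N, forall n, (N <= n)%N -> n.+1%:R^-1 < e :> R.
  by move=> e0; have [N _ hN] := near_infty_natSinv_lt (PosNum e0); exists N.
have ballE (z w : V) (r : R) : ball z (r%:C%C : R[i]) w -> nrm (z - w) < r.
  by rewrite -ball_normE /= nrmE ltcR.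
have [|l hl] := h x.
  move=> e e0; have e2 : 0 < e / 2 by rewrite divr_gt0.
  have [N hN] := small _ e2; exists N => m n /hN hm /hN hn.
  have [w [wm wn]] := filter_ex (filterI (hx m) (hx n)).
  have -> : x m - x n = (x m - w) - (x n - w) by rewrite opprB addrA subrK.
  apply: le_lt_trans (nrmD _ _) _; rewrite nrmN.
  have := lt_trans (ballE _ _ _ wm) hm; have := lt_trans (ballE _ _ _ wn) hn; lra.
apply/cvg_ex; exists l; apply/cvg_ballP => e e0.
have re0 : 0 < complex.Re e by move: e0; rewrite ltcE => /andP[].
have e2 : 0 < complex.Re e / 2 by rewrite divr_gt0.
have [N hN] := small _ e2; have [N' hN'] := hl _ e2.
pose n := maxn N N'; apply: filterS (hx n) => w /ballE hw.
rewrite -[e]RRe_real ?gtr0_real //; apply: ball_nrm.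
have -> : l - w = (x n - w) - (x n - l) by rewrite opprB [RHS]addrC addrA subrK.
apply: le_lt_trans (nrmD _ _) _; rewrite nrmN.
have := lt_trans hw (hN n (leq_maxl _ _)); have := hN' n (leq_maxr _ _); lra.
Qed.

Lemma l2_coord (f : l2 R) k : nrm (f k) <= nrm f.
Proof.
rewrite -(@ler_pXn2r _ 2) ?nnegrE ?nrm_ge0 // nrm_l2.
apply: le_trans (sqsum_l2sq f k.+1).
by rewrite /sqsum big_nat_recr //= lerDr sumr_ge0 // => j _; exact: sqr_ge0.
Qed.

Lemma l2_complete (F : set_system (l2 R)) : ProperFilter F -> cauchy F -> cvg F.
Proof.
apply: seq_complete => u hu.
have /boolp.choice[f hf] k : exists l, lim_to (fun n => u n k) l.
  apply: complex_cauchy => e /hu[N hN]; exists N => m n Nm Nn.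
  by apply: le_lt_trans (hN _ _ Nm Nn); exact: (l2_coord (u m - u n) k).
pose g n : nat -> R[i]^o := fun k => u n k - f k.
have near e : 0 < e -> exists N, forall n, (N <= n)%N -> forall K,
    sqsum (g n) K <= (2 * e) ^+ 2.
  move=> e0; have [N hN] := hu _ e0; exists N => n Nn K.
  (* [m] is taken so late that each of the first [K] coordinates is within [e / K1] of its limit;
     their squares then sum to at most [e ^+ 2]. *)
  pose K1 : R := K%:R + 1.
  have K10 : 0 < K1 by rewrite ltr_wpDl.
  have eK : 0 < e / K1 by rewrite divr_gt0.
  have [m Nm hm] : exists2 m, (N <= m)%N &
      forall m', (m <= m')%N -> forall k, (k < K)%N -> nrm (u m' k - f k) <= e / K1.
    elim: (K) => [|j [m Nm hm]]; first by exists N.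
    have [m' hm'] := hf j _ eK; exists (maxn m m') => [|i].
      by rewrite leq_max Nm.
    rewrite geq_max => /andP[mi m'i] k; rewrite ltnS leq_eqVlt => /orP[/eqP ->|kj].
      by rewrite ltW // hm'.
    exact: hm.
  have -> : g n = l2val (u n - u m) + g m.
    by apply/funext => k; rewrite /g /= [RHS]addrA subrK.
  apply: le_trans (sqsumD _ _ _ ltr01) _; rewrite invr1.
  have h1 : sqsum (u n - u m : l2 R) K <= e ^+ 2.
    apply: le_trans (sqsum_l2sq _ _) _; rewrite -nrm_l2.
    by rewrite ler_pXn2r ?nnegrE ?nrm_ge0 ?(ltW e0) // ltW // hN.
  have h2 : sqsum (g m) K <= e ^+ 2.
    apply: (@le_trans _ _ (\sum_(0 <= k < K) (e / K1) ^+ 2)).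
      rewrite /sqsum !big_nat; apply: ler_sum => k /andP[_ kK].
      by rewrite ler_pXn2r ?nnegrE ?nrm_ge0 ?(ltW eK) // hm.
    rewrite sumr_const_nat subn0 -mulr_natl exprMn exprVn mulrCA ger_pMr ?exprn_gt0 //.
    rewrite ler_pdivrMr ?exprn_gt0 // mul1r /K1 expr2; have := ler0n R K; nra.
  by have := sqr_ge0 e; nra.
have gP n : (exists B, forall K, sqsum (g n) K <= B) -> g n \in @sqsummable R.
  by move=> h; apply/asboolP.
have [N0 hN0] := near 1 ltr01.
have g0 : g N0 \in @sqsummable R by apply: gP; exists ((2 * 1) ^+ 2); exact: hN0.
(* The limit has coordinates [f]; writing it as a difference of summable sequences makes it an
   element of [l2]. *)
exists (u N0 - L2 g0) => e e0; have e4 : 0 < e / 4 by rewrite divr_gt0.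
have [N hN] := near _ e4; exists N => n Nn.
suff h : nrm (u n - (u N0 - L2 g0)) ^+ 2 <= (e / 2) ^+ 2.
  rewrite ler_pXn2r ?nnegrE ?nrm_ge0 // in h; last by lra.
  lra.
rewrite nrm_l2; apply: l2sq_le => K.
have -> : l2val (u n - (u N0 - L2 g0)) = g n.
  apply/funext => k.
  by rewrite -[LHS]/(u n k - (u N0 k - (u N0 k - f k))) subKr.
by apply: le_trans (hN n Nn K) _; rewrite (_ : 2 * (e / 4) = e / 2) //; lra.
Qed.

HB.instance Definition _ := Uniform_isComplete.Build (l2 R) l2_complete.

Lemma l2ip_bilinear : bilinear_for ( *%R : R[i] -> _ -> _ )
  ((@Num.conj R[i]) \; *%R) (@l2ip R).
Proof.
split=> [g a f f'|f a g g']; first exact: l2ip_linl.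
by rewrite l2ipC l2ip_linl rmorphD rmorphM /= -!l2ipC.
Qed.

HB.instance Definition _ := bilinear_isBilinear.Build R[i] (l2 R) (l2 R) R[i]
  ( *%R : R[i] -> _ -> _ ) ((@Num.conj R[i]) \; *%R) (@l2ip R) l2ip_bilinear.

Lemma l2ip_hermitian (f g : l2 R) :
  l2ip f g = (-1) ^+ false * Num.conj (l2ip g f).
Proof. by rewrite expr0 mul1r; exact: l2ipC. Qed.

HB.instance Definition _ := isHermitianSesquilinear.Build R[i] (l2 R) false
  (@Num.conj R[i]) (@l2ip R) l2ip_hermitian.

Lemma l2ip_pos (f : l2 R) : f != 0 -> 0 < l2ip f f.
Proof.
move=> f0; rewrite l2ipxx ltcR lt_def l2sq_ge0 andbT.
by apply: contra f0 => /eqP/l2sq_eq0 ->.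
Qed.

HB.instance Definition _ := isDotProduct.Build R[i] (l2 R) (@l2ip R) l2ip_pos.

Lemma l2_inner_norm (f : l2 R) : `|f| ^+ 2 = l2ip f f.
Proof. by rewrite l2ipxx nrmE -rmorphXn nrm_l2. Qed.

HB.instance Definition _ := NormedModule_isHilbert.Build R[i] (l2 R) l2_inner_norm.

End Completeness.

(** * A module of countable rank with full support *)

Section L2Module.
Variable R : realType.
Implicit Types (p q : pred nat) (f h : l2 R).

Lemma mask_sqsum p (f : nat -> R[i]^o) n :
  sqsum (fun k => if p k then f k else 0) n <= sqsum f n.
Proof.
apply: ler_sum => k _; case: (p k) => //.
by rewrite nrm0 expr0n sqr_ge0.
Qed.

Lemma mask_summable p f : (fun k => if p k then f k else 0) \in @sqsummable R.
Proof.
have /asboolP[B hB] := l2P f; apply/asboolP; exists B => n.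
exact: le_trans (mask_sqsum _ _ _) (hB n).
Qed.

Definition mask p f : l2 R := L2 (mask_summable p f).

Lemma l2_eq f h : (forall k, f k = h k) -> f = h.
Proof. by move=> e; apply/val_inj/funext. Qed.

Lemma l2D f h k : (f + h) k = f k + h k. Proof. by []. Qed.
Lemma l2Z (a : R[i]) f k : (a *: f) k = a * f k. Proof. by []. Qed.
Lemma l2N f k : (- f) k = - f k. Proof. by []. Qed.

Lemma nrm_mask p f : nrm (mask p f) <= nrm f.
Proof.
rewrite -(@ler_pXn2r _ 2) ?nnegrE ?nrm_ge0 // !nrm_l2; apply: l2sq_le => n.
exact: le_trans (mask_sqsum _ _ _) (sqsum_l2sq _ _).
Qed.

Lemma bop_mask p : bop (mask p).
Proof.
split=> [a f h|].
  apply: l2_eq => k.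
  rewrite -[LHS]/(if p k then a * f k + h k else 0).
  rewrite -[RHS]/(a * (if p k then f k else 0) + (if p k then h k else 0)).
  by case: (p k); rewrite ?mulr0 ?addr0.
by exists 1 => // f; rewrite mul1r nrm_mask.
Qed.

Lemma mask_adjoint p : is_adjoint (mask p) (mask p).
Proof.
move=> f h; apply: (@lim_to_unique _ R[i]^o) (l2ipP _ _) _.
have := l2ipP f (mask p h); congr lim_to; apply/funext => n.
apply: eq_bigr => k _ /=; case: (p k) => //; by rewrite rmorph0 mul0r mulr0.
Qed.

Lemma delta_summable n : (fun k => (k == n)%:R : R[i]^o) \in @sqsummable R.
Proof.
apply/asboolP; exists 1 => m; rewrite /sqsum big_mkord.
case: (ltnP n m) => [nm|mn].
  rewrite (bigD1 (Ordinal nm)) //= eqxx nrm1 expr1n big1 ?addr0 // => i ni.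
  rewrite (_ : (i == n :> nat) = false) ?nrm0 ?expr0n //.
  by apply/negbTE; apply: contra ni => /eqP e; apply/eqP/val_inj.
rewrite big1 // => i _; rewrite (_ : (i == n :> nat) = false) ?nrm0 ?expr0n //.
by rewrite ltn_eqF // (leq_trans (ltn_ord i)).
Qed.

Definition delta n : l2 R := L2 (delta_summable n).

Lemma ip_delta m n : ip (delta m) (delta n) = (m == n)%:R.
Proof.
apply: (@lim_to_unique _ R[i]^o) (l2ipP _ _) _; apply: lim_to_const.
exists m.+1 => j mj; rewrite /psum big_mkord (bigD1 (Ordinal mj)) //= eqxx mul1r.
rewrite rmorph_nat big1 ?addr0 // => i im.
rewrite (_ : (i == m :> nat) = false) ?mul0r //.
by apply/negbTE; apply: contra im => /eqP e; apply/eqP/val_inj.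
Qed.

Lemma mask_lt_sum f N : mask (fun k => (k < N)%N) f = \sum_(k < N) f k *: delta k.
Proof.
elim: N => [|N IH]; first by rewrite big_ord0; exact: l2_eq.
rewrite big_ord_recr -IH; apply: l2_eq => k; rewrite l2D l2Z /= ltnS leq_eqVlt.
have [->|kN] := eqVneq k N; first by rewrite ltnn add0r mulr1.
by rewrite mulr0 addr0.
Qed.

Lemma mask_lt_cvg f (e : R) : 0 < e -> exists N, nrm (f - mask (fun k => (k < N)%N) f) < e.
Proof.
move=> e0; have e2 : 0 < (e / 2) ^+ 2 by rewrite exprn_gt0 // divr_gt0.
have [_ [N _ <-] hN] := sup_adherent e2 (l2_has_sup f).
exists N; have : nrm (f - mask (fun k => (k < N)%N) f) ^+ 2 <= (e / 2) ^+ 2.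
  rewrite nrm_l2; apply: l2sq_le => n.
  have [nN|/ltnW Nn] := leqP n N.
    rewrite /sqsum big_nat big1 ?sqr_ge0 // => k /andP[_ kn].
    by rewrite l2D l2N /= (leq_trans kn nN) subrr nrm0 expr0n.
  have hn := sqsum_l2sq f n; rewrite -/(l2sq f) in hN.
  have : sqsum f n = sqsum f N + sqsum (f - mask (fun k => (k < N)%N) f) n.
    rewrite /sqsum !(big_cat_nat (n := N) (m := 0) (p := n)) //=.
    rewrite [X in _ = _ + (X + _)]big_nat [X in _ = _ + (X + _)]big1 ?add0r; last first.
      move=> k /andP[_ kN].
      by rewrite -[X in nrm X]/(f k - if (k < N)%N then f k else 0) kN subrr nrm0 expr0n.
    congr (_ + _); rewrite !big_nat; apply: eq_bigr => k /andP[Nk _].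
    rewrite -[X in _ = nrm X ^+ 2]/(f k - if (k < N)%N then f k else 0).
    by rewrite ltnNge Nk /= subr0.
  lra.
rewrite ler_pXn2r ?nnegrE ?nrm_ge0 //; [lra|by rewrite divr_ge0 // ltW].
Qed.

Lemma dense_span_delta (S : set (l2 R)) : (forall n, S (delta n)) ->
  dense (lin_span S).
Proof.
move=> hS; apply: approx_dense => f e e0; have [N hN] := mask_lt_cvg f e0.
exists (mask (fun k => (k < N)%N) f) => //.
by exists N, (fun i : 'I_N => f i), (fun i : 'I_N => delta i); split=> //; exact: mask_lt_sum.
Qed.

Lemma delta_basis : orthonormal_basis (range delta).
Proof.
split; last by apply: dense_span_delta => n; exists n.
move=> _ _ [m _ <-] [n _ <-]; rewrite ipE ip_delta; congr (_%:R).
case: (eqVneq m n) => [->|mn]; first by rewrite eqxx.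
case: (eqVneq (delta m) (delta n)) => // dmn.
have : ip (delta m) (delta n) = 1 by rewrite dmn ip_delta eqxx.
by rewrite ip_delta (negbTE mn) => /eqP; rewrite eq_sym oner_eq0.
Qed.

(** [A] acts as multiplication by the indicator of its preimage under [g]. The basis [delta] is
    countable, so the rank is within every infinite bound. *)
Lemma exists_full_support_module (k : rank_bound) (X : coarseSpace) (g : nat -> X) :
  (forall x, exists n, g n = x) ->
  exists M : Aobj R k X, forall x, exists v, ind M [set x] v != 0.
Proof.
move=> gs; pose p (A : set X) : pred nat := fun n => `[< A (g n) >].
have /boolp.choice[P hP] (A : set X) : exists b : bounded_op (l2 R) (l2 R),
    b = mask (p A) :> (l2 R -> l2 R).
  exact: bop_bounded_opE (bop_mask (p A)).
have PE A f n : P A f n = if `[< A (g n) >] then f n else 0 by rewrite hP.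
have h1 A : is_projection (P A).
  rewrite hP; split; first exact: mask_adjoint.
  by move=> f; apply: l2_eq => n /=; case: (p A n).
have h2 v : P set0 v = 0 by apply: l2_eq => n; rewrite PE asboolF.
have h3 v : P setT v = v by apply: l2_eq => n; rewrite PE asboolT.
have h4 A B v : P (A `&` B) v = P A (P B v).
  apply: l2_eq => n; rewrite !PE asbool_and.
  by case: `[< A _ >]; case: `[< B _ >].
have h5 A B v : P (A `|` B) v = P A v + P B v - P A (P B v).
  apply: l2_eq => n; rewrite !(l2D, l2N) !PE asbool_or.
  by case: (`[< A (g n) >]); case: (`[< B (g n) >]);
    rewrite /= ?addrK ?subr0 ?addr0 ?add0r.
have h6 A v : P (~` A) v = v - P A v.
  apply: l2_eq => n; rewrite !(l2D, l2N) !PE asbool_neg.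
  by case: `[< A _ >]; rewrite ?subr0 ?subrr.
have Pd n : P [set g n] (delta n) = delta n.
  apply: l2_eq => m; rewrite PE /=; case: eqVneq => [->|mn].
    by rewrite asboolT.
  by case: ifP.
have h7 : exists2 E, @gauge X E &
    dense (lin_span (\bigcup_(A in [set A | rel_bounded E A]) range (P A))).
  exists diagonal.
    split=> //; first exact: ent_diag.
    by apply/seteqP; split=> -[a b] /= /diagonalP h; apply/diagonalP.
  apply: dense_span_delta => n; exists [set g n].
    by move=> [a b] [/= -> ->]; apply/diagonalP.
  by exists (delta n) => //; exact: Pd.
pose M := CoarseModule h1 h2 h3 h4 h5 h6 h7.
have rM : satisfies_rank k M.
  case: k => //= K iK; exists (range delta); first exact: delta_basis.
  apply: card_le_trans (_ : ([set: nat] #<= _)%card); first exact: card_image_le.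
  exact/infiniteP.
exists (AObj rM) => x; have [n <-] := gs x; exists (delta n).
rewrite -[ind _ _ _]/(P [set g n] (delta n)) Pd -nrm_eq0 -sqrf_eq0.
have -> : nrm (delta n) ^+ 2 = 1 by apply: (@complexI R); rewrite -ipxx ip_delta eqxx rmorph1.
exact: oner_neq0.
Qed.

End L2Module.

(** Each component is a countable union of neighbourhoods of one of its points, finite by local
    finiteness. *)
Lemma coarse_enumeration (X : coarseSpace) (x0 : X) : locally_finite X ->
  countably_generated X -> countable (coarse_components X) ->
  exists g : nat -> X, forall x, exists n, g n = x.
Proof.
move=> lf /countably_generated_cofinal[E [eE _ cof]] cc.
have : countable [set: X].
  pose A c := \bigcup_n thicken (E n) [set xget x0 c].
  apply: (@sub_countable _ _ _ (\bigcup_(c in coarse_components X) A c)).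
    apply: subset_card_le => x _; pose c := [set y | ent X [set (x, y)]].
    exists c; first by exists x.
    have cx : c x by exact: compxx.
    have : c (xget x0 c) by apply: (@xgetPex _ x0 c); exists x.
    by move=> /cof[n hn]; exists n => //; exists (xget x0 c) => //; exact: hn.
  apply: bigcup_countable => // c _; apply: bigcup_countable => // n _.
  by apply: finite_set_countable; exact: finite_thicken.
move=> /countable_injP[h hinj].
exists (fun n => xget x0 [set x | h x = n]) => x; exists (h x).
apply: hinj; rewrite ?in_setT //.
by have := @xgetPex _ x0 [set z | h z = h x]; apply; exists x.
Qed.

(** * Assembly of the coarse embedding *)

Lemma coarse_embedding_of (X Y : coarseSpace) (f : X -> Y) :
  (forall E, ent X E -> exists2 F, ent Y F & forall x x', E (x, x') -> F (f x, f x')) ->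
  (forall F, ent Y F -> exists2 E, ent X E & forall x x', F (f x, f x') -> E (x, x')) ->
  coarse_embedding f.
Proof.
move=> fc fe; split.
  move=> E /fc[F eF hF]; apply: ent_sub eF => _ [_ [[x x'] Exx' <-] <-] /=.
  exact: hF.
have /boolp.choice[g hg] (z : {y | range f y}) : exists x, f x = sval z.
  by have [x _ fx] := svalP z; exists x.
exists g; split.
- move=> F eF; have [E eE hE] := fe _ eF; apply: ent_sub eE.
  by move=> _ [[z z'] Fz <-] /=; apply: hE; rewrite !hg; exists (z, z').
- move=> F; rewrite /ent /= /induced_ent /= => eF.
  by apply: ent_sub eF => _ [_ [[z z'] Fz <-] <-] /=; rewrite hg; exists (z, z').
- move=> E /fc[F /fe[E' eE' hE'] hF]; apply: ent_sub eE'.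
  by move=> _ [[x x'] Exx' <-] /=; apply: hE'; rewrite hg; exact: hF.
Qed.

Lemma prod_ent (X Y : coarseSpace) (F : set (Y * Y)) (E : set (X * X)) :
  ent Y F -> ent X E -> ent (prod_coarse Y X) (prod_rel F E).
Proof. by move=> eF eE S [_]; apply; exists F => //; exists E. Qed.

Theorem theorem0p1 (R : realType) (k : rank_bound) (X Y : coarseSpace)
  (X_lf : locally_finite X) (Y_lf : locally_finite Y)
  (X_cg : countably_generated X) (Y_cg : countably_generated Y)
  (X_comp : countable (coarse_components X))
  (Y_comp : countable (coarse_components Y))
  (Phi : star_functor R k X Y)
  (Phi_full : full_functor Phi) (Phi_faithful : faithful_functor Phi) :
  exists f : X -> Y, coarse_embedding f /\
    forall (C : Aobj R k X), faithful_module C ->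
    forall (U : bounded_op C (Phi C)), unitary_op U ->
    (forall (t : Amor C C) (Ustar : bounded_op (Phi C) C),
       is_adjoint U Ustar -> fmor Phi t =1 U \o t \o Ustar) ->
    forall delta : R, 0 < delta < 1 ->
    exists2 F0 : set (Y * Y), ent Y F0 &
    exists2 E0 : set (X * X), ent X E0 &
    forall (F : set (Y * Y)) (E : set (X * X)), ent Y F -> ent X E ->
      F0 `<=` F -> E0 `<=` E ->
      @asymp_eq (prod_coarse Y X)
        (approx_relation U delta F E) [set (f x, x) | x in [set: X]].
Proof.
(* An enumeration of [X] by [nat] needs a point, so the empty space is treated apart. *)
have [[x0 _]|empty] := pselect (exists x : X, True); last first.
  have noX (x : X) : False by apply: empty; exists x.
  exists (fun x => False_rect Y (noX x)); split.
    apply: coarse_embedding_of => [E _|F _]; last first.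
      by exists set0; [exact: ent_set0|move=> x].
    by exists set0; [exact: ent_set0|move=> x].
  move=> C _ U _ _ d _; exists set0; first exact: ent_set0.
  exists set0; first exact: ent_set0.
  move=> F E _ _ _ _; split; exists set0; try exact: ent_set0.
    by move=> [y x].
  by move=> _ [x _ <-].
have [g gs] := coarse_enumeration x0 X_lf X_cg X_comp.
have [M hM] := exists_full_support_module R k gs.
have [EX EX_cof] := countably_generated_cofinal X_cg.
have [EY EY_cof] := countably_generated_cofinal Y_cg.
have /boolp.choice[e he] x : exists e : M, nrm e = 1 /\ ind M [set x] e = e.
  have [v nz] := hM x; exists (((nrm (ind M [set x] v))^-1)%:C%C *: ind M [set x] v).
  by split; [exact: normalize|rewrite (bopZ (bop_ind _ _)) ind_idem].
have le x : Loc x (e x).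
  by have [_] := he x; apply: Loc_bounded => _ ->; exact: compxx.
have /boolp.choice[xi hxi] x : exists xi : Phi M, nrm xi = 1 /\ ph (rk (e x) (e x)) xi = xi.
  by have [e1 _] := he x; have [xi ? ?] := exists_xi X_lf Phi_faithful e1 (le x); exists xi.
have fr : frame setT e xi.
  by split=> x _; [have [] := he x|have [] := he x|have [] := hxi x|have [] := hxi x].
have t0 : 0 < (10^-1 : R) by rewrite invr_gt0.
have [F1 F1_ent hF1] := concentration X_lf Y_lf Phi_full EX_cof EY_cof fr t0.
have /boolp.choice[G hG] x : exists G, [/\ finite_set G, rel_bounded F1 G,
    nrm (ind (Phi M) (~` G) (xi x)) <= 10^-1 &
    forall y, G y -> ind (Phi M) [set y] (xi x) != 0] by exact: hF1.
have G_fin x : finite_set (G x) by have [] := hG x.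
have G_bd x : rel_bounded F1 (G x) by have [] := hG x.
have G_mass x : nrm (ind (Phi M) (~` G x) (xi x)) <= 10^-1 by have [] := hG x.
have G_nz x y : G x y -> ind (Phi M) [set y] (xi x) != 0 by have [_ _ _] := hG x; exact.
have /boolp.choice[f Gf] x : exists y, G x y.
  apply: contrapT => h; have := G_mass x.
  have -> : ~` G x = setT by apply/seteqP; split=> // y _ Gy; apply: h; exists y.
  by rewrite indT (frame_xi1 fr) // leNgt invf_lt1 ?ltr1n.
have coarse := f_coarse X_lf Y_lf Phi_full EY_cof fr F1_ent G_bd G_mass G_nz Gf.
exists f; split.
  apply: coarse_embedding_of => [E eE|F eF]; first exact: coarse.
  exact: (f_expanding X_lf Y_lf Phi_full EX_cof fr F1_ent G_fin G_bd G_mass G_nz Gf).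
move=> C fC U [V [UV VU _]] hU d /andP[d0 d1].
have implements (t : C -> C) : aprx t -> ph t =1 U \o t \o V.
  by move=> /aprx_Amor[m <-] v; rewrite ph_fmor; exact: hU.
have bU : bop U by exact: bop_bounded_op.
have [F0 eF0 [E1 eE1 hE1]] :=
  relation_large X_lf Y_lf Phi_full EX_cof EY_cof bU UV VU implements fC d0 d1.
(* On the [X] side only singletons must be bounded, hence the diagonal; [F0] admits the sets [B] of
   [relation_large]. *)
exists F0 => //; exists diagonal; first exact: ent_diag.
move=> F E eF eE F0F dE.
have [F' eF' hF'] := relation_near_graph X_lf Y_lf Phi_full EX_cof EY_cof fr
  F1_ent G_bd G_mass G_nz Gf bU UV VU implements eE eF d0 d1.
split.
  exists (prod_rel F' diagonal); first exact: prod_ent eF' (ent_diag X).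
  move=> [y x] [[B A] [/= bB bA big] [/= By Ax]].
  exists (f x, x); first by exists x.
  by split=> //=; exact: hF' bB bA big By Ax.
have [Fc eFc hFc] := coarse _ eE1.
(* From [f x] to [f x'] since [f] is coarse, and from [f x'] to [y] since [(y, x')] lies in the
   relation, hence near the graph. *)
exists (prod_rel (crel Fc F'^-1%relation) E1).
  by apply: prod_ent => //; apply: ent_comp => //; exact: ent_inv.
move=> _ [x _ <-]; have [x' [B [y [E1x bB By big]]]] := hE1 x.
have bx' : rel_bounded E [set x'] by move=> [a b] [/= -> ->]; exact: dE.
have bBF : rel_bounded F B by move=> p /bB /F0F.
exists (y, x'); first by exists (B, [set x']).
split=> //=; exists (f x'); first exact: hFc.
exact: hF' bBF bx' big By erefl.
Qed.
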